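(* Let $1<p<\infty$, $p\ne2$, and let $\mathcal{U}$ be a selective nonprincipal ultrafilter on $\mathbb{N}$. Then there are exactly four closed subspaces of $(L^{p})^{\mathcal{U}}$, other than $\{0\}$ and $(L^{p})^{\mathcal{U}}$, that are invariant under $T^{\mathcal{U}}$ for all $T\in B(L^{p})$, namely $L^{p}$, $\widehat{L^{p}}$, $M$ and $L^{p}\oplus M$. Here $M$ is the unique complemented closed subspace of $\widehat{L^{p}}$ such that an operator $S\in B((L^{p})^{\mathcal{U}})$ lies in the WOT closure of $\{T^{\mathcal{U}}:T\in B(L^{p})\}$ iff $S$ leaves $L^{p}$, $\widehat{L^{p}}$ and $M$ invariant; for $p>2$ one has $M=\{(f_n)_{n,\mathcal{U}}\in(L^{p})^{\mathcal{U}}:\lim_{n,\mathcal{U}}\|f_n\|_2=0\}$.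
   Context: $L^{p}=L^{p}([0,1],\mu)$, $\mu$ Lebesgue measure. $(L^{p})^{\mathcal{U}}$ is the ultrapower (bounded sequences modulo those with $\lim_{n,\mathcal{U}}\|f_n\|_p=0$), $(f_n)_{n,\mathcal{U}}$ the class of $(f_n)$, $T^{\mathcal{U}}(f_n)_{n,\mathcal{U}}=(Tf_n)_{n,\mathcal{U}}$. $L^p$ is identified with constant classes, $\widehat{L^{p}}=\{(f_n)_{n,\mathcal{U}}:w\text{-}\lim_{n,\mathcal{U}}f_n=0\}$, and $(L^{p})^{\mathcal{U}}=L^{p}\oplus\widehat{L^{p}}$. An ultrafilter $\mathcal{U}$ on $\mathbb{N}$ is selective if (1) for every sequence $A_1,A_2,\dots$ in $\mathcal{U}$ there is $A\in\mathcal{U}$ with $A\setminus A_k$ finite for each $k$; and (2) for every partition of $\mathbb{N}$ into finite sets $A_1,A_2,\dots$ there is $A\in\mathcal{U}$ with $A\cap A_k$ a singleton for each $k$. *)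

(* Defs.v *)
From HB Require Import structures.
From mathcomp Require Import all_boot all_order all_algebra.
From mathcomp Require Import all_classical all_reals all_analysis.
Import Order.TTheory GRing.Theory Num.Theory.
Import numFieldNormedType.Exports.
Local Open Scope classical_set_scope.
Local Open Scope ring_scope.

Lemma measurable_01 (R : realType) :
  measurable (`[0%R, 1%R] : set (measurableTypeR R)).
Proof. exact: measurable_itv. Qed.

Definition mu01 (R : realType) := mrestr (@lebesgue_measure R) (@measurable_01 R).

Definition is_ultrafilter (U : set (set nat)) : Prop :=
  [/\ U setT, ~ U set0,
      (forall A B, U A -> U B -> U (A `&` B)),
      (forall A B, A `<=` B -> U A -> U B) &
      (forall A, U A \/ U (~` A))].

Definition nonprincipal (U : set (set nat)) : Prop := forall n, ~ U [set n].

Definition selective (U : set (set nat)) : Prop :=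
  (forall A : nat -> set nat, (forall k, U (A k)) ->
     exists B, U B /\ forall k, finite_set (B `\` A k)) /\
  (forall A : nat -> set nat,
     (forall k, finite_set (A k)) -> (forall k, A k !=set0) ->
     (forall n, exists k, A k n) ->
     (forall k l, k <> l -> A k `&` A l = set0) ->
     exists B, U B /\ forall k, exists n, B `&` A k = [set n]).

Section UltraLp.
Context (R : realType).

Definition ulim_to (U : set (set nat)) (x : nat -> R) (l : R) : Prop :=
  forall e : R, 0 < e -> U [set n | `|x n - l| < e].

Definition ulim (U : set (set nat)) (x : nat -> R) : R :=
  xget 0 [set l | ulim_to U x l].

Context (p : R) (p1 : (1 <= p%:E)%E).

(* Representatives of elements of L^p = L^p([0,1], mu): measurable functions
   with finite p-norm (equality in L^p is equality mu01-a.e.). *)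
Notation Lf := (LfunType (mu01 R) p1).

Definition lpn (f : Lf) : R := fine ('N[mu01 R]_p%:E [EFin \o f]).
Definition l2n (f : Lf) : R := fine ('N[mu01 R]_(2%:E) [EFin \o f]).

Definition lp_op (T : Lf -> Lf) : Prop :=
  (forall (a : R) f g, lpn (T (a *: f + g) - (a *: T f + T g)) = 0) /\
  exists C : R, forall f, lpn (T f) <= C * lpn f.

Definition lp_func (phi : Lf -> R) : Prop :=
  (forall (a : R) f g, phi (a *: f + g) = a * phi f + phi g) /\
  exists C : R, forall f, `|phi f| <= C * lpn f.

Context (U : set (set nat)).

(* The ultrapower (L^p)^U: its elements are represented by bounded sequences,
   two sequences representing the same element iff their difference is unull. *)
Definition ubounded (F : nat -> Lf) : Prop := exists C : R, forall n, lpn (F n) <= C.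
Definition ubdd : set (nat -> Lf) := [set F | ubounded F].
Definition unorm (F : nat -> Lf) : R := ulim U (fun n => lpn (F n)).
Definition unull (F : nat -> Lf) : Prop := ulim_to U (fun n => lpn (F n)) 0.

Definition seq_add (F G : nat -> Lf) : nat -> Lf := fun n => F n + G n.
Definition seq_sub (F G : nat -> Lf) : nat -> Lf := fun n => F n - G n.
Definition seq_scale (a : R) (F : nat -> Lf) : nat -> Lf := fun n => a *: F n.

(* closed linear subspaces of (L^p)^U, as saturated sets of representatives *)
Definition usubspace (Y : set (nat -> Lf)) : Prop :=
  [/\ Y `<=` ubdd,
      Y (fun _ => 0),
      (forall (a : R) F G, Y F -> Y G -> Y (seq_add (seq_scale a F) G)),
      (forall F G, Y F -> ubounded G -> unull (seq_sub F G) -> Y G) &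
      (forall F, ubounded F ->
         (forall e : R, 0 < e -> exists G, Y G /\ unorm (seq_sub F G) < e) ->
         Y F)].

Definition uzero : set (nat -> Lf) := [set F | ubounded F /\ unull F].

Definition uLp : set (nat -> Lf) :=
  [set F | ubounded F /\ exists f : Lf, unull (seq_sub F (fun _ => f))].

Definition uhat : set (nat -> Lf) :=
  [set F | ubounded F /\ forall phi, lp_func phi -> ulim_to U (fun n => phi (F n)) 0].

Definition usum (Y Z : set (nat -> Lf)) : set (nat -> Lf) :=
  [set F | ubounded F /\ exists G H, [/\ Y G, Z H & unull (seq_sub F (seq_add G H))]].

Definition uop (S : (nat -> Lf) -> (nat -> Lf)) : Prop :=
  [/\ (forall F, ubounded F -> ubounded (S F)),
      (forall (a : R) F G, ubounded F -> ubounded G ->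
         unull (seq_sub (S (seq_add (seq_scale a F) G))
                       (seq_add (seq_scale a (S F)) (S G)))) &
      exists C : R, forall F, ubounded F -> unorm (S F) <= C * unorm F].

Definition ufunc (phi : (nat -> Lf) -> R) : Prop :=
  (forall (a : R) F G, ubounded F -> ubounded G ->
     phi (seq_add (seq_scale a F) G) = a * phi F + phi G) /\
  exists C : R, forall F, ubounded F -> `|phi F| <= C * unorm F.

Definition Tult (T : Lf -> Lf) : (nat -> Lf) -> (nat -> Lf) := fun F n => T (F n).

Definition wot_closure_ult (S : (nat -> Lf) -> (nat -> Lf)) : Prop :=
  forall (k : nat) (x : nat -> (nat -> Lf)) (phi : nat -> ((nat -> Lf) -> R))
         (e : R), 0 < e ->
    (forall i, (i < k)%N -> ubounded (x i) /\ ufunc (phi i)) ->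
    exists T, lp_op T /\
      forall i, (i < k)%N -> `|phi i (S (x i)) - phi i (Tult T (x i))| < e.

Definition uinvariant (Y : set (nat -> Lf)) (S : (nat -> Lf) -> (nat -> Lf)) :=
  forall F, Y F -> Y (S F).

Definition complemented_in_hat (M : set (nat -> Lf)) : Prop :=
  exists N, [/\ usubspace N, N `<=` uhat, usum M N = uhat & M `&` N = uzero].

Definition M_property (M : set (nat -> Lf)) : Prop :=
  [/\ usubspace M, M `<=` uhat, complemented_in_hat M &
      forall S, uop S ->
        (wot_closure_ult S <-> [/\ uinvariant uLp S, uinvariant uhat S & uinvariant M S])].

Definition uM2 : set (nat -> Lf) :=
  [set F | ubounded F /\ ulim_to U (fun n => l2n (F n)) 0].

End UltraLp.

Arguments ulim_to {R}.
Arguments ulim {R}.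
Arguments lpn {R p}.
Arguments l2n {R p}.
Arguments lp_op {R p}.
Arguments lp_func {R p}.
Arguments ubounded {R p}.
Arguments ubdd {R p}.
Arguments unorm {R p}.
Arguments unull {R p}.
Arguments seq_add {R p}.
Arguments seq_sub {R p}.
Arguments seq_scale {R p}.
Arguments usubspace {R p}.
Arguments uzero {R p}.
Arguments uLp {R p}.
Arguments uhat {R p}.
Arguments usum {R p}.
Arguments uop {R p}.
Arguments ufunc {R p}.
Arguments Tult {R p}.
Arguments wot_closure_ult {R p}.
Arguments uinvariant {R p}.
Arguments complemented_in_hat {R p}.
Arguments M_property {R p}.
Arguments uM2 {R p}.

(* Main.v *)
Require Import Defs.
From HB Require Import structures.
From mathcomp Require Import all_boot all_order all_algebra.
From mathcomp Require Import all_classical all_reals all_analysis measurable_realfun.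
From mathcomp Require Import ring lra.
Import Order.TTheory GRing.Theory Num.Theory.
Import numFieldNormedType.Exports.
Set Implicit Arguments.
Unset Strict Implicit.
Unset Printing Implicit Defensive.
Local Open Scope classical_set_scope.
Local Open Scope ring_scope.

(** A bounded sequence in L^p splits, by truncation at slowly growing levels, into
    a part with equi-integrable p-th powers and a part tending to 0 in L^1. Hence
    (L^p)^U = L^p + D + E, where D consists of the bounded sequences that tend to 0
    in L^1, and E of the weakly null ones with equi-integrable p-th powers. The dual
    pieces, with exponent q = p / (p - 1), separate the points of D and of E.

    Selectivity gives, on a set of U, an upper p-estimate for (an approximation of)
    a sequence of D, by almost disjointness, and an upper 2-estimate for one of E, by
    Riesz products; in the same way the functionals on D and E satisfy upper q- and
    2-estimates. Let phi have an upper s-estimate and y an upper t-estimate. If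
    1/s + 1/t <= 1, then the diagonal operator f |-> sum <phi n, f> y n over a sparse
    set of U is bounded on L^p, and its ultrapower approximates the rank-one map
    F |-> phi(F) y. If 1/s + 1/t < 1, then phi (T^U y) = 0 for all T in B(L^p), since
    a sum of k selected diagonal terms is O(k^(1/s + 1/t)). So every rank-one map
    inside D, inside E, and in one direction between D and E is approximated, whereas
    no T^U goes the other way: from D to E if p > 2, from E to D if p < 2. Thus M = D
    for p > 2 and M = E for p < 2, and an invariant subspace not killed by a
    functional contains the targets of the rank-one maps with that functional. *)

(** The exponents decide everything. A functional on D has s = q, on E s = 2; a target in D has t =
    p, in E t = 2. Inside D and inside E the sum 1/s + 1/t is exactly 1, the borderline where
    rank-one maps are approximated and nothing is obstructed. A functional on E with a target in D
    gives 1/2 + 1/p, a functional on D with a target in E gives 1/q + 1/2. For p other than 2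
    exactly one of these is below 1, and this one strict inequality yields both halves of the
    dichotomy: if phi lives on E and y in D, say, the map F |-> phi(F) y leads from E to D and is
    approximated, while phi (T^U y) = 0 keeps T^U from leading from D to E. Any set of U determines
    the class of a sequence, so restricting to a sparse set of U costs nothing; this is how
    selectivity enters. Weak limits along U, obtained from Riesz representation, replace norm
    convergence: they give the diagonal operators and the component in L^p. All subspaces are
    handled as annihilators of families of sequences in L^q, which makes them closed and lets
    invariance pass to WOT limits. *)

HB.lock Definition mean d (T : measurableType d) (R : realType)
  (P : probability T R) (f : T -> R) : R := \int[P]_x f x.
Arguments mean {d T R} P f.

HB.lock Definition mom d (T : measurableType d) (R : realType)
  (P : probability T R) (r : R) (f : T -> R) : R := mean P (fun x => `|f x| `^ r).
Arguments mom {d T R} P r f.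

HB.lock Definition nrm d (T : measurableType d) (R : realType)
  (P : probability T R) (r : R) (f : T -> R) : R := mom P r f `^ r^-1.
Arguments nrm {d T R} P r f.

(** * Means, moments and norms of real functions on a probability space *)

Section Integration.
Context d (T : measurableType d) (R : realType) (P : probability T R).
Implicit Types (f g h : T -> R) (r s a c : R).

Definition itg f := P.-integrable [set: T] (EFin \o f).
Local Notation mean := (mean P).
Local Notation mom := (mom P).
Local Notation nrm := (nrm P).

Lemma meanE f : mean f = \int[P]_x f x.
Proof. by rewrite mean.unlock. Qed.

Lemma momE r f : mom r f = mean (fun x => `|f x| `^ r).
Proof. by rewrite mom.unlock. Qed.

Lemma nrmE r f : nrm r f = mom r f `^ r^-1.
Proof. by rewrite nrm.unlock. Qed.

Lemma itg_meas f : itg f -> measurable_fun setT f.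
Proof. by move=> /integrableP[/measurable_EFinP]. Qed.

Lemma itg_dom f g : measurable_fun setT f -> (forall x, `|f x| <= g x) ->
  itg g -> itg f.
Proof.
move=> mf fg; apply: le_integrable => //; first exact/measurable_EFinP.
by move=> x _ /=; rewrite lee_fin (le_trans (fg x)) ?ler_norm.
Qed.

Lemma itg_cst c : itg (fun=> c).
Proof. exact: finite_measure_integrable_cst. Qed.

Lemma itgD f g : itg f -> itg g -> itg (fun x => f x + g x).
Proof.
by move=> itf ig; have := integrableD measurableT itf ig; apply: eq_integrable.
Qed.

Lemma itgZ a f : itg f -> itg (fun x => a * f x).
Proof.
by move=> itf; have := integrableZl measurableT a itf; apply: eq_integrable.
Qed.

Lemma itgN f : itg f -> itg (fun x => - f x).
Proof.
by move=> itf; have := integrableN itf; apply: eq_integrable.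
Qed.

Lemma itgB f g : itg f -> itg g -> itg (fun x => f x - g x).
Proof. by move=> itf ig; apply: itgD => //; apply: itgN. Qed.

Lemma itg_norm f : itg f -> itg (fun x => `|f x|).
Proof. exact: integrable_norm. Qed.

Lemma itg_sum I (l : seq I) (Q : pred I) (F : I -> T -> R) :
  (forall i, Q i -> itg (F i)) -> itg (fun x => \sum_(i <- l | Q i) F i x).
Proof.
move=> H; elim: l => [|a l IH].
  by under eq_fun do rewrite big_nil; exact: itg_cst.
under eq_fun do rewrite big_cons.
by move: (H a); case: (Q a) => [/(_ isT) Ha|//]; exact: itgD.
Qed.

Lemma itg_bounded f c : measurable_fun setT f -> (forall x, `|f x| <= c) -> itg f.
Proof. by move=> mf fc; apply: itg_dom mf fc (itg_cst c). Qed.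

Lemma meanD f g : itg f -> itg g -> mean (fun x => f x + g x) = mean f + mean g.
Proof. by rewrite !meanE; exact: RintegralD. Qed.

Lemma meanB f g : itg f -> itg g -> mean (fun x => f x - g x) = mean f - mean g.
Proof. by rewrite !meanE; exact: RintegralB. Qed.

Lemma meanZ a f : itg f -> mean (fun x => a * f x) = a * mean f.
Proof. by rewrite !meanE; exact: RintegralZl. Qed.

Lemma mean_cst c : mean (fun=> c) = c.
Proof. by rewrite !meanE Rintegral_cst// [X in fine X]probability_setT mulr1. Qed.

Lemma mean_sum I (l : seq I) (Q : pred I) (F : I -> T -> R) :
  (forall i, Q i -> itg (F i)) ->
  mean (fun x => \sum_(i <- l | Q i) F i x) = \sum_(i <- l | Q i) mean (F i).
Proof.
move=> H; elim: l => [|a l IH].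
  by under eq_fun do rewrite big_nil; rewrite big_nil mean_cst.
under eq_fun do rewrite big_cons; rewrite big_cons.
move: (H a); case: (Q a) => [/(_ isT) Ha|//]; rewrite meanD ?IH//.
exact: itg_sum.
Qed.

Lemma le_mean f g : itg f -> itg g -> (forall x, f x <= g x) -> mean f <= mean g.
Proof. by move=> itf ig fg; rewrite !meanE; apply: le_Rintegral. Qed.

Lemma mean_ge0 f : (forall x, 0 <= f x) -> 0 <= mean f.
Proof. by move=> f0; rewrite meanE; apply: Rintegral_ge0. Qed.

Lemma mean_dom f g : measurable_fun setT f -> (forall x, `|f x| <= g x) ->
  itg g -> `|mean f| <= mean g.
Proof.
move=> mf fg ig; have itf := itg_dom mf fg ig.
rewrite [mean f]meanE; apply: (le_trans (le_normr_Rintegral measurableT itf)).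
by rewrite -meanE; apply: le_mean => //; exact: itg_norm.
Qed.

Lemma mean_bounded f c : measurable_fun setT f -> (forall x, `|f x| <= c) ->
  `|mean f| <= c.
Proof. by move=> mf fc; rewrite -[c]mean_cst; apply: mean_dom => //; exact: itg_cst. Qed.

Lemma measurable_abs_powR f r : measurable_fun setT f ->
  measurable_fun setT (fun x => `|f x| `^ r).
Proof.
move=> mf; apply: (@measurableT_comp _ _ _ _ _ _ (@powR R ^~ r)) => //.
exact: measurableT_comp.
Qed.

Lemma measurable_abs f : measurable_fun setT f ->
  measurable_fun setT (fun x => `|f x|).
Proof. by move=> mf; exact: measurableT_comp. Qed.

Lemma measurable_scale a f : measurable_fun setT f ->
  measurable_fun setT (fun x => a * f x).
Proof. by move=> mf; apply: measurable_funM. Qed.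

Definition mL r f := measurable_fun setT f /\ itg (fun x => `|f x| `^ r).

Lemma mom_ge0 r f : 0 <= mom r f.
Proof. by rewrite momE; apply: mean_ge0 => x; exact: powR_ge0. Qed.

Lemma nrm_ge0 r f : 0 <= nrm r f.
Proof. by rewrite nrmE; exact: powR_ge0. Qed.

Lemma nrm_powR r f : 0 < r -> nrm r f `^ r = mom r f.
Proof. by move=> r0; rewrite nrmE -powRrM mulVf ?gt_eqF// powRr1// mom_ge0. Qed.

Lemma mL_dom r f g : 0 <= r -> measurable_fun setT f ->
  (forall x, `|f x| <= `|g x|) -> mL r g -> mL r f.
Proof.
move=> r0 mf fg [mg ig]; split => //; apply: itg_dom ig.
  exact: measurable_abs_powR.
move=> x; rewrite ger0_norm ?powR_ge0// ge0_ler_powR ?nnegrE//.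
Qed.

Lemma mL_bounded r f c : 0 <= r -> measurable_fun setT f ->
  (forall x, `|f x| <= c) -> mL r f.
Proof.
move=> r0 mf fc; split => //; apply: (@itg_bounded _ (c `^ r)).
  exact: measurable_abs_powR.
move=> x; rewrite ger0_norm ?powR_ge0// ge0_ler_powR ?nnegrE//.
exact: le_trans (fc x).
Qed.

Lemma mom_dom r f g : 0 <= r -> measurable_fun setT f ->
  (forall x, `|f x| <= `|g x|) -> mL r g -> mom r f <= mom r g.
Proof.
move=> r0 mf fg Lg; have [_ Lf] := mL_dom r0 mf fg Lg.
by rewrite !momE; apply: le_mean => //; [apply Lg|move=> x; rewrite ge0_ler_powR ?nnegrE].
Qed.

Lemma nrm_dom r f g : 0 < r -> measurable_fun setT f ->
  (forall x, `|f x| <= `|g x|) -> mL r g -> nrm r f <= nrm r g.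
Proof.
move=> r0 mf fg Lg; have r0' := ltW r0.
by rewrite !nrmE ge0_ler_powR ?nnegrE ?mom_ge0 ?invr_ge0//; exact: mom_dom.
Qed.

Lemma nrm_bounded r f c : 0 < r -> 0 <= c -> measurable_fun setT f ->
  (forall x, `|f x| <= c) -> nrm r f <= c.
Proof.
move=> r0 c0 mf fc; have r0' := ltW r0.
have -> : c = (c `^ r) `^ r^-1 by rewrite -powRrM divff ?gt_eqF// powRr1.
rewrite nrmE ge0_ler_powR ?nnegrE ?mom_ge0 ?invr_ge0 ?powR_ge0//.
rewrite momE -[X in _ <= X]mean_cst; apply: le_mean; last 2 first.
- exact: itg_cst.
- by move=> y; rewrite ge0_ler_powR ?nnegrE.
- by case: (mL_bounded (ltW r0) mf fc).
Qed.

Lemma LnormE r f : mL r f -> 'N[P]_r%:E[EFin \o f]%E = (nrm r f)%:E.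
Proof.
move=> [mf itf]; rewrite unlock nrmE -poweR_EFin momE meanE /Rintegral fineK//.
exact: integrable_fin_num.
Qed.

Lemma finite_norm_mL r f : r != 0 -> measurable_fun setT f ->
  finite_norm P r%:E f -> mL r f.
Proof.
move=> r0 mf; rewrite /finite_norm => fin; split => //; apply/integrableP; split.
  exact/measurable_EFinP/measurable_abs_powR.
rewrite (_ : (\int[P]_x _)%E = 'N[P]_r%:E[EFin \o f] `^ r)%E ?poweR_lty//.
rewrite powR_Lnorm//; apply: eq_integral => x _ /=.
by rewrite ger0_norm ?powR_ge0.
Qed.

Lemma mL_finite_norm r f : mL r f -> finite_norm P r%:E f.
Proof. by move=> Lf; rewrite /finite_norm LnormE// ltry. Qed.

Lemma mLD r f g : 1 <= r -> mL r f -> mL r g -> mL r (fun x => f x + g x).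
Proof.
move=> r1 Lf Lg; have [mf _] := Lf; have [mg _] := Lg.
apply: finite_norm_mL; first by rewrite gt_eqF// (lt_le_trans _ r1).
  exact: measurable_funD.
apply: le_lt_trans (minkowski_EFin _ mf mg r1) _.
by rewrite !LnormE// -EFinD ltry.
Qed.

Lemma nrmD r f g : 1 <= r -> mL r f -> mL r g ->
  nrm r (fun x => f x + g x) <= nrm r f + nrm r g.
Proof.
move=> r1 Lf Lg; have [mf _] := Lf; have [mg _] := Lg.
have := minkowski_EFin P mf mg r1.
by rewrite (LnormE Lf) (LnormE Lg) (LnormE (mLD r1 Lf Lg)) -EFinD lee_fin.
Qed.

Lemma mLZ r a f : mL r f -> mL r (fun x => a * f x).
Proof.
move=> [mf itf]; split; first exact: measurable_scale.
by under eq_fun do rewrite normrM powRM//; exact: itgZ.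
Qed.

Lemma momZ r a f : mL r f -> mom r (fun x => a * f x) = `|a| `^ r * mom r f.
Proof.
move=> [mf itf]; rewrite !momE.
by under eq_fun do rewrite normrM powRM//; exact: meanZ.
Qed.

Lemma nrmZ r a f : 0 < r -> mL r f -> nrm r (fun x => a * f x) = `|a| * nrm r f.
Proof.
move=> r0 Lf; rewrite !nrmE momZ// powRM ?powR_ge0 ?mom_ge0//.
by rewrite -powRrM divff ?gt_eqF// powRr1.
Qed.

Lemma mLN r f : mL r f -> mL r (fun x => - f x).
Proof. by move=> /(mLZ (-1)); under eq_fun do rewrite mulN1r. Qed.

Lemma nrmN r f : nrm r (fun x => - f x) = nrm r f.
Proof. by rewrite !nrmE !momE; under eq_fun do rewrite normrN. Qed.

Lemma mLB r f g : 1 <= r -> mL r f -> mL r g -> mL r (fun x => f x - g x).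
Proof. by move=> r1 Lf Lg; apply: mLD => //; exact: mLN. Qed.

Lemma nrmBC r f g : nrm r (fun x => f x - g x) = nrm r (fun x => g x - f x).
Proof. by rewrite -nrmN; congr nrm; apply/funext => x; rewrite opprB. Qed.

Lemma nrmB r f g : 1 <= r -> mL r f -> mL r g ->
  nrm r (fun x => f x - g x) <= nrm r f + nrm r g.
Proof. by move=> r1 Lf Lg; rewrite -[X in _ + X]nrmN; apply: nrmD => //; exact: mLN. Qed.

Lemma mL0 r : mL r (fun=> 0).
Proof. by split=> //; exact: itg_cst. Qed.

Lemma nrm0 r : 0 < r -> nrm r (fun=> 0) = 0.
Proof.
move=> r0; apply/eqP; rewrite eq_le nrm_ge0 andbT.
by apply: nrm_bounded => // x; rewrite normr0.
Qed.

Lemma mL_sum r I (l : seq I) (Q : pred I) (F : I -> T -> R) : 1 <= r ->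
  (forall i, Q i -> mL r (F i)) -> mL r (fun x => \sum_(i <- l | Q i) F i x).
Proof.
move=> r1 H; elim: l => [|a l IH].
  by under eq_fun do rewrite big_nil; exact: mL0.
under eq_fun do rewrite big_cons.
by move: (H a); case: (Q a) => [/(_ isT) Ha|//]; exact: mLD.
Qed.

Lemma mL1_itg f : mL 1 f <-> itg f.
Proof.
split=> [[mf]|itf]; last split; first 1 last; first exact: itg_meas.
  by under eq_fun do rewrite powRr1//; exact: itg_norm.
by under eq_fun do rewrite powRr1//; apply: itg_dom.
Qed.

Lemma nrm1E f : nrm 1 f = mean (fun x => `|f x|).
Proof.
rewrite !nrmE !momE invr1; under eq_fun do rewrite powRr1//.
by rewrite powRr1// mean_ge0.
Qed.

Definition conjg r s := [/\ 1 < r, 1 < s & r^-1 + s^-1 = 1].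

Lemma conjg_sym r s : conjg r s -> conjg s r.
Proof. by case=> ? ? rs; split=> //; rewrite addrC. Qed.

Lemma conjg_conj r : 1 < r -> conjg r (r / (r - 1)).
Proof.
move=> r1; have r0 : 0 < r by lra. have r2 : 0 < r - 1 by lra.
split=> //; first by rewrite ltr_pdivlMr//; lra.
by field; rewrite !gt_eqF.
Qed.

Lemma conjgE r s : conjg r s -> s = r / (r - 1).
Proof.
move=> [r1 s1 rs]; have r0 : 0 < r by lra. have r2 : 0 < r - 1 by lra.
have s0 : 0 < s by lra.
have : (r^-1 + s^-1) * (r * s) = r * s by rewrite rs mul1r.
rewrite mulrDl mulrA mulVf ?gt_eqF// mul1r mulrCA mulVf ?gt_eqF// mulr1 => h.
by rewrite -[LHS](mulfK (lt0r_neq0 r2)); congr (_ / _); lra.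
Qed.

Lemma hoelder_mean r s f g : conjg r s -> mL r f -> mL s g ->
  itg (fun x => f x * g x) /\ mean (fun x => `|f x * g x|) <= nrm r f * nrm s g.
Proof.
move=> [r1 s1 rs] Lf Lg; have [mf _] := Lf; have [mg _] := Lg.
have r0 : 0 < r by lra. have s0 : 0 < s by lra.
have H := hoelder P mf mg r0 s0 rs.
have mfg : measurable_fun setT (f \* g) by exact: measurable_funM.
have L1 : mL 1 (f \* g).
  apply: finite_norm_mL => //; apply: le_lt_trans H _.
  by rewrite !LnormE// -EFinM ltry.
split; first exact/mL1_itg.
move: H; rewrite !LnormE// -EFinM lee_fin nrm1E//.
Qed.

Lemma hoelder_pair r s f g : conjg r s -> mL r f -> mL s g ->
  `|mean (fun x => f x * g x)| <= nrm r f * nrm s g.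
Proof.
move=> c Lf Lg; have [i] := hoelder_mean c Lf Lg.
by apply: le_trans; rewrite !meanE; apply: le_normr_Rintegral.
Qed.

Lemma nrm_cst r c : 0 < r -> nrm r (fun=> c) = `|c|.
Proof. by move=> r0; rewrite !nrmE !momE mean_cst -powRrM divff ?gt_eqF// powRr1. Qed.

Lemma mL_cst r c : mL r (fun=> c).
Proof. by split=> //; exact: itg_cst. Qed.

Lemma mL_itg r f : 1 <= r -> mL r f -> itg f.
Proof.
rewrite le_eqVlt => /predU1P[<-/mL1_itg//|r1] Lf.
have [] := hoelder_mean (conjg_conj r1) Lf (mL_cst _ 1).
by under eq_fun do rewrite mulr1.
Qed.

Lemma nrm1_le r f : 1 <= r -> mL r f -> nrm 1 f <= nrm r f.
Proof.
rewrite le_eqVlt => /predU1P[<-//|r1] Lf.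
have [_ s1 _] := conjg_conj r1.
have [_] := hoelder_mean (conjg_conj r1) Lf (mL_cst _ 1).
by under eq_fun do rewrite mulr1; rewrite nrm_cst ?normr1 ?mulr1 ?nrm1E//; lra.
Qed.

End Integration.

(** * Pointwise truncation *)

Section Truncation.
Context (R : realType).
Implicit Types (K t r : R).

Definition trunc K t : R := Num.max (- K) (Num.min K t).

Lemma truncP K t : 0 <= K ->
  [\/ `|t| <= K /\ trunc K t = t, K < t /\ trunc K t = K | t < - K /\ trunc K t = - K].
Proof.
move=> K0; rewrite /trunc; have [tK|tK] := leP K t.
  rewrite max_r; last by lra.
  have [->|ne] := eqVneq t K; first by apply: Or31; rewrite ger0_norm.
  by apply: Or32; split=> //; rewrite lt_neqAle eq_sym ne.
have [tK'|tK'] := leP (- K) t.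
  by apply: Or31; split=> //; rewrite ler_norml tK'/= ltW.
by apply: Or33.
Qed.

Lemma trunc_norm K t : 0 <= K -> `|trunc K t| <= K.
Proof.
move=> K0; case: (truncP t K0) => -[h ->] //; first by rewrite ger0_norm.
by rewrite normrN ger0_norm.
Qed.

Lemma trunc_id K t : 0 <= K -> `|t| <= K -> trunc K t = t.
Proof.
move=> K0 tK; case: (truncP t K0) => -[h e] //; move: tK; rewrite ler_norml => /andP[]; lra.
Qed.

Lemma trunc_le K t : 0 <= K -> `|trunc K t| <= `|t|.
Proof.
move=> K0; case: (truncP t K0) => -[h ->] //.
  by rewrite !ger0_norm//; lra.
by rewrite normrN ger0_norm// ltr0_norm; lra.
Qed.

(** The two differences on the left have the same sign, so their absolute values add up without
    loss. *)
Lemma trunc_split j K t : 0 <= j -> j <= K ->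
  `|trunc K t - trunc j t| + `|t - trunc K t| = `|t - trunc j t|.
Proof.
move=> j0 jK; have K0 : 0 <= K by lra.
case: (truncP t j0) => -[h ->]; case: (truncP t K0) => -[h' ->].
- by rewrite !subrr normr0 addr0.
- by move: h; rewrite ler_norml => /andP[]; lra.
- by move: h; rewrite ler_norml => /andP[]; lra.
- by rewrite subrr normr0 addr0.
- by rewrite !ger0_norm; lra.
- lra.
- by rewrite subrr normr0 addr0.
- lra.
- by rewrite !ler0_norm; lra.
Qed.

Lemma trunc_rest_le K t : 0 <= K -> `|t - trunc K t| <= `|t|.
Proof.
move=> K0; case: (truncP t K0) => -[h ->]; first by rewrite subrr normr0.
  by rewrite !ger0_norm; lra.
by rewrite !ler0_norm; lra.
Qed.

Lemma trunc_rest_anti j K t : 0 <= j -> j <= K -> `|t - trunc K t| <= `|t - trunc j t|.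
Proof. by move=> j0 jK; rewrite -(trunc_split t j0 jK) lerDr. Qed.

Lemma powR_add_le (a b : R) r : 0 <= a -> 0 <= b -> 1 <= r ->
  a `^ r + b `^ r <= (a + b) `^ r.
Proof.
move=> a0 b0 r1; have r0 : 0 < r by lra. have r2 : 0 <= r - 1 by lra.
have ab0 := addr_ge0 a0 b0.
rewrite -(mulr_powRB1 a0 r0) -(mulr_powRB1 b0 r0) -(mulr_powRB1 ab0 r0) mulrDl.
by apply: lerD; apply: ler_wpM2l => //; apply: ge0_ler_powR; rewrite ?nnegrE// ?lerDl ?lerDr.
Qed.

(** After integration, the slab between the levels [j] and [K] costs at most the drop of the tail
    moment from [j] to [K]. Convergence of the tails thereby gives equi-integrability of the
    truncated functions. *)
Lemma trunc_split_powR r j K t : 1 <= r -> 0 <= j -> j <= K ->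
  `|trunc K t - trunc j t| `^ r + `|t - trunc K t| `^ r <= `|t - trunc j t| `^ r.
Proof. by move=> r1 j0 jK; rewrite -(trunc_split t j0 jK); exact: powR_add_le. Qed.

Lemma trunc_rest_powR r K t : 1 <= r -> 0 < K ->
  `|t - trunc K t| * K `^ (r - 1) <= `|t| `^ r.
Proof.
move=> r1 K0; have [tK|tK] := leP `|t| K.
  by rewrite trunc_id ?(ltW K0)// subrr normr0 mul0r powR_ge0.
rewrite -[X in _ <= X]mulr_powRB1//; last by lra.
apply: ler_pM => //; [exact: powR_ge0|exact/trunc_rest_le/ltW|].
by rewrite ge0_ler_powR ?nnegrE//; lra.
Qed.

End Truncation.

(** * Dominated convergence, dual functions and duality of norms *)

Section Convergence.
Context d (T : measurableType d) (R : realType) (P : probability T R).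
Implicit Types (f g h : T -> R) (r s K : R).
Local Notation itg := (itg P).
Local Notation mean := (mean P).
Local Notation mL := (mL P).
Local Notation mom := (mom P).
Local Notation nrm := (nrm P).

Lemma measurable_trunc K f : measurable_fun setT f ->
  measurable_fun setT (fun x => trunc K (f x)).
Proof. by move=> mf; apply: measurable_maxr => //; apply: measurable_minr. Qed.

Lemma dominated_mean (f_ : nat -> T -> R) f g :
  (forall n, measurable_fun setT (f_ n)) -> measurable_fun setT f ->
  (forall n x, `|f_ n x| <= g x) -> itg g ->
  (forall x, f_ n x @[n --> \oo] --> f x) ->
  mean (f_ n) @[n --> \oo] --> mean f.
Proof.
move=> mf_ mf fg ig cv.
have [itf _ C] : [/\ P.-integrable setT (EFin \o f), [sequence (\int[P]_x `|(EFin \o f_ n) x - (EFin \o f) x|)%E]_n @ \oo --> 0%E & [sequence (\int[P]_x (EFin \o f_ n) x)%E]_n @ \oo --> (\int[P]_x (EFin \o f) x)%E].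
  apply: (@dominated_convergence _ _ _ P setT measurableT _ _ (EFin \o g)) => //.
  - by move=> n; exact/measurable_EFinP.
  - exact/measurable_EFinP.
  - by apply: aeW => x _; apply: cvg_EFin; [exact: nearW|exact: cv].
  - by apply: aeW => x n _ /=; rewrite lee_fin.
have : (mean (f_ n))%:E @[n --> \oo] --> (mean f)%:E.
  rewrite !meanE /Rintegral fineK; last exact: integrable_fin_num.
  suff -> : (fun n => (mean (f_ n))%:E) = (fun n => \int[P]_x (EFin \o f_ n) x)%E by [].
  apply/funext => n; rewrite meanE fineK//.
  by apply: integrable_fin_num => //; exact: itg_dom (fg _) ig.
by move/fine_cvgP => [].
Qed.

Lemma trunc_approx r f (e : R) : 1 <= r -> mL r f -> 0 < e ->
  exists n : nat, forall K, n%:R <= K -> nrm r (fun x => f x - trunc K (f x)) < e.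
Proof.
move=> r1 Lf e0; have [mf itf] := Lf; have r0 : 0 < r by lra.
have C : mean (fun x => `|f x - trunc n%:R (f x)| `^ r) @[n --> \oo] --> mean (fun=> 0).
  apply: (@dominated_mean _ _ (fun x => `|f x| `^ r)) => //.
  - by move=> n; apply: measurable_abs_powR; apply: measurable_funB => //; exact: measurable_trunc.
  - move=> n x; rewrite ger0_norm ?powR_ge0//; apply: ge0_ler_powR; rewrite ?nnegrE//; first exact: ltW.
    exact: trunc_rest_le.
  - move=> x; apply: cvg_near_cst; near=> n.
    rewrite trunc_id// ?subrr ?normr0 ?powR0 ?gt_eqF//.
    by near: n; exact: nbhs_infty_ger.
have er : 0 < e `^ r by rewrite powR_gt0.
move/cvgrPdist_lt : C => /(_ _ er)[n _ N]; exists n => K nK.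
have := N n (leqnn n); rewrite mean_cst sub0r normrN ger0_norm; last first.
  by apply: mean_ge0 => x; exact: powR_ge0.
move=> lt; have K0 : 0 <= K by apply: le_trans nK.
have m1 L : measurable_fun setT (fun x => f x - trunc L (f x)).
  by apply: measurable_funB => //; exact: measurable_trunc.
have L1 : mL r (fun x => f x - trunc n%:R (f x)).
  by apply: mL_dom Lf => //; [exact: ltW|move=> x; exact: trunc_rest_le].
apply: le_lt_trans (_ : nrm r (fun x => f x - trunc n%:R (f x)) < e).
  by apply: nrm_dom => // x; exact: trunc_rest_anti.
have -> : e = (e `^ r) `^ r^-1 by rewrite -powRrM divff ?gt_eqF// powRr1// ltW.
rewrite nrmE gt0_ltr_powR ?nnegrE ?mom_ge0 ?invr_gt0 ?powR_ge0// momE.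
Unshelve. all: by end_near. Qed.

(** The duality map sgn(f) |f|^(r-1) of L^r. Where [f] vanishes the first factor makes the value 0,
    also for r < 2. *)
Definition dualf r f (x : T) : R := f x * `|f x| `^ (r - 2).

Lemma measurable_dualf r f : measurable_fun setT f -> measurable_fun setT (dualf r f).
Proof. by move=> mf; apply: measurable_funM => //; exact: measurable_abs_powR. Qed.

Lemma dualf_norm r f x : 1 < r -> `|dualf r f x| = `|f x| `^ (r - 1).
Proof.
move=> r1; rewrite /dualf normrM [X in _ * X]ger0_norm ?powR_ge0//.
have [->|fx] := eqVneq (f x) 0; first by rewrite normr0 mul0r powR0//; lra.
rewrite -{1}[`|f x|]powRr1// -powRD; first by congr powR; lra.
by apply/implyP; rewrite normr_eq0.
Qed.

Lemma dualf_mul r f x : 1 < r -> f x * dualf r f x = `|f x| `^ r.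
Proof.
move=> r1; rewrite -mulr_powRB1 ?normr_ge0//; last by lra.
rewrite -(dualf_norm f x r1) -normrM ger0_norm// /dualf mulrA -expr2.
by rewrite mulr_ge0 ?sqr_ge0 ?powR_ge0.
Qed.

Lemma dualf_powR r s f x : conjg r s -> `|dualf r f x| `^ s = `|f x| `^ r.
Proof.
move=> c; have [r1 _ _] := c; rewrite dualf_norm// -powRrM; congr powR.
by rewrite (conjgE c); field; lra.
Qed.

Lemma mL_dualf r s f : conjg r s -> mL r f -> mL s (dualf r f).
Proof.
move=> c [mf itf]; split; first exact: measurable_dualf.
by under eq_fun do rewrite (dualf_powR _ _ c).
Qed.

Lemma mom_dualf r s f : conjg r s -> mom s (dualf r f) = mom r f.
Proof.
move=> c; rewrite !momE; congr mean; apply/funext => x; exact: dualf_powR.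
Qed.

(** Divide by mom^(1/s) and use 1 - 1/s = 1/r. This is the closing step of every duality argument
    with [dualf]. *)
Lemma nrm_le_of_mom r s f (c : R) : conjg r s -> 0 <= c ->
  mom r f <= c * mom r f `^ s^-1 -> nrm r f <= c.
Proof.
move=> cj c0; have [r1 s1 rs] := cj; have [m0|m0] := eqVneq (mom r f) 0.
  by move=> _; rewrite !nrmE m0 powR0// invr_neq0// gt_eqF//; lra.
have mp : 0 < mom r f by rewrite lt_neqAle eq_sym m0 mom_ge0.
rewrite !nrmE -{1}[mom r f]powRr1 ?mom_ge0// -{1}rs powRD ?m0 ?implybT//.
by rewrite ler_pM2r// powR_gt0.
Qed.

Lemma nrm_le_dual r s f (c : R) : conjg r s -> mL r f -> 0 <= c ->
  (forall g, mL s g -> `|mean (fun x => f x * g x)| <= c * nrm s g) -> nrm r f <= c.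
Proof.
move=> cj Lf c0 H; have [r1 _ _] := cj.
apply: (nrm_le_of_mom cj c0).
have := H _ (mL_dualf cj Lf); rewrite !nrmE (mom_dualf _ cj).
apply: le_trans; rewrite (_ : mom r f = mean (fun x => f x * dualf r f x)) ?ler_norm//.
by rewrite !momE; congr mean; apply/funext => x; rewrite dualf_mul.
Qed.

End Convergence.

(** * Riesz representation of bounded functionals on L^r *)

Section Riesz.
Context d (T : measurableType d) (R : realType) (P : probability T R).
Implicit Types (f g h : T -> R) (a K : R).
Local Notation itg := (itg P).
Local Notation mean := (mean P).
Local Notation mL := (mL P).
Local Notation mom := (mom P).
Local Notation nrm := (nrm P).

Lemma sub_cancel (V : zmodType) (a b c : V) : a - b = a - c - (b - c).
Proof. by rewrite opprB addrA subrK. Qed.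

Lemma sum_levels (n : nat) (t : R) : 0 <= t ->
  (n%:R <= t -> \sum_(0 <= k < n) (k.+1%:R <= t)%R%:R = n%:R :> R) /\
  (t < n%:R -> `|\sum_(0 <= k < n) (k.+1%:R <= t)%R%:R - t| <= 1 :> R).
Proof.
move=> t0; elim: n => [|n [IH1 IH2]].
  by split=> [_|]; [rewrite big_nil|lra].
rewrite big_nat_recr//= -natr1; split=> [nt|nt].
  by rewrite IH1 ?nt//; lra.
have -> : (n%:R + 1 <= t) = false by apply/negbTE; rewrite -ltNge.
rewrite addr0; have [tn|tn] := leP n%:R t; last exact: IH2.
by rewrite IH1// distrC ger0_norm; lra.
Qed.

Variables (r s C : R) (phi : (T -> R) -> R).
Hypothesis rs : conjg r s.
Hypothesis C0 : 0 <= C.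
Hypothesis phi_lin : forall a f g, mL r f -> mL r g ->
  phi (fun x => a * f x + g x) = a * phi f + phi g.
Hypothesis phi_bd : forall f, mL r f -> `|phi f| <= C * nrm r f.

Let r1 : 1 <= r. Proof. by case: rs => /ltW. Qed.
Let r0 : 0 < r. Proof. by apply: lt_le_trans r1. Qed.

Let phi0 f : f = (fun=> 0) -> phi f = 0.
Proof.
move=> ->; apply/eqP; rewrite -normr_le0.
by have := phi_bd (mL0 P r); rewrite nrm0// mulr0.
Qed.

Let phiD f g : mL r f -> mL r g -> phi (fun x => f x + g x) = phi f + phi g.
Proof.
move=> Lf Lg; have := phi_lin 1 Lf Lg; rewrite mul1r => <-.
by congr phi; apply/funext => x; rewrite mul1r.
Qed.

Let phiZ a f : mL r f -> phi (fun x => a * f x) = a * phi f.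
Proof.
move=> Lf; have := phi_lin a Lf (mL0 P r); rewrite (phi0 erefl) addr0 => <-.
by congr phi; apply/funext => x; rewrite addr0.
Qed.

Let phiB f g : mL r f -> mL r g -> phi (fun x => f x - g x) = phi f - phi g.
Proof.
move=> Lf Lg; rewrite phiD//; last exact: mLN.
by rewrite -[- phi g]mulN1r -phiZ//; congr (_ + phi _); apply/funext => x; rewrite mulN1r.
Qed.

Let phi_sum I (l : seq I) (F : I -> T -> R) : (forall i, mL r (F i)) ->
  phi (fun x => \sum_(i <- l) F i x) = \sum_(i <- l) phi (F i).
Proof.
move=> H; elim: l => [|a l IH].
  by under eq_fun do rewrite big_nil; rewrite big_nil (phi0 erefl).
by under eq_fun do rewrite big_cons; rewrite big_cons phiD ?IH//; exact: mL_sum.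
Qed.

Let indicL A : measurable A -> mL r (\1_A : T -> R).
Proof.
move=> mA; apply: (@mL_bounded _ _ _ P r _ 1) => //; first exact: ltW.
by move=> x; rewrite indicE; case: (x \in A); rewrite ?normr1 ?normr0.
Qed.

Let phi_cvg (f_ : nat -> T -> R) f : (forall n, mL r (f_ n)) -> mL r f ->
  mom r (fun x => f_ n x - f x) @[n --> \oo] --> 0 -> phi (f_ n) @[n --> \oo] --> phi f.
Proof.
have C1 : 0 < C + 1 by rewrite ltr_wpDl.
move=> Lf_ Lf /cvgrPdist_lt cv; apply/cvgrPdist_lt => e e0.
have e1 : 0 < e / (C + 1) by rewrite divr_gt0.
have er : 0 < (e / (C + 1)) `^ r by rewrite powR_gt0.
have [N _ H] := cv _ er; exists N => //= n /H /=.
rewrite sub0r normrN ger0_norm ?mom_ge0// => lt.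
have nr : nrm r (fun x => f_ n x - f x) < e / (C + 1).
  have -> : e / (C + 1) = ((e / (C + 1)) `^ r) `^ r^-1.
    by rewrite -powRrM divff ?gt_eqF// powRr1// ltW.
  by rewrite nrmE gt0_ltr_powR ?nnegrE ?mom_ge0 ?invr_gt0 ?powR_ge0.
rewrite distrC -phiB//; apply: le_lt_trans (phi_bd _) _; first exact: mLB.
apply: le_lt_trans (_ : (C + 1) * nrm r (fun x => f_ n x - f x) < e).
  by rewrite ler_wpM2r ?nrm_ge0// lerDl.
by rewrite mulrC -ltr_pdivlMr.
Qed.

Let nu (A : set T) : \bar R := (phi \1_A)%:E.

Let nu0 : nu set0 = 0%E.
Proof. by rewrite /nu phi0// indic0. Qed.

Let nu_fin A : measurable A -> nu A \is a fin_num.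
Proof. by []. Qed.

Let nu_sigma : semi_sigma_additive nu.
Proof.
move=> F mF tF mU; rewrite /nu.
have -> : (fun n => \sum_(0 <= i < n) (phi \1_(F i))%:E)%E =
    (fun n => (phi (fun x => \sum_(0 <= i < n) \1_(F i) x))%:E).
  by apply/funext => n; rewrite sumEFin phi_sum// => i; exact: indicL.
apply: cvg_EFin; first exact: nearW.
have S01 x k : F k x -> forall n, \sum_(0 <= i < n) \1_(F i) x = (k < n)%N%:R :> R.
  move=> Fk n; rewrite (eq_bigr (fun i => if i == k then 1 else 0)); last first.
    move=> i _; rewrite indicE; case: eqP => [->|ik]; first by rewrite mem_set.
    rewrite memNset// => Fi; have := tF i k Logic.I Logic.I.
    by move=> /(_ (ex_intro _ x (conj Fi Fk))).
  by rewrite -big_mkcond/= big_nat1_eq/=; case: ifP.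
have S0 x : ~ (\bigcup_n F n) x -> forall n, \sum_(0 <= i < n) \1_(F i) x = 0 :> R.
  move=> nF n; rewrite big1// => i _; rewrite indicE memNset// => Fi; apply: nF.
  by exists i.
have LS n : mL r (fun x => \sum_(0 <= i < n) \1_(F i) x).
  by apply: mL_sum => // i _; exact: indicL.
have LU := indicL mU.
apply: phi_cvg => //.
suff : mom r (fun x => \sum_(0 <= i < n) \1_(F i) x - \1_(\bigcup_n F n) x)
    @[n --> \oo] --> mean (fun=> 0) by rewrite mean_cst.
under eq_fun do rewrite momE.
apply: (@dominated_mean _ _ _ _ _ _ (fun=> 1)) => //; last 2 first.
- exact: itg_cst.
- move=> x; apply: cvg_near_cst; have [[k _ Fk]|nF] := pselect ((\bigcup_n F n) x).
    near=> n; rewrite (S01 x k)// indicE mem_set; last by exists k.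
    rewrite (_ : (k < n)%N); last by near: n; exact: nbhs_infty_gt.
    by rewrite subrr normr0 powR0// gt_eqF.
  near=> n; rewrite S0// indicE memNset//.
  by rewrite subrr normr0 powR0// gt_eqF.
- move=> n; apply: measurable_abs_powR; apply: measurable_funB; first by case: (LS n).
  by case: LU.
- move=> n x; rewrite ger0_norm ?powR_ge0//.
  have [[k _ Fk]|nF] := pselect ((\bigcup_n F n) x).
    rewrite (S01 x k)// indicE mem_set; last by exists k.
    by case: (k < n)%N; rewrite ?subrr ?sub0r ?normrN ?normr1 ?normr0 ?powR1 ?powR0// gt_eqF.
  by rewrite S0// indicE memNset// subrr normr0 powR0// gt_eqF.
Unshelve. all: by end_near. Qed.

(** The charge [nu] is dominated by [P], since the indicator of a null set has norm 0 and [phi] is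
    bounded by the norm. Radon-Nikodym gives [g], at this stage only integrable. *)
Let density : exists g, itg g /\
  forall A, measurable A -> phi \1_A = mean (fun x => \1_A x * g x).
Proof.
pose nuc : {charge set T -> \bar R} :=
  HB.pack nu (isCharge.Build _ _ _ nu nu0 nu_fin nu_sigma).
have dom : nuc `<< P.
  apply/null_content_dominatesP => A mA PA; congr EFin; apply/eqP; rewrite -normr_le0.
  rewrite (le_trans (phi_bd (indicL mA)))//.
  suff -> : nrm r (\1_A) = 0 by rewrite mulr0.
  rewrite !nrmE !momE (_ : mean _ = 0) ?powR0 ?invr_neq0 ?gt_eqF//.
  have -> : (fun x => `|\1_A x| `^ r) = (\1_A : T -> R).
    apply/funext => x; rewrite indicE; case: (x \in A); rewrite ?normr1 ?powR1//.
    by rewrite normr0 powR0// gt_eqF.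
  by rewrite !meanE /Rintegral integral_indic// setIT [X in fine X](_ : _ = 0%E).
pose G := Radon_Nikodym nuc P.
have GE : EFin \o (fine \o G) = G.
  by apply/funext => x /=; rewrite fineK//; exact: Radon_Nikodym_fin_num.
have iG : itg (fine \o G).
  by rewrite /itg GE; exact: Radon_Nikodym_integrable.
exists (fine \o G); split=> // A mA.
have := Radon_Nikodym_integral dom mA; rewrite integral_mkcond /nuc/= /nu => h.
apply: EFin_inj; rewrite [LHS]h !meanE /Rintegral fineK; last first.
  apply: integrable_fin_num => //.
  apply: (itg_dom (g := fun x => `|fine (G x)|)); last exact: itg_norm.
    by apply: measurable_funM => //; exact: itg_meas iG.
  by move=> x; rewrite indicE /=; case: (x \in A); rewrite ?mul1r ?mul0r ?normr0.
apply: eq_integral => x _; rewrite epatch_indic EFinM muleC; congr (_ * _)%E.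
by rewrite -[in LHS]/G -GE.
Qed.

Let rep_bounded g : itg g ->
  (forall A, measurable A -> phi \1_A = mean (fun x => \1_A x * g x)) ->
  forall h K, measurable_fun setT h -> (forall x, `|h x| <= K) ->
  phi h = mean (fun x => h x * g x).
Proof.
move=> ig Hg.
have unit h : measurable_fun setT h -> (forall x, 0 <= h x < 1) ->
    phi h = mean (fun x => h x * g x).
  move=> mh h01.
  have Lh : mL r h.
    apply: (@mL_bounded _ _ _ P r _ 1) => //; first exact: ltW.
    by move=> x; have /andP[? /ltW ?] := h01 x; rewrite ger0_norm.
  have ih (k : T -> R) : measurable_fun setT k -> (forall x, `|k x| <= 1) -> itg (fun x => k x * g x).
    move=> mk k1; apply: itg_dom (itg_norm ig).
      by apply: measurable_funM => //; exact: itg_meas ig.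
    by move=> x; rewrite normrM ler_piMl.
  apply/eqP; rewrite -subr_eq0 -normr_le0; apply/ler_addgt0Pl => e e0; rewrite addr0.
  have M0 : 0 <= mean (fun x => `|g x|) by apply: mean_ge0.
  pose D := C + mean (fun x => `|g x|) + 1.
  have D0 : 0 < D by rewrite /D ltr_wpDl// addr_ge0.
  pose n := (Num.truncn (D / e)).+1.
  have nD : D / e < n%:R by exact: truncnS_gt.
  have n0 : 0 < n%:R :> R by rewrite ltr0n.
  pose A k := [set x | k.+1%:R <= h x * n%:R].
  have mA k : measurable (A k).
    have mhn : measurable_fun setT (fun x => h x * n%:R) by exact: measurable_funM.
    have := mhn measurableT _ (measurable_itv `[k.+1%:R, +oo[).
    rewrite setTI (_ : _ @^-1` _ = A k)//.
    by apply/seteqP; split=> x; rewrite /= in_itv/= andbT.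
  pose hn (x : T) : R := n%:R^-1 * \sum_(0 <= k < n) \1_(A k) x.
  have hnE x : hn x = n%:R^-1 * \sum_(0 <= k < n) (k.+1%:R <= h x * n%:R)%R%:R.
    congr (_ * _); apply: eq_bigr => k _; rewrite indicE; congr ((_ : bool)%:R).
    by apply/idP/idP => [|?]; [rewrite inE|rewrite inE].
  have dh x : `|h x - hn x| <= n%:R^-1.
    have /andP[h0 h1] := h01 x.
    have hx0 : 0 <= h x * n%:R by rewrite mulr_ge0// ltW.
    have [_ H] := sum_levels n hx0.
    have hxn : h x * n%:R < n%:R by rewrite -[X in _ < X]mul1r ltr_pM2r.
    have n0' : 0 <= n%:R^-1 :> R by rewrite invr_ge0 ltW.
    have {}H := H hxn; rewrite hnE.
    rewrite (_ : h x - _ = n%:R^-1 * (h x * n%:R - \sum_(0 <= k < n) (k.+1%:R <= h x * n%:R)%R%:R)).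
      by rewrite normrM (ger0_norm n0') -[X in _ <= X]mulr1 ler_wpM2l// distrC.
    by rewrite mulrBr mulrCA mulVf ?gt_eqF// mulr1.
  have L1 k : mL r (\1_(A k) : T -> R) by exact: indicL.
  have LS : mL r (fun x => \sum_(0 <= k < n) \1_(A k) x) by apply: mL_sum.
  have Lhn : mL r hn by exact: mLZ.
  have mhn : measurable_fun setT hn by case: Lhn.
  have i1 k : itg (fun x => \1_(A k) x * g x).
    apply: ih => // x; rewrite indicE; case: (x \in A k); by rewrite ?normr1 ?normr0.
  have phn : phi hn = mean (fun x => hn x * g x).
    rewrite phiZ// phi_sum// (eq_bigr (fun k => mean (fun x => \1_(A k) x * g x))); last first.
      by move=> k _; rewrite Hg.
    rewrite -mean_sum// -meanZ; last exact: itg_sum.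
    congr mean; apply/funext => x; rewrite /hn -mulrA; congr (_ * _).
    by rewrite mulr_suml.
  have ihn : itg (fun x => hn x * g x).
    rewrite (_ : (fun x => _) = (fun x => n%:R^-1 * \sum_(0 <= k < n) \1_(A k) x * g x)).
      by apply: itgZ; apply: itg_sum.
    by apply/funext => x; rewrite /hn -mulrA mulr_suml.
  have ihg : itg (fun x => h x * g x).
    by apply: ih => // x; have /andP[? /ltW ?] := h01 x; rewrite ger0_norm.
  have -> : phi h - mean (fun x => h x * g x) =
      phi (fun x => h x - hn x) - mean (fun x => (h x - hn x) * g x).
    rewrite phiB// phn (_ : (fun x => (h x - hn x) * g x) = fun x => h x * g x - hn x * g x); last first.
      by apply/funext => x; rewrite mulrBl.
    by rewrite meanB//; exact: sub_cancel.
  have b1 : `|phi (fun x => h x - hn x)| <= C * n%:R^-1.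
    apply: le_trans (phi_bd _) _; first exact: mLB.
    rewrite ler_wpM2l//; apply: nrm_bounded => //; exact: measurable_funB.
  have b2 : `|mean (fun x => (h x - hn x) * g x)| <= n%:R^-1 * mean (fun x => `|g x|).
    rewrite -meanZ; last exact: itg_norm.
    apply: mean_dom; last by apply: itgZ; exact: itg_norm.
      apply: measurable_funM; first exact: measurable_funB.
      exact: itg_meas ig.
    by move=> x; rewrite normrM ler_wpM2r.
  apply: le_trans (ler_normB _ _) _; apply: le_trans (lerD b1 b2) _.
  rewrite [C * _]mulrC -mulrDr mulrC ler_pdivrMr//.
  move: nD; rewrite ltr_pdivrMr// /D => nD.
  by rewrite [e * _]mulrC; apply: le_trans (ltW nD); rewrite lerDl.
move=> h K mh hK.
have K0 : 0 <= `|K| by [].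
have K1 : 0 < 2 * `|K| + 1 by lra.
(* An affine change of variable brings the values into [0, 1). The added 1 in the denominator makes
   the upper bound strict and the denominator positive also for K = 0. *)
pose h' x := (h x + `|K|) / (2 * `|K| + 1).
have hK' x : - `|K| <= h x <= `|K|.
  by rewrite -ler_norml (le_trans (hK x))// ler_norm.
have mh' : measurable_fun setT h'.
  by apply: measurable_funM => //; exact: measurable_funD.
have h'01 x : 0 <= h' x < 1.
  have /andP[? ?] := hK' x.
  by rewrite /h' divr_ge0 ?ltr_pdivrMr//=; lra.
have hE : h = (fun x => (2 * `|K| + 1) * h' x + - `|K| * 1).
  by apply/funext => x; rewrite /h' mulrC mulfVK ?gt_eqF//; lra.
have Lh' : mL r h'.
  apply: (@mL_bounded _ _ _ P r _ 1) => //; first exact: ltW.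
  by move=> x; have /andP[? /ltW ?] := h'01 x; rewrite ger0_norm.
have u1 : phi (fun=> 1) = mean g.
  have := Hg _ measurableT; rewrite indicT (_ : cst 1 = fun=> 1)// => ->.
  by congr mean; apply/funext => x; rewrite mul1r.
have ih' : itg (fun x => h' x * g x).
  apply: itg_dom (itg_norm ig).
    by apply: measurable_funM => //; exact: itg_meas ig.
  move=> x; rewrite normrM ler_piMl//.
  by have /andP[? /ltW ?] := h'01 x; rewrite ger0_norm.
rewrite hE phiD; last 2 first.
- exact: mLZ.
- exact/mLZ/mL_cst.
rewrite !phiZ//; last exact: mL_cst.
rewrite u1 unit// -!meanZ// -meanD; last 2 first.
- exact: itgZ.
- exact: itgZ.
by congr mean; apply/funext => x; rewrite [RHS]mulrDl mulr1 -[in RHS]mulrA.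
Qed.

(** The density [g] is tested against the dual function of its own truncation [t n]. As [t n] has
    the sign of [g] and is no larger in modulus, this pairing dominates |t n|^s, so the s-moments of
    [t n] are at most C^s for all n. Fatou's lemma then puts [g] in L^s, and truncation extends the
    formula from bounded [f] to all of L^r. *)
Lemma riesz_representation : exists g, mL s g /\
  forall f, mL r f -> phi f = mean (fun x => f x * g x).
Proof.
have [g [ig Hg]] := density; have {}Hg := rep_bounded ig Hg.
have mg := itg_meas ig; have sr := conjg_sym rs; have [s1 _ _] := sr.
have s0 : 0 < s := lt_trans ltr01 s1. have s0' := ltW s0.
pose t (n : nat) x := trunc n%:R (g x).
have tb n x : `|t n x| <= n%:R by exact: trunc_norm.
have mt n : measurable_fun setT (t n) by exact: measurable_trunc.
have Lt n : mL s (t n) by exact: (@mL_bounded _ _ _ P s _ _ s0' (mt n) (tb n)).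
have nt n : mom s (t n) <= C `^ s.
  have db x : `|dualf s (t n) x| <= n%:R `^ (s - 1).
    by rewrite dualf_norm// ge0_ler_powR ?nnegrE// subr_ge0 ltW.
  have md : measurable_fun setT (dualf s (t n)) by exact: measurable_dualf.
  have H : nrm s (t n) <= C.
    apply: (nrm_le_of_mom sr) => //.
    have := phi_bd (mL_dualf sr (Lt n)); rewrite (Hg _ _ md db).
    rewrite !nrmE (mom_dualf _ _ sr); apply: le_trans.
    apply: le_trans (ler_norm _); rewrite momE; apply: le_mean; first by case: (Lt n).
      apply: itg_dom (itgZ (n%:R `^ (s - 1)) (itg_norm ig)).
        exact: measurable_funM.
      by move=> x; rewrite normrM ler_wpM2r.
    move=> x; rewrite -dualf_mul// [X in X <= _]mulrC /dualf -!mulrA.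
    rewrite ![_ `^ _ * _]mulrC !mulrA ler_wpM2r ?powR_ge0//.
    rewrite /t; case: (truncP (g x) (ler0n _ n)) => -[h ->] //.
      by rewrite ler_wpM2l// ltW.
    by rewrite !mulNr lerN2 ler_wpM2l// ltW.
  by rewrite -nrm_powR// ge0_ler_powR ?nnegrE ?nrm_ge0.
have Lg : mL s g.
  split=> //; apply/integrableP; split; first exact/measurable_EFinP/measurable_abs_powR.
  under eq_integral do rewrite /= ger0_norm ?powR_ge0//.
  apply: (@le_lt_trans _ _ (C `^ s)%:E); last exact: ltry.
  pose F n x := (`|t n x| `^ s)%:E.
  have cF x : F n x @[n --> \oo] --> (`|g x| `^ s)%:E.
    apply: cvg_near_cst; near=> n; rewrite /F /t trunc_id//.
    by near: n; exact: nbhs_infty_ger.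
  have -> : (\int[P]_x (`|g x| `^ s)%:E = \int[P]_x (limn_einf (F^~ x)))%E.
    by apply: eq_integral => x _; have [-> _] := cvg_limn_einf_sup (cF x).
  apply: le_trans (fatou P measurableT _ _) _.
  - by move=> n; apply/measurable_EFinP/measurable_abs_powR.
  - by move=> n x _; rewrite lee_fin powR_ge0.
  have FE n : (\int[P]_x F n x = (mom s (t n))%:E)%E.
    by rewrite !momE !meanE /Rintegral fineK//; apply: integrable_fin_num => //; case: (Lt n).
  rewrite limn_einf_lim; apply: lime_le; first exact: is_cvg_einfs.
  apply: nearW => n; apply: (@le_trans _ _ (\int[P]_x F n x)%E); last by rewrite FE lee_fin.
  by apply: ereal_inf_lbound; exists n => //=.
exists g; split=> // f Lf; have [mf _] := Lf.
have pf n : phi (fun x => trunc n%:R (f x)) = mean (fun x => trunc n%:R (f x) * g x).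
  apply: (Hg _ n%:R); first exact: measurable_trunc.
  by move=> x; exact: trunc_norm.
apply/eqP; rewrite -subr_eq0 -normr_le0; apply/ler_addgt0Pl => e e0; rewrite addr0.
pose D := C + nrm s g + 1.
have D0 : 0 < D by rewrite /D ltr_wpDl// addr_ge0// nrm_ge0.
have eD : 0 < e / D by rewrite divr_gt0.
have [n /(_ n%:R (lexx _)) Hn] := trunc_approx r1 Lf eD.
pose f' x := f x - trunc n%:R (f x).
have Lt' : mL r (fun x => trunc n%:R (f x)).
  apply: mL_dom Lf; first exact: ltW.
    exact: measurable_trunc.
  by move=> x; exact: trunc_le.
have Lf' : mL r f' by exact: mLB.
have [i1 _] := hoelder_mean rs Lf Lg; have [i2 _] := hoelder_mean rs Lt' Lg.
have -> : phi f - mean (fun x => f x * g x) = phi f' - mean (fun x => f' x * g x).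
  rewrite phiB// pf (_ : (fun x => f' x * g x) = fun x => f x * g x - trunc n%:R (f x) * g x); last first.
    by apply/funext => x; rewrite mulrBl.
  by rewrite meanB//; exact: sub_cancel.
apply: le_trans (ler_normB _ _) _.
apply: le_trans (lerD (phi_bd Lf') (hoelder_pair rs Lf' Lg)) _.
rewrite [C * _]mulrC -mulrDr; apply: le_trans (_ : e / D * D <= e).
  apply: ler_pM; rewrite ?nrm_ge0 ?addr_ge0 ?nrm_ge0//; first exact: ltW.
  by rewrite /D lerDl.
by rewrite divfK// gt_eqF.
Unshelve. all: by end_near. Qed.

End Riesz.

(** * Limits along an ultrafilter and selective ultrafilters *)

Section Ultrafilter.
Context (R : realType) (U : set (set nat)).
Hypothesis UU : is_ultrafilter U.
Implicit Types (x y : nat -> R) (A B : set nat).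

Let UT : U setT. Proof. by case: UU. Qed.
Let U0 : ~ U set0. Proof. by case: UU. Qed.

Lemma ultraI A B : U A -> U B -> U (A `&` B).
Proof. by case: UU => _ _ h _ _; exact: h. Qed.

Lemma ultraS A B : A `<=` B -> U A -> U B.
Proof. by case: UU => _ _ _ h _; exact: h. Qed.

Lemma ultraC A : ~ U A -> U (~` A).
Proof. by move=> nA; case: UU => _ _ _ _ /(_ A) [|]. Qed.

Lemma ultraW A : (forall n, A n) -> U A.
Proof. by move=> h; apply: ultraS UT => n _. Qed.

Lemma ultra_ex A : U A -> exists n, A n.
Proof.
move=> UA; apply: contrapT => /forallNP h; apply: U0.
by apply: ultraS UA => n /h.
Qed.

Lemma ultra_bigI (A : nat -> set nat) k : (forall i, (i < k)%N -> U (A i)) ->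
  U [set n | forall i, (i < k)%N -> A i n].
Proof.
elim: k => [_|k IH H]; first exact: ultraW.
have H1 := IH (fun i ik => H i (ltnW ik)).
apply: ultraS (ultraI H1 (H k (ltnSn k))) => n [h hk] i.
by rewrite ltnS leq_eqVlt => /predU1P[->//|]; exact: h.
Qed.

Lemma ulim_to_unique x l l' : ulim_to U x l -> ulim_to U x l' -> l = l'.
Proof.
move=> h h'; apply/eqP; rewrite -subr_eq0 -normr_le0.
apply/ler_addgt0Pl => e e0; rewrite addr0.
have e2 : 0 < e / 2 by rewrite divr_gt0.
have [n [/= a b]] := ultra_ex (ultraI (h _ e2) (h' _ e2)).
have -> : l - l' = (x n - l') - (x n - l) by rewrite opprB [RHS]addrC addrA subrK.
by apply: le_trans (ler_normB _ _) _; rewrite [e]splitr; apply: lerD; exact: ltW.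
Qed.

Lemma ulimE x l : ulim_to U x l -> ulim U x = l.
Proof.
by move=> h; rewrite /ulim; case: xgetP => [l' _ /ulim_to_unique|/(_ l)//]; exact.
Qed.

Lemma ulim_toD x y l l' : ulim_to U x l -> ulim_to U y l' ->
  ulim_to U (fun n => x n + y n) (l + l').
Proof.
move=> hx hy e e0; have e2 : 0 < e / 2 by rewrite divr_gt0.
apply: ultraS (ultraI (hx _ e2) (hy _ e2)) => n [/= a b].
rewrite opprD addrACA [e]splitr; apply: le_lt_trans (ler_normD _ _) _.
exact: ltrD.
Qed.

Lemma ulim_toZ a x l : ulim_to U x l -> ulim_to U (fun n => a * x n) (a * l).
Proof.
move=> hx e e0; have a0 : 0 < `|a| + 1 by rewrite ltr_wpDl.
have e2 : 0 < e / (`|a| + 1) by rewrite divr_gt0.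
apply: ultraS (hx _ e2) => n /= h; rewrite -mulrBr normrM.
apply: (@le_lt_trans _ _ ((`|a| + 1) * `|x n - l|)).
  by rewrite ler_wpM2r// lerDl.
by rewrite mulrC -ltr_pdivlMr.
Qed.

Lemma ulim_to_cst c : ulim_to U (fun=> c : R) c.
Proof. by move=> e e0; apply: ultraW => n /=; rewrite subrr normr0. Qed.

Lemma ulim_toN x l : ulim_to U x l -> ulim_to U (fun n => - x n) (- l).
Proof.
by move=> /(ulim_toZ (-1)); rewrite mulN1r; under eq_fun do rewrite mulN1r.
Qed.

Lemma ulim_toB x y l l' : ulim_to U x l -> ulim_to U y l' ->
  ulim_to U (fun n => x n - y n) (l - l').
Proof. by move=> hx hy; apply: ulim_toD => //; exact: ulim_toN. Qed.

Lemma ulim_to_abs x l : ulim_to U x l -> ulim_to U (fun n => `|x n|) `|l|.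
Proof.
move=> hx e e0; apply: ultraS (hx _ e0) => n /=.
by apply: le_lt_trans; exact: ler_dist_dist.
Qed.

Lemma ulim_to_le x y l l' : ulim_to U x l -> ulim_to U y l' ->
  U [set n | x n <= y n] -> l <= l'.
Proof.
move=> hx hy h; apply/ler_addgt0Pl => e e0; have e2 : 0 < e / 2 by rewrite divr_gt0.
have [n [[/= ]]] := ultra_ex (ultraI (ultraI (hx _ e2) (hy _ e2)) h).
rewrite !ltr_norml => /andP[a1 a2] /andP[b1 b2] c.
have : e / 2 + e / 2 = e by rewrite -splitr.
move: a1 a2 b1 b2 c; move: (x n) (y n) (e / 2) => xn yn e' *; lra.
Qed.

Lemma ulim_to_squeeze x y : U [set n | `|x n| <= y n] -> ulim_to U y 0 -> ulim_to U x 0.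
Proof.
move=> h hy e e0; apply: ultraS (ultraI h (hy _ e0)) => n [/= a].
by rewrite !subr0 => b; apply: le_lt_trans a _; apply: le_lt_trans b; exact: ler_norm.
Qed.

Lemma ulim_to0P x : (forall e : R, 0 < e -> U [set n | `|x n| <= e]) -> ulim_to U x 0.
Proof.
move=> h e e0; have e2 : 0 < e / 2 by rewrite divr_gt0.
apply: ultraS (h _ e2) => n /= a; rewrite subr0; apply: le_lt_trans a _.
by rewrite ltr_pdivrMr// mulr_natr mulr2n ltrDl.
Qed.

Lemma ulim_to_eq x y l : U [set n | x n = y n] -> ulim_to U x l -> ulim_to U y l.
Proof.
by move=> h hx e e0; apply: ultraS (ultraI h (hx _ e0)) => n [/= <-].
Qed.

(** The limit is the supremum of the t with t <= x n on a set of [U]. *)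
Lemma ulim_ex x (C : R) : (forall n, `|x n| <= C) -> ulim_to U x (ulim U x).
Proof.
move=> xC; suff [l hl] : exists l, ulim_to U x l by rewrite (ulimE hl).
pose S := [set t : R | U [set n | t <= x n]].
have S0 : S !=set0.
  by exists (- C); apply: ultraW => n /=; have := xC n; rewrite ler_norml => /andP[].
have SC t : S t -> t <= C.
  move=> /ultra_ex[n /= tn]; apply: le_trans tn _.
  by have := xC n; rewrite ler_norml => /andP[].
have hS : has_sup S by split => //; exists C.
exists (sup S) => e e0; have e2 : 0 < e / 2 by rewrite divr_gt0.
have [t St lt] := sup_adherent e0 hS.
have nS : U (~` [set n | sup S + e / 2 <= x n]).
  apply: ultraC => h; have : sup S + e / 2 <= sup S by exact: (ub_le_sup hS.2).
  by rewrite gerDl leNgt e2.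
apply: ultraS (ultraI St nS) => n [/= a /negP]; rewrite -ltNge => b.
have : e / 2 + e / 2 = e by rewrite -splitr.
rewrite ltr_norml; move: a b e2 lt; move: (sup S) (x n) (e / 2) => s xn e' *.
by apply/andP; split; lra.
Qed.

Hypothesis UN : nonprincipal U.

Lemma ultra_ge N : U [set n | (N <= n)%N].
Proof.
elim: N => [|N IH]; first exact: ultraW.
have nN : U (~` [set N]) by apply: ultraC; exact: UN.
have h := ultraI IH nN; apply: ultraS h => n [/= Nn {}nN].
by rewrite ltn_neqAle Nn andbT; apply/eqP => h; apply: nN.
Qed.

Lemma ultra_inf A N : U A -> exists n, (N <= n)%N /\ A n.
Proof. by move=> UA; have [n [? ?]] := ultra_ex (ultraI (ultra_ge N) UA); exists n. Qed.

Lemma ulim_to_ge (x : nat -> R) : (forall e : R, 0 < e -> exists N, forall n, (N <= n)%N -> `|x n| <= e) ->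
  ulim_to U x 0.
Proof.
move=> h; apply: ulim_to0P => e /h[N H].
by apply: ultraS (ultra_ge N) => n /H.
Qed.

Hypothesis US : selective U.

Lemma finite_set_nat_ub A : finite_set A -> exists N, forall n, A n -> (n < N)%N.
Proof.
move=> /finite_seqP[s ->]; exists (\max_(i <- s) i).+1 => n /= ns.
by rewrite ltnS; exact: leq_bigmax_seq.
Qed.

(* The P-point property gives B on which n >= g m forces n in X m; cutting N
   into intervals along the iterates of g, the Q-point property keeps one point
   per interval, and restricting to intervals of one parity separates them. *)
Lemma selection (X : nat -> set nat) : (forall m, U (X m)) ->
  exists A, U A /\ forall m n, A m -> A n -> (m < n)%N -> X m n.
Proof.
move=> UX; have [B [UB BX]] := US.1 X UX.
have /choice[g Hg] : forall m, exists N, forall n, B n -> (N <= n)%N -> X m n.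
  move=> m; have [N HN] := finite_set_nat_ub (BX m); exists N => n Bn Nn.
  by apply: contrapT => nX; have := HN n (conj Bn nX); rewrite ltnNge Nn.
pose nx k := maxn k.+1 (\max_(j < k.+1) g j).
pose kk i := iter i nx 0%N.
have kS i : (kk i < kk i.+1)%N by rewrite /kk/= leq_max leqnn.
have kmono i j : (i <= j)%N -> (kk i <= kk j)%N.
  elim: j => [|j IH]; first by rewrite leqn0 => /eqP ->.
  rewrite leq_eqVlt => /predU1P[->//|]; rewrite ltnS => /IH h.
  by apply: leq_trans h _; exact/ltnW/kS.
have kge i : (i <= kk i)%N.
  by elim: i => // i IH; apply: leq_ltn_trans IH (kS i).
have kg i m : (m <= kk i)%N -> (g m <= kk i.+1)%N.
  move=> mk; rewrite /kk /= -/(kk i) leq_max; apply/orP; right.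
  have mk' : (m < (kk i).+1)%N by [].
  exact: (leq_bigmax (Ordinal mk')).
pose I i : set nat := [set n | (kk i <= n < kk i.+1)%N].
have Iex n : exists i, I i n.
  have : exists i, (n < kk i)%N by exists n.+1; apply: leq_trans (kge n.+1).
  move=> ex; case: (ex_minnP ex) => -[|i] // ni min; exists i; apply/andP; split=> //.
  by rewrite leqNgt; apply/negP => /min; rewrite ltnn.
have Idisj i j n : I i n -> I j n -> i = j.
  move=> /andP[a b] /andP[c e]; case: (ltngtP i j) => // /kmono h.
    by have := leq_ltn_trans (leq_trans h c) b; rewrite ltnn.
  by have := leq_ltn_trans (leq_trans h a) e; rewrite ltnn.
have [] := US.2 I.
- move=> i; apply: (@sub_finite_set _ _ `I_(kk i.+1)); last exact: finite_II.
  by move=> n /andP[].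
- by move=> i; exists (kk i); apply/andP; split.
- exact: Iex.
- by move=> i j ij; apply/seteqP; split=> // n [/Idisj h /h].
move=> C [UC CI].
pose E : set nat := [set n | exists i, ~~ odd i /\ I i n].
have key D b : U D -> (forall n i, D n -> I i n -> odd i = b) ->
    exists A, U A /\ forall m n, A m -> A n -> (m < n)%N -> X m n.
  move=> UD Db; exists (B `&` (C `&` D)); split.
    by apply: ultraI => //; exact: ultraI.
  move=> m n [Bm [Cm Dm]] [Bn [Cn Dn]] mn.
  have [i Ii] := Iex m; have [j Ij] := Iex n.
  have ij : (i <= j)%N.
    rewrite leqNgt; apply/negP => ji; have /andP[a _] := Ii; have /andP[_ c] := Ij.
    by have := leq_trans (leq_trans c (kmono _ _ ji)) a; rewrite ltnNge (ltnW mn).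
  have nij : i != j.
    apply/negP => /eqP eij; subst j; have [q hq] := CI i.
    have : [set q] m by rewrite -hq.
    have : [set q] n by rewrite -hq.
    by move=> /= nq mq; move: mn; rewrite nq mq ltnn.
  have lij : (i.+2 <= j)%N.
    rewrite ltn_neqAle; apply/andP; split; last by rewrite ltn_neqAle nij.
    apply/negP => /eqP e; have := Db _ _ Dn Ij; rewrite -(Db _ _ Dm Ii) -e /=.
    by case: odd.
  apply: Hg => //; have /andP[_ mi] := Ii; have /andP[nj _] := Ij.
  by apply: leq_trans (kg _ _ (ltnW mi)) _; apply: leq_trans (kmono _ _ lij) nj.
have [UE|nUE] := pselect (U E).
  apply: (key E false) => // n i [j [oj Ij]] Ii.
  by rewrite (Idisj _ _ _ Ii Ij); exact/negbTE.
apply: (key (~` E) true); first exact: ultraC.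
move=> n i nE Ii; apply/negPn/negP => oi; apply: nE; by exists i.
Qed.

Lemma sum_half_le2 n : \sum_(0 <= i < n) 2^-1 ^+ i <= 2 :> R.
Proof.
suff -> : \sum_(0 <= i < n) 2^-1 ^+ i = 2 - 2 * 2^-1 ^+ n :> R.
  by rewrite gerBl mulr_ge0// exprn_ge0// invr_ge0.
elim: n => [|n IH]; first by rewrite big_nil expr0 mulr1 subrr.
by rewrite big_nat_recr//= IH exprS mulrA divff// mul1r; move: (_ ^+ n) => z; lra.
Qed.

(** The error at a selected index n is charged to its predecessor m in [A]. Every m is charged at
    most once, so the errors are dominated by a geometric series, apart from the first one, which
    has no predecessor and is bounded by [e0]. The induction carries along the last selected index
    below N. *)
Lemma selected_sum A (c e0 : R) (e : nat -> R) : 0 <= c -> 0 <= e0 ->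
  (forall m n, A m -> A n -> (m < n)%N -> (forall k, (m < k < n)%N -> ~ A k) ->
     e n <= c * 2^-1 ^+ m) ->
  (forall n, A n -> (forall m, (m < n)%N -> ~ A m) -> e n <= e0) ->
  forall N, \sum_(0 <= n < N | n \in A) e n <= e0 + c * 2.
Proof.
move=> c0 e00 He H0 N.
pose s m : R := \sum_(0 <= i < m) 2^-1 ^+ i.
have h0 i : 0 <= 2^-1 ^+ i :> R by rewrite exprn_ge0// invr_ge0.
suff : (forall m, (m < N)%N -> ~ A m) /\ \sum_(0 <= n < N | n \in A) e n = 0 \/
    exists m, [/\ (m < N)%N, A m, forall k, (m < k < N)%N -> ~ A k &
      \sum_(0 <= n < N | n \in A) e n <= e0 + c * s m].
  case=> [[_ ->]|[m [_ _ _ h]]]; first by rewrite addr_ge0// mulr_ge0.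
  by apply: le_trans h _; rewrite lerD2l ler_wpM2l// sum_half_le2.
elim: N => [|N IH]; first by left; rewrite big_nil.
rewrite big_mkcond big_nat_recr//= -big_mkcond/=.
case: (boolP (N \in A)) => [/set_mem AN|/negP nA]; last first.
  have {}nA : ~ A N by move=> h; apply: nA; exact: mem_set.
  rewrite addr0; case: IH => [[h ->]|[m [mN Am pm h]]]; [left|right].
    by split=> // m; rewrite ltnS leq_eqVlt => /predU1P[->//|]; exact: h.
  exists m; split=> //; first exact: ltnW.
  move=> k /andP[mk]; rewrite ltnS leq_eqVlt => /predU1P[->//|kN].
  by apply: pm; rewrite mk.
right; exists N; split=> //; first by move=> k /andP[a b]; move: (leq_trans a b); rewrite ltnn.
case: IH => [[h ->]|[m [mN Am pm h]]].
  rewrite add0r; apply: le_trans (H0 N AN h) _.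
  by rewrite lerDl mulr_ge0// sumr_ge0.
apply: le_trans (lerD h (He _ _ Am AN mN pm)) _.
rewrite -addrA -mulrDr lerD2l ler_wpM2l//.
have -> : s m + 2^-1 ^+ m = s m.+1 by rewrite /s big_nat_recr.
by rewrite /s [X in _ <= X](big_cat_nat (n := m.+1))//= lerDl sumr_ge0.
Qed.

End Ultrafilter.

(** * Scalar inequalities *)

Section Inequalities.
Context (R : realType).
Implicit Types (t r K : R).

(** Three ranges: for small t the power is at most [d]; for t > 1/d it is absorbed by d t^r; in
    between it is at most a constant multiple of t. *)
Lemma powR_interp r (d : R) : 1 < r -> 0 < d ->
  exists C : R, 0 <= C /\ forall t, 0 <= t -> t `^ (r - 1) <= d * (1 + t `^ r) + C * t.
Proof.
move=> r1 d0; have r0 : 0 < r by lra. have r2 : 0 < r - 1 by lra.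
have r2' := ltW r2.
pose a := d `^ (r - 1)^-1; have a0 : 0 < a by rewrite powR_gt0.
have aE : a `^ (r - 1) = d by rewrite -powRrM mulVf ?gt_eqF// powRr1// ltW.
have d1 : 0 < d^-1 by rewrite invr_gt0.
exists (d^-1 `^ (r - 1) / a); split; first by rewrite divr_ge0 ?powR_ge0 ?ltW.
move=> t t0; have tr := powR_ge0 t r; have tr1 := powR_ge0 t (r - 1).
have X0 : 0 <= d^-1 `^ (r - 1) / a * t by rewrite !mulr_ge0 ?invr_ge0 ?powR_ge0 ?(ltW a0).
have Y0 : 0 <= d * t `^ r by rewrite mulr_ge0 ?(ltW d0).
rewrite mulrDr mulr1; have [ta|ta] := leP t a.
  have : t `^ (r - 1) <= d by rewrite -aE ge0_ler_powR ?nnegrE ?(ltW a0).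
  lra.
have [tk|tk] := leP d^-1 t.
  have : t `^ (r - 1) <= d * t `^ r.
    rewrite -[X in _ * X]mulr_powRB1// mulrA -[X in X <= _]mul1r ler_wpM2r//.
    by rewrite -(@mulfV _ d) ?gt_eqF// ler_wpM2l// ltW.
  lra.
have : t `^ (r - 1) <= d^-1 `^ (r - 1) / a * t.
  rewrite mulrAC ler_pdivlMr//; apply: ler_pM => //; first exact: ltW.
    by rewrite ge0_ler_powR ?nnegrE ?(ltW d1)// ltW.
  exact: ltW.
lra.
Qed.

Lemma powR_1D r (u : R) : 1 <= r -> 0 <= u <= 1 -> (1 + u) `^ r <= 1 + 2 `^ r * u.
Proof.
move=> r1 /andP[u0 u1].
have r0 : 0 < r by lra.
have v0 : 0 <= 1 - u by lra. have v1 : 1 - u <= 1 by lra.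
have u01 : 0 <= u <= 1 by rewrite u0.
have h : (u * 2 + (1 - u) * 1) `^ r <= u * 2 `^ r + (1 - u) * 1 `^ r.
  by apply: (@convex_powR R r r1 (Itv01 u0 u1) 2 1); rewrite inE/= in_itv/= andbT.
rewrite powR1 !mulr1 in h; have -> : 1 + u = u * 2 + (1 - u) by lra.
by apply: le_trans h _; rewrite mulrC; lra.
Qed.

Lemma powR_addD r (a b : R) : 1 < r -> 0 <= b -> b <= a ->
  (a + b) `^ r <= a `^ r + 2 `^ r * (a `^ (r - 1) * b).
Proof.
move=> r1 b0 ba; have r0 : 0 < r by lra.
have [a0|a0] := leP a 0.
  have -> : a = 0 by lra.
  have -> : b = 0 by lra.
  by rewrite !mulr0 !addr0.
have h : 0 <= b / a <= 1 by rewrite divr_ge0 ?(ltW a0)//= ler_pdivrMr// mul1r.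
have := powR_1D (ltW r1) h; have -> : a + b = a * (1 + b / a).
  by rewrite mulrDr mulr1 mulrC divfK// gt_eqF.
move=> h2; rewrite powRM ?(ltW a0)//; last by have /andP[] := h; lra.
apply: le_trans (ler_wpM2l (powR_ge0 _ _) h2) _.
rewrite mulrDr mulr1 lerD2l -mulr_powRB1 ?(ltW a0)//.
rewrite (_ : a * _ * _ = 2 `^ r * (a `^ (r - 1) * b) * (a * a^-1)); last by ring.
by rewrite mulfV ?gt_eqF// mulr1.
Qed.

(** The mixed terms are controlled when one function is bounded while the other tends to 0 in L^1
    and in the moment of order r - 1. This is the form of almost disjointness used below. *)
Lemma powR_expand r (a b : R) : 1 < r ->
  `|a + b| `^ r <= `|a| `^ r + `|b| `^ r +
    2 `^ r * (`|a| `^ (r - 1) * `|b| + `|a| * `|b| `^ (r - 1)).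
Proof.
move=> r1; have r0 : 0 <= r by lra.
apply: (@le_trans _ _ ((`|a| + `|b|) `^ r)).
  by rewrite ge0_ler_powR ?nnegrE ?addr_ge0// ler_normD.
have a0 := normr_ge0 a; have b0 := normr_ge0 b.
have ar := powR_ge0 `|a| r; have br := powR_ge0 `|b| r.
have k0 := powR_ge0 2 r.
have ar1 := mulr_ge0 k0 (mulr_ge0 (powR_ge0 `|a| (r - 1)) b0).
have br1 := mulr_ge0 k0 (mulr_ge0 a0 (powR_ge0 `|b| (r - 1))).
rewrite mulrDr; have [ba|/ltW ab] := leP `|b| `|a|.
  by have := powR_addD r1 b0 ba; lra.
have := powR_addD r1 a0 ab; rewrite [`|b| + _]addrC [`|b| `^ (r - 1) * _]mulrC; lra.
Qed.

(** With u = 2x^2 - x one has exp(-u) <= 1/(1 + u), and (1 + x)(1 + u) = 1 + x^2 (1 + 2x) is at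
    least 1 precisely because x >= -1/2 makes the last factor nonnegative. *)
Lemma expR_riesz (x : R) : - (2^-1) <= x -> expR x <= (1 + x) * expR (2 * x ^+ 2).
Proof.
move=> hx; have y0 : 0 < 1 + (2 * x ^+ 2 - x) by nra.
have h : expR (x - 2 * x ^+ 2) <= 1 + x.
  have -> : x - 2 * x ^+ 2 = - (2 * x ^+ 2 - x) by lra.
  rewrite expRN; apply: (@le_trans _ _ (1 + (2 * x ^+ 2 - x))^-1).
    by rewrite lef_pV2 ?posrE ?expR_gt0// expR_ge1Dx.
  rewrite -[X in X <= _]mul1r ler_pdivrMr//.
  have -> : (1 + x) * (1 + (2 * x ^+ 2 - x)) = 1 + x ^+ 2 * (1 + 2 * x) by ring.
  rewrite lerDl mulr_ge0 ?sqr_ge0//; lra.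
have -> : expR x = expR (x - 2 * x ^+ 2) * expR (2 * x ^+ 2) by rewrite -expRD subrK.
by rewrite ler_wpM2r// expR_ge0.
Qed.

(** Raise u <= exp(u), with u = l t / r, to the power r. *)
Lemma powR_le_expR r (l t : R) : 0 < r -> 0 < l -> 0 <= t ->
  t `^ r <= (r / l) `^ r * expR (l * t).
Proof.
move=> r0 l0 t0.
have -> : expR (l * t) = expR (l * t / r) `^ r.
  by rewrite -expRM divfK// gt_eqF.
rewrite -powRM ?expR_ge0 ?divr_ge0 ?(ltW r0) ?(ltW l0)//.
rewrite ge0_ler_powR ?nnegrE ?(ltW r0)// ?mulr_ge0 ?expR_ge0 ?invr_ge0 ?(ltW r0) ?(ltW l0)//.
apply: (@le_trans _ _ (r / l * (l * t / r))).
  rewrite (_ : r / l * (l * t / r) = t * (r * r^-1) * (l * l^-1)); last by ring.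
  by rewrite !mulfV ?gt_eqF// !mulr1.
rewrite ler_wpM2l ?divr_ge0 ?(ltW r0) ?(ltW l0)//.
by apply: le_trans (expR_ge1Dx _); rewrite lerDr.
Qed.

Lemma powR_split2 p K t : 2 <= p -> 0 < K -> 0 <= t ->
  t `^ 2 <= K * t + K `^ (2 - p) * t `^ p.
Proof.
move=> p2 K0 t0; have tp := powR_ge0 t p; have kp := powR_ge0 K (2 - p).
have h1 : 0 <= K * t by rewrite mulr_ge0// ltW.
have h2 : 0 <= K `^ (2 - p) * t `^ p by rewrite mulr_ge0.
have [tK|tK] := leP t K.
  have : t `^ 2 <= K * t by rewrite powR_mulrn// expr2 ler_wpM2r.
  lra.
have t1 : 0 < t by apply: lt_trans tK.
have : t `^ 2 <= K `^ (2 - p) * t `^ p.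
  have -> : t `^ 2 = t `^ (2 - p) * t `^ p.
    by rewrite -powRD ?subrK// gt_eqF// implybT.
  rewrite ler_wpM2r// -opprB !powRN lef_pV2 ?posrE ?powR_gt0//.
  by rewrite ge0_ler_powR ?nnegrE ?(ltW K0) ?(ltW tK)// subr_ge0.
lra.
Qed.

(** Up to 2K the power is linearly bounded. Beyond 2K the point u is at most half of t in modulus,
    so |t| <= 2 |t - u|. *)
Lemma powR_near_bounded p K (t u : R) : 1 <= p -> 0 <= K -> `|u| <= K ->
  `|t| `^ p <= (2 * K) `^ (p - 1) * `|t| + 2 `^ p * `|t - u| `^ p.
Proof.
move=> p1 K0 uK; have p0 : 0 < p by lra.
have X0 : 0 <= (2 * K) `^ (p - 1) * `|t| by rewrite mulr_ge0// powR_ge0.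
have Y0 : 0 <= 2 `^ p * `|t - u| `^ p by rewrite mulr_ge0// powR_ge0.
have [tK|tK] := leP `|t| (2 * K).
  have : `|t| `^ p <= (2 * K) `^ (p - 1) * `|t|.
    rewrite -mulr_powRB1// mulrC ler_wpM2r// ge0_ler_powR ?nnegrE//; first lra.
    by rewrite mulr_ge0.
  lra.
have : `|t| `^ p <= 2 `^ p * `|t - u| `^ p.
  rewrite -powRM// ge0_ler_powR ?nnegrE ?mulr_ge0 ?(ltW p0)//.
  have := ler_normD (t - u) u; rewrite subrK; lra.
lra.
Qed.

(** For |t| <= 1 the product is t^2, and |t| <= e + t^2 / e; otherwise the product is |t| itself.
    Thus a small pairing of a function with its truncation at level 1 forces a small L^1 norm. *)
Lemma norm_le_trunc1 (e t : R) : 0 < e ->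
  `|t| <= e + (1 + e^-1) * (trunc 1 t * t).
Proof.
move=> e0; have e1 : 0 < e^-1 by rewrite invr_gt0.
case: (truncP t ler01) => -[h ->]; first last.
- by rewrite ltr0_norm; [nra|lra].
- by rewrite gtr0_norm; [nra|lra].
have t2 : t * t = `|t| * `|t| by rewrite -normrM ger0_norm// -expr2 sqr_ge0.
have t0 := normr_ge0 t.
rewrite t2; have [te|te] := leP `|t| e; first by nra.
have : `|t| <= e^-1 * (`|t| * `|t|).
  rewrite mulrA -[X in X <= _]mul1r ler_wpM2r// mulrC ler_pdivlMr// mul1r ltW//.
nra.
Qed.

End Inequalities.

(** * The duality pairing and weak limits along the ultrafilter *)

Section Pairing.
Context d (T : measurableType d) (R : realType) (P : probability T R).
Implicit Types (f g h : T -> R) (F G : nat -> T -> R) (r s a K : R).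
Local Notation itg := (itg P).
Local Notation mean := (mean P).
Local Notation mL := (mL P).
Local Notation mom := (mom P).
Local Notation nrm := (nrm P).

Definition pr f g : R := mean (fun x => f x * g x).

Lemma prC f g : pr f g = pr g f.
Proof. by congr mean; apply/funext => x; rewrite mulrC. Qed.

Lemma pr_linl r s a f f' g : conjg r s -> mL r f -> mL r f' -> mL s g ->
  pr (fun x => a * f x + f' x) g = a * pr f g + pr f' g.
Proof.
move=> c Lf Lf' Lg; have [i _] := hoelder_mean c Lf Lg.
have [i' _] := hoelder_mean c Lf' Lg.
rewrite /pr -meanZ// -meanD//; last exact: itgZ.
by congr mean; apply/funext => x; rewrite mulrDl mulrA.
Qed.

Lemma prDl r s f f' g : conjg r s -> mL r f -> mL r f' -> mL s g ->
  pr (fun x => f x + f' x) g = pr f g + pr f' g.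
Proof.
move=> c Lf Lf' Lg; rewrite -[pr f g]mul1r -(pr_linl 1 c Lf Lf' Lg).
by congr mean; apply/funext => x; rewrite mul1r.
Qed.

Lemma prZl r s a f g : conjg r s -> mL r f -> mL s g ->
  pr (fun x => a * f x) g = a * pr f g.
Proof.
move=> c Lf Lg; have [i _] := hoelder_mean c Lf Lg; rewrite /pr -meanZ//.
by congr mean; apply/funext => x; rewrite mulrA.
Qed.

Lemma prBl r s f f' g : conjg r s -> mL r f -> mL r f' -> mL s g ->
  pr (fun x => f x - f' x) g = pr f g - pr f' g.
Proof.
move=> c Lf Lf' Lg; rewrite -[- pr f' g]mulN1r -(prZl _ c)// -(prDl c)//.
  by congr mean; apply/funext => x; rewrite mulN1r.
exact: mLZ.
Qed.

Lemma pr_suml r s I (l : seq I) (Q : pred I) (H : I -> T -> R) g : conjg r s ->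
  (forall i, Q i -> mL r (H i)) -> mL s g ->
  pr (fun x => \sum_(i <- l | Q i) H i x) g = \sum_(i <- l | Q i) pr (H i) g.
Proof.
move=> c LH Lg; rewrite /pr -mean_sum; last first.
  by move=> i Qi; have [] := hoelder_mean c (LH i Qi) Lg.
by congr mean; apply/funext => x; rewrite mulr_suml.
Qed.

Lemma prDr r s f g g' : conjg r s -> mL r f -> mL s g -> mL s g' ->
  pr f (fun x => g x + g' x) = pr f g + pr f g'.
Proof.
by move=> /conjg_sym c Lf Lg Lg'; rewrite prC (prDl c)// prC [X in _ + X]prC.
Qed.

Lemma prBr r s f g g' : conjg r s -> mL r f -> mL s g -> mL s g' ->
  pr f (fun x => g x - g' x) = pr f g - pr f g'.
Proof.
by move=> /conjg_sym c Lf Lg Lg'; rewrite prC (prBl c)// prC [X in _ - X]prC.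
Qed.

Lemma prZr r s a f g : conjg r s -> mL r f -> mL s g ->
  pr f (fun x => a * g x) = a * pr f g.
Proof. by move=> /conjg_sym c Lf Lg; rewrite prC (prZl _ c)// prC. Qed.

Lemma pr_bound r s f g : conjg r s -> mL r f -> mL s g ->
  `|pr f g| <= nrm r f * nrm s g.
Proof. exact: hoelder_pair. Qed.

Lemma pr_bound1 K f g : itg f -> measurable_fun setT g -> (forall x, `|g x| <= K) ->
  `|pr f g| <= K * nrm 1 f.
Proof.
move=> itf mg gK; rewrite nrm1E -meanZ; last exact: itg_norm.
apply: mean_dom; last by apply: itgZ; exact: itg_norm.
  by apply: measurable_funM => //; exact: itg_meas itf.
by move=> x; rewrite normrM mulrC ler_wpM2r.
Qed.

Lemma pr_ext r s f f' : conjg r s -> mL r f -> mL r f' ->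
  (forall g, mL s g -> pr f g = pr f' g) -> nrm r (fun x => f x - f' x) = 0.
Proof.
move=> c Lf Lf' H; have r1 : 1 <= r by case: c => /ltW.
apply/eqP; rewrite eq_le nrm_ge0 andbT.
apply: (nrm_le_dual c) => // [|g Lg]; first exact: mLB.
by rewrite -/(pr _ _) (prBl c)// H// subrr normr0 mul0r.
Qed.

Context (U : set (set nat)).
Hypothesis UU : is_ultrafilter U.

Definition bdd r F := (forall n, mL r (F n)) /\ exists C : R, 0 <= C /\ forall n, nrm r (F n) <= C.
Definition nullr r F := ulim_to U (fun n => nrm r (F n)) 0.
(** The exponent is that of the test functions, hence conjugate to the one in which [F] is
    bounded. *)
Definition wnull s F := forall g, mL s g -> ulim_to U (fun n => pr (F n) g) 0.
Definition ubd F := (forall n, measurable_fun setT (F n)) /\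
  exists K : R, 0 <= K /\ forall n x, `|F n x| <= K.
Definition wlim_to r s F f := mL r f /\
  forall g, mL s g -> ulim_to U (fun n => pr (F n) g) (pr f g).

Lemma ubd_bdd r F : 0 < r -> ubd F -> bdd r F.
Proof.
move=> r0 [mF [K [K0 FK]]]; split=> [n|]; first exact: (mL_bounded _ (ltW r0) (mF n) (FK n)).
by exists K; split=> // n; exact: nrm_bounded.
Qed.

Lemma bddD r F G : 1 <= r -> bdd r F -> bdd r G -> bdd r (fun n x => F n x + G n x).
Proof.
move=> r1 [LF [C [C0 FC]]] [LG [D [D0 GD]]]; split=> [n|]; first exact: mLD.
exists (C + D); split=> [|n]; first exact: addr_ge0.
by apply: le_trans (nrmD _ _ _) _ => //; exact: lerD.
Qed.

Lemma bddZ r a F : 1 <= r -> bdd r F -> bdd r (fun n x => a * F n x).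
Proof.
move=> r1 [LF [C [C0 FC]]]; split=> [n|]; first exact: mLZ.
exists (`|a| * C); split=> [|n]; first exact: mulr_ge0.
by rewrite nrmZ ?ler_wpM2l//; apply: lt_le_trans r1.
Qed.

Lemma bddB r F G : 1 <= r -> bdd r F -> bdd r G -> bdd r (fun n x => F n x - G n x).
Proof.
move=> r1 bF /(bddZ (-1) r1) bG; have := bddD r1 bF bG.
by under eq_fun do under eq_fun do rewrite mulN1r.
Qed.

Lemma bdd_cst r f : mL r f -> bdd r (fun=> f).
Proof. by move=> Lf; split=> //; exists (nrm r f); rewrite nrm_ge0. Qed.

Lemma pr_ulim r s F g : conjg r s -> bdd r F -> mL s g ->
  ulim_to U (fun n => pr (F n) g) (ulim U (fun n => pr (F n) g)).
Proof.
move=> c [LF [C [C0 FC]]] Lg; apply: (ulim_ex UU (C := C * nrm s g)) => n.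
by apply: le_trans (pr_bound c _ _) _ => //; rewrite ler_wpM2r ?nrm_ge0.
Qed.

(** The [U]-limits of the pairings with [F] form a bounded functional on L^s, and its Riesz
    representative is the weak limit. *)
Lemma wlim_ex r s F : conjg r s -> bdd r F -> exists f, wlim_to r s F f.
Proof.
move=> c bF; have [LF [C [C0 FC]]] := bF; have c' := conjg_sym c.
pose phi g := ulim U (fun n => pr (F n) g).
have [] := @riesz_representation _ _ _ P s r C phi c' C0.
- move=> a f g Lf Lg; apply: (ulimE UU).
  have -> : (fun n => pr (F n) (fun x => a * f x + g x)) =
      (fun n => a * pr (F n) f + pr (F n) g).
    by apply/funext => n; rewrite (prDr c)// ?(prZr _ c)//; exact: mLZ.
  apply: (ulim_toD UU); last exact: pr_ulim bF Lg.
  by apply: (ulim_toZ UU); exact: pr_ulim bF Lf.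
- move=> f Lf; apply: (ulim_to_le UU (ulim_to_abs UU (pr_ulim c bF Lf)) (ulim_to_cst UU _)).
  apply: (ultraW UU) => n /=; apply: le_trans (pr_bound c _ _) _ => //.
  by rewrite ler_wpM2r ?nrm_ge0.
move=> f [Lf H]; exists f; split=> // g Lg.
by rewrite prC /pr -H//; exact: pr_ulim bF Lg.
Qed.

Lemma wlim_norm r s F f (C : R) : conjg r s -> (forall n, mL r (F n)) -> 0 <= C ->
  U [set n | nrm r (F n) <= C] -> wlim_to r s F f -> nrm r f <= C.
Proof.
move=> c LF C0 FC [Lf H]; apply: (nrm_le_dual c) => // g Lg; rewrite -/(pr f g).
apply: (ulim_to_le UU (ulim_to_abs UU (H g Lg)) (ulim_to_cst UU _)).
apply: (ultraS UU) FC => n /= FC; apply: le_trans (pr_bound c _ _) _ => //.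
by rewrite ler_wpM2r ?nrm_ge0.
Qed.

(* Testing a weak limit f of functions bounded by K against the dual function
   of f - trunc K f shows that f is bounded by K almost everywhere. *)
Lemma wlim_ubd r s F K : conjg r s -> 0 <= K -> (forall n, measurable_fun setT (F n)) ->
  (forall n x, `|F n x| <= K) ->
  exists f, wlim_to r s F f /\ forall x, `|f x| <= K.
Proof.
move=> c K0 mF FK; have [r1 s1 _] := c; have r0 : 0 < r by lra.
have s0 : 1 <= s by lra.
have bF : bdd r F by apply: ubd_bdd => //; split=> //; exists K.
have [f [Lf Hf]] := wlim_ex c bF; have [mf _] := Lf.
pose t x := trunc K (f x); have mt : measurable_fun setT t by exact: measurable_trunc.
have tK x : `|t x| <= K by exact: trunc_norm.
have Lt : mL r t by apply: mL_dom Lf => //; [exact: ltW|move=> x; exact: trunc_le].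
pose h x := f x - t x; have Lh : mL r h by apply: mLB => //; exact: ltW.
pose g := dualf r h; have Lg : mL s g by exact: mL_dualf.
have ig := mL_itg s0 Lg.
have gt x : g x * t x = K * `|g x|.
  rewrite /g /dualf /h /t; case: (truncP (f x) K0) => -[u ->].
  - by rewrite subrr !mul0r normr0 mulr0.
  - have v0 : 0 <= (f x - K) * `|f x - K| `^ (r - 2) by rewrite mulr_ge0 ?powR_ge0//; lra.
    by rewrite [in RHS](ger0_norm v0) mulrC.
  - have v0 : (f x - - K) * `|f x - - K| `^ (r - 2) <= 0.
      by rewrite mulr_le0_ge0 ?powR_ge0//; lra.
    by rewrite [in RHS](ler0_norm v0) mulrC mulNr mulrN.
have le1 : pr f g <= K * mean (fun x => `|g x|).
  apply: (ulim_to_le UU (Hf g Lg) (ulim_to_cst UU _)); apply: (ultraW UU) => n /=.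
  rewrite -nrm1E; apply: le_trans (ler_norm _) _; rewrite prC.
  exact: pr_bound1.
have e1 : pr f g = mom r h + K * mean (fun x => `|g x|).
  have -> : f = (fun x => h x + t x) by apply/funext => x; rewrite /h subrK.
  rewrite (prDl c)//; congr (_ + _).
    by rewrite /pr !momE; congr mean; apply/funext => x; rewrite /g dualf_mul.
  rewrite prC /pr; under eq_fun do rewrite gt.
  by rewrite meanZ//; exact: itg_norm.
have m0 : mom r h = 0.
  by have := mom_ge0 P r h; move: le1; rewrite e1; lra.
have n0 : nrm r h = 0 by rewrite !nrmE m0 powR0// invr_neq0// gt_eqF.
exists t; split=> //; split=> // g' Lg'.
suff <- : pr f g' = pr t g' by exact: Hf.
apply/eqP; rewrite -subr_eq0 -(prBl c)// -normr_le0.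
by have := pr_bound c Lh Lg'; rewrite n0 mul0r.
Qed.

Lemma wnull_sub_wlim r s F f : conjg r s -> bdd r F -> wlim_to r s F f ->
  wnull s (fun n x => F n x - f x).
Proof.
move=> c [LF _] [Lf H] g Lg; rewrite -(subrr (pr f g)).
have -> : (fun n => pr (fun x => F n x - f x) g) = (fun n => pr (F n) g - pr f g).
  by apply/funext => n; rewrite (prBl c).
by apply: (ulim_toB UU); [exact: H|exact: ulim_to_cst].
Qed.

Lemma wnull_bounded r s F : conjg r s -> bdd r F ->
  (forall g K, measurable_fun setT g -> (forall x, `|g x| <= K) ->
     ulim_to U (fun n => pr (F n) g) 0) -> wnull s F.
Proof.
move=> c [LF [C [C0 FC]]] H g Lg; have [_ s1 _] := c; have s0 : 1 <= s := ltW s1.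
apply: (ulim_to0P UU) => e e0; have C1 : 0 < C + 1 by lra.
have e2 : 0 < e / 2 by rewrite divr_gt0.
have e1 : 0 < e / 2 / (C + 1) by rewrite divr_gt0.
have [k /(_ k%:R (lexx _)) Hk] := trunc_approx s0 Lg e1.
have [mg _] := Lg.
have mt : measurable_fun setT (fun x => trunc k%:R (g x)) by exact: measurable_trunc.
have tk x : `|trunc k%:R (g x)| <= k%:R by exact: trunc_norm.
have Lt : mL s (fun x => trunc k%:R (g x)).
  by apply: (mL_bounded _ _ mt tk); lra.
apply: (ultraS UU) (H _ _ mt tk _ e2) => n /=; rewrite subr0 => hn.
have -> : pr (F n) g = pr (F n) (fun x => trunc k%:R (g x)) + pr (F n) (fun x => g x - trunc k%:R (g x)).
  by rewrite (prBr c)// addrC subrK.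
have LB : mL s (fun x => g x - trunc k%:R (g x)) by exact: mLB.
have b2 := pr_bound c (LF n) LB.
have : nrm r (F n) * nrm s (fun x => g x - trunc k%:R (g x)) <= (C + 1) * (e / 2 / (C + 1)).
  apply: ler_pM (nrm_ge0 _ _ _) (nrm_ge0 _ _ _) _ (ltW Hk).
  by apply: le_trans (FC n) _; rewrite lerDl.
rewrite [(C + 1) * _]mulrC divfK ?gt_eqF// => b3.
have := ler_normD (pr (F n) (fun x => trunc k%:R (g x))) (pr (F n) (fun x => g x - trunc k%:R (g x))).
move=> b4; apply: le_trans b4 _; rewrite [e]splitr; apply: lerD; first exact: ltW.
exact: le_trans b2 b3.
Qed.

End Pairing.

(** * Equi-integrable sequences, L^1-null sequences and the splitting *)

Section Splitting.
Context d (T : measurableType d) (R : realType) (P : probability T R).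
Context (U : set (set nat)).
Hypothesis UU : is_ultrafilter U.
Implicit Types (f g h : T -> R) (F G : nat -> T -> R) (r s a K e : R).
Local Notation itg := (itg P).
Local Notation mean := (mean P).
Local Notation mL := (mL P).
Local Notation mom := (mom P).
Local Notation nrm := (nrm P).
Local Notation pr := (pr P).
Local Notation bdd := (bdd P).
Local Notation nullr := (nullr P U).
Local Notation wnull := (wnull P U).
Local Notation wlim_to := (wlim_to P U).

Lemma mean_le_dom f g : measurable_fun setT f -> (forall x, 0 <= f x <= g x) ->
  itg g -> itg f /\ mean f <= mean g.
Proof.
move=> mf fg ig; have itf : itg f.
  by apply: itg_dom ig => // x; have /andP[? ?] := fg x; rewrite ger0_norm.
by split=> //; apply: le_mean => // x; have /andP[] := fg x.
Qed.

Lemma nrm_le_mom r f e : 0 < r -> 0 <= e -> mom r f <= e `^ r -> nrm r f <= e.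
Proof.
move=> r0 e0 h; have -> : e = (e `^ r) `^ r^-1 by rewrite -powRrM divff ?gt_eqF// powRr1.
by rewrite nrmE ge0_ler_powR ?nnegrE ?mom_ge0 ?powR_ge0// invr_ge0 ltW.
Qed.

Lemma mom_le_nrm r f e : 0 < r -> nrm r f <= e -> mom r f <= e `^ r.
Proof.
move=> r0 h; rewrite -nrm_powR// ge0_ler_powR ?nnegrE ?nrm_ge0//; first exact: ltW.
exact: le_trans (nrm_ge0 _ _ _) h.
Qed.

Lemma bdd_mom r F : 0 < r -> bdd r F -> exists C : R, 0 <= C /\ forall n, mom r (F n) <= C.
Proof.
move=> r0 [LF [C [C0 FC]]]; exists (C `^ r); split; first exact: powR_ge0.
by move=> n; exact: mom_le_nrm.
Qed.

Lemma bdd_dom r F G : 0 < r -> (forall n, measurable_fun setT (F n)) ->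
  (forall n x, `|F n x| <= `|G n x|) -> bdd r G -> bdd r F.
Proof.
move=> r0 mF FG [LG [C [C0 GC]]]; split=> [n|]; first exact: (mL_dom (ltW r0) (mF n) (FG n)).
by exists C; split=> // n; apply: le_trans (GC n); exact: (nrm_dom r0 (mF n) (FG n) (LG n)).
Qed.

Lemma nullrD r F G : 1 <= r -> bdd r F -> bdd r G -> nullr r F -> nullr r G ->
  nullr r (fun n x => F n x + G n x).
Proof.
move=> r1 [LF _] [LG _] nF nG.
apply: (ulim_to_squeeze UU) (_ : ulim_to U (fun n => nrm r (F n) + nrm r (G n)) 0); last first.
  by rewrite -[0]addr0; exact: ulim_toD.
by apply: (ultraW UU) => n /=; rewrite ger0_norm ?nrm_ge0//; exact: nrmD.
Qed.

Lemma nullr_nullr1 r F : 1 <= r -> bdd r F -> nullr r F -> nullr 1 F.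
Proof.
move=> r1 [LF _]; apply: (ulim_to_squeeze UU); apply: (ultraW UU) => n /=.
by rewrite ger0_norm ?nrm_ge0//; exact: nrm1_le.
Qed.

Lemma bdd1 r F : 1 <= r -> bdd r F -> bdd 1 F.
Proof.
move=> r1 [LF [C [C0 FC]]]; split=> [n|]; first exact/mL1_itg/(mL_itg r1).
by exists C; split=> // n; apply: le_trans (FC n); exact: nrm1_le.
Qed.

Lemma null1_wnull r s F : conjg r s -> bdd r F -> nullr 1 F -> wnull s F.
Proof.
move=> c bF nF; have [LF _] := bF; have [/ltW r1 _ _] := c.
apply: (wnull_bounded UU c bF) => g K mg gK.
apply: (ulim_to_squeeze UU) (_ : ulim_to U (fun n => K * nrm 1 (F n)) 0); last first.
  by rewrite -(mulr0 K); exact: ulim_toZ.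
by apply: (ultraW UU) => n /=; apply: pr_bound1 => //; exact: (mL_itg r1).
Qed.

(** By [powR_interp] the moment is at most a small multiple of the bounded quantity 1 + |F|^r plus a
    multiple of the L^1 norm. It says that the dual functions of [F] are again null in L^1. *)
Lemma null1_mom r F : 1 < r -> bdd r F -> nullr 1 F ->
  ulim_to U (fun n => mom (r - 1) (F n)) 0.
Proof.
move=> r1 bF nF; have r0 : 0 < r by lra. have [C [C0 FC]] := bdd_mom r0 bF.
have [LF _] := bF.
apply: (ulim_to0P UU) => e e0; have C1 : 0 < 1 + C by lra.
have d0 : 0 < e / 2 / (1 + C) by rewrite !divr_gt0.
have [D [D0 HD]] := powR_interp r1 d0.
have e2 : 0 < e / 2 by rewrite divr_gt0.
have := ulim_toZ UU D nF; rewrite mulr0 => /(_ _ e2).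
apply: (ultraS UU) => n /=; rewrite subr0 ger0_norm; last first.
  by rewrite mulr_ge0// nrm_ge0.
move=> hn; rewrite ger0_norm ?mom_ge0//.
have [mF itF] := LF n; have i1 := mL_itg (ltW r1) (LF n).
have iA : itg (fun x => 1 + `|F n x| `^ r) by apply: itgD => //; exact: itg_cst.
have iB := itgZ (e / 2 / (1 + C)) iA; have iC := itgZ D (itg_norm i1).
have h x : 0 <= `|F n x| `^ (r - 1) <=
    e / 2 / (1 + C) * (1 + `|F n x| `^ r) + D * `|F n x| by rewrite powR_ge0 HD.
have [_ H] := mean_le_dom (measurable_abs_powR _ mF) h (itgD iB iC).
rewrite momE; apply: le_trans H _.
rewrite meanD// !meanZ//; last exact: itg_norm.
rewrite meanD//; last exact: itg_cst.
rewrite mean_cst -nrm1E [e]splitr; apply: lerD; last exact: ltW.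
rewrite -splitr mulrAC ler_pdivrMr// ler_wpM2l ?(ltW e2)//.
by rewrite lerD2l -momE; exact: FC.
Qed.

(* Equi-integrability along U of the r-th powers. *)
Definition EI r F := bdd r F /\ forall e, 0 < e ->
  exists G, ubd G /\ U [set n | nrm r (fun x => F n x - G n x) <= e].

Lemma EI_null1 r F : 1 <= r -> EI r F -> nullr 1 F -> nullr r F.
Proof.
move=> r1 [bF H] nF; have [LF _] := bF; have r0 : 0 < r by lra.
(* The quarter pays for the factor 2^r of [powR_near_bounded]: 2^r (e/4)^r = (e/2)^r <= e^r / 2,
   because r >= 1. *)
apply: (ulim_to0P UU) => e e0; have e4 : 0 < e / 4 by rewrite divr_gt0.
have [G [[mG [K [K0 GK]]] FG]] := H _ e4.
have er : 0 < e `^ r / 2 by rewrite divr_gt0// powR_gt0.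
have := ulim_toZ UU ((2 * K) `^ (r - 1)) nF; rewrite mulr0 => /(_ _ er) h2.
apply: (ultraS UU) (ultraI UU FG h2) => n [/= a]; rewrite subr0 ger0_norm; last first.
  by rewrite mulr_ge0 ?powR_ge0 ?nrm_ge0.
move=> b; rewrite ger0_norm ?nrm_ge0//; apply: nrm_le_mom => //; first exact: ltW.
have LG : mL r (G n) by exact: (mL_bounded _ (ltW r0) (mG n) (GK n)).
have LB := mLB r1 (LF n) LG; have [mF _] := LF n; have i1 := mL_itg r1 (LF n).
have ma := mom_le_nrm r0 a.
have iA := itgZ ((2 * K) `^ (r - 1)) (itg_norm i1).
have iB := itgZ (2 `^ r) LB.2.
have h x : 0 <= `|F n x| `^ r <= (2 * K) `^ (r - 1) * `|F n x| +
    2 `^ r * `|F n x - G n x| `^ r by rewrite powR_ge0 powR_near_bounded.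
have [_ H'] := mean_le_dom (measurable_abs_powR _ mF) h (itgD iA iB).
rewrite momE; apply: le_trans H' _.
rewrite meanD// !meanZ//; [|exact: LB.2|exact: itg_norm].
rewrite -nrm1E -momE [e `^ r]splitr; apply: lerD; first exact: ltW.
apply: le_trans (ler_wpM2l (powR_ge0 2 r) ma) _.
rewrite -powRM ?(ltW e4)//; have -> : 2 * (e / 4) = e * 2^-1 by lra.
rewrite powRM ?(ltW e0)// ler_wpM2l ?powR_ge0//.
by rewrite ge1r_powR// invr_gt0 ltr0n/= invf_le1 ?ler1n.
Qed.

(** Replace [F] by a uniformly bounded [G] at a small cost in L^r: the L^1 norm of [phi] controls
    the pairing with [G], Hoelder the pairing with F - G. *)
Lemma EI_killed r s F phi : conjg r s -> EI r F -> bdd s phi -> nullr 1 phi ->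
  ulim_to U (fun n => pr (phi n) (F n)) 0.
Proof.
move=> c [[LF _] H] [Lp [C [C0 HC]]] nphi; have [r1 s1 _] := c.
have [r1' s1'] := (ltW r1, ltW s1); have r0 : 0 <= r by lra.
apply: (ulim_to0P UU) => e e0; have C1 : 0 < C + 1 by lra.
have e2 : 0 < e / 2 by rewrite divr_gt0.
have e4 : 0 < e / 2 / (C + 1) by rewrite divr_gt0.
have [G [[mG [K [K0 GK]]] FG]] := H _ e4.
have := ulim_toZ UU K nphi; rewrite mulr0 => /(_ _ e2) h2.
apply: (ultraS UU) (ultraI UU FG h2) => n [/= a]; rewrite subr0 ger0_norm; last first.
  by rewrite mulr_ge0 ?nrm_ge0.
move=> b; have LG : mL r (G n) by exact: (mL_bounded _ r0 (mG n) (GK n)).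
have LB := mLB r1' (LF n) LG.
have -> : pr (phi n) (F n) = pr (phi n) (G n) + pr (phi n) (fun x => F n x - G n x).
  by rewrite (prBr (conjg_sym c))// addrC subrK.
apply: le_trans (ler_normD _ _) _; rewrite [e]splitr; apply: lerD.
  apply: le_trans (ltW b); apply: pr_bound1 => //; exact: (mL_itg s1').
apply: le_trans (pr_bound (conjg_sym c) (Lp n) LB) _.
apply: (@le_trans _ _ ((C + 1) * (e / 2 / (C + 1)))); last by rewrite mulrC divfK// gt_eqF.
apply: ler_pM (nrm_ge0 _ _ _) (nrm_ge0 _ _ _) _ a.
by apply: le_trans (HC n) _; rewrite lerDl.
Qed.

Lemma null1_killed r F phi : 1 <= r -> bdd r F -> nullr 1 F -> ubd phi ->
  ulim_to U (fun n => pr (phi n) (F n)) 0.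
Proof.
move=> r1 [LF _] nF [mp [K [K0 HK]]].
apply: (ulim_to_squeeze UU) (_ : ulim_to U (fun n => K * nrm 1 (F n)) 0); last first.
  by rewrite -(mulr0 K); exact: ulim_toZ.
by apply: (ultraW UU) => n /=; rewrite prC; apply: pr_bound1 => //; exact: (mL_itg r1).
Qed.

(** The dual functions of [F] are themselves admissible: they are bounded in L^s and null in L^1 by
    [null1_mom]. Their pairing with [F] is the r-th moment. *)
Lemma null1_separated r s F : conjg r s -> bdd r F -> nullr 1 F ->
  (forall phi, bdd s phi -> nullr 1 phi -> ulim_to U (fun n => pr (phi n) (F n)) 0) ->
  nullr r F.
Proof.
move=> c bF nF H; have [LF _] := bF; have [r1 s1 _] := c; have r0 : 0 < r by lra.
have s0 : 0 < s by lra.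
have [C [C0 FC]] := bdd_mom r0 bF.
have bp : bdd s (fun n => dualf r (F n)).
  split=> [n|]; first exact: mL_dualf.
  exists (C `^ s^-1); split=> [|n]; first exact: powR_ge0.
  rewrite nrmE (mom_dualf _ _ c) ge0_ler_powR ?nnegrE ?mom_ge0//.
  by rewrite invr_ge0 ltW.
have np : nullr 1 (fun n => dualf r (F n)).
  apply: (ulim_to_eq UU) (null1_mom r1 bF nF); apply: (ultraW UU) => n /=.
  by rewrite nrm1E momE; congr mean; apply/funext => x; rewrite dualf_norm.
have H0 := H _ bp np.
apply: (ulim_to0P UU) => e e0; have er : 0 < e `^ r by rewrite powR_gt0.
apply: (ultraS UU) (H0 _ er) => n /=; rewrite subr0.
have -> : pr (dualf r (F n)) (F n) = mom r (F n).
  by rewrite prC momE; congr mean; apply/funext => x; rewrite dualf_mul.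
rewrite !ger0_norm ?mom_ge0 ?nrm_ge0// => h.
by apply: nrm_le_mom => //; exact: ltW.
Qed.

(** The test sequence is trunc 1 F minus its weak limit [w]. Since [F] is weakly null it does not
    see [w], so the pairing of [F] with trunc 1 F tends to 0; [norm_le_trunc1] makes [F] null in L^1
    and [EI_null1] null in L^r. *)
Lemma EI_separated r s F : conjg r s -> EI r F -> wnull s F ->
  (forall phi, ubd phi -> wnull r phi -> ulim_to U (fun n => pr (phi n) (F n)) 0) ->
  nullr r F.
Proof.
move=> c EF wF H; have [[LF _] _] := EF; have [r1 s1 _] := c.
have [r1' s1'] := (ltW r1, ltW s1).
have mF n : measurable_fun setT (F n) by case: (LF n).
pose t n x := trunc 1 (F n x).
have mt n : measurable_fun setT (t n) by exact: measurable_trunc.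
have t1 n x : `|t n x| <= 1 by exact: trunc_norm.
have [w [wt w1]] := wlim_ubd P UU (conjg_sym c) ler01 mt t1.
have [Lw _] := wt; have [mw _] := Lw.
have ut : ubd t by split=> //; exists 1.
have bt : bdd s t by apply: ubd_bdd ut; lra.
have up : ubd (fun n x => t n x - w x).
  split=> [n|]; first exact: measurable_funB.
  exists 2; split=> // n x; apply: le_trans (ler_normB _ _) _.
  by have := t1 n x; have := w1 x; lra.
have wp := wnull_sub_wlim UU (conjg_sym c) bt wt.
have H0 := H _ up wp.
have H1 : ulim_to U (fun n => pr (t n) (F n)) 0.
  rewrite -[0](addr0 0); apply: (ulim_to_eq UU) (ulim_toD UU H0 (wF _ Lw)).
  apply: (ultraW UU) => n /=; rewrite [pr (F n) w]prC -(prDl (conjg_sym c))//.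
  - by congr mean; apply/funext => x; rewrite subrK.
  - by apply: mLB => //; case: bt.
apply: EI_null1 => //; apply: (ulim_to0P UU) => e e0.
have e2 : 0 < e / 2 by rewrite divr_gt0.
have := ulim_toZ UU (1 + (e / 2)^-1) H1; rewrite mulr0 => /(_ _ e2).
apply: (ultraS UU) => n /=; rewrite subr0 => h.
rewrite ger0_norm ?nrm_ge0// nrm1E.
have i1 := mL_itg r1' (LF n).
have [i2 _] := hoelder_mean (conjg_sym c) (bt.1 n) (LF n).
have iZ := itgZ (1 + (e / 2)^-1) i2.
apply: (@le_trans _ _ (mean (fun x => e / 2 + (1 + (e / 2)^-1) * (t n x * F n x)))).
  apply: le_mean; [exact: itg_norm|by apply: itgD => //; exact: itg_cst|].
  by move=> x; exact: norm_le_trunc1.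
rewrite meanD//; last exact: itg_cst.
rewrite mean_cst meanZ//; apply: (@le_trans _ _ (e / 2 + e / 2)); last by rewrite -splitr.
by apply: lerD => //; apply: le_trans (ltW h); exact: ler_norm.
Qed.

Lemma downclosed_nat (Q : nat -> Prop) N : (forall m k, (m <= k)%N -> Q k -> Q m) ->
  exists k, (k <= N)%N /\ forall m, (m < N)%N -> (Q m <-> (m < k)%N).
Proof.
move=> dQ; elim: N => [|N [k [kN IH]]]; first by exists 0%N.
have [QN|nQ] := pselect (Q N).
  by exists N.+1; split=> // m mN; split=> // _; apply: (dQ m N).
exists k; split=> [|m]; first exact: leqW.
rewrite ltnS leq_eqVlt => /predU1P[->|]; last exact: IH.
by split=> // Nk; have := leq_trans Nk kN; rewrite ltnn.
Qed.

Hypothesis UN : nonprincipal U.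

(* The truncation levels l n tend to infinity so slowly that the truncation
   errors mom (F n - trunc j (F n)), j <= l n, are close to their U-limits. *)
Lemma split_null1_EI r F : 1 < r -> bdd r F -> exists l : nat -> nat,
  EI r (fun n x => trunc (l n)%:R (F n x)) /\
  nullr 1 (fun n x => F n x - trunc (l n)%:R (F n x)).
Proof.
move=> r1 bF; have r0 : 0 < r by lra. have r1' := ltW r1.
have [LF _] := bF; have [C [C0 FC]] := bdd_mom r0 bF.
have mF n : measurable_fun setT (F n) by case: (LF n).
have mt n K : measurable_fun setT (fun x => trunc K (F n x)) by exact: measurable_trunc.
have mrest n K : measurable_fun setT (fun x => F n x - trunc K (F n x)).
  exact: measurable_funB.
have Lrest n (j : nat) : mL r (fun x => F n x - trunc j%:R (F n x)).
  by apply: mL_dom (LF n) => //; [exact: ltW|move=> x; exact: trunc_rest_le].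
pose t n (j : nat) := mom r (fun x => F n x - trunc j%:R (F n x)).
have t0 n j : 0 <= t n j by exact: mom_ge0.
have tC n j : `|t n j| <= C.
  rewrite ger0_norm//; apply: le_trans (FC n); apply: mom_dom => //; first exact: ltW.
  by move=> x; exact: trunc_rest_le.
pose h j := ulim U (fun n => t n j).
have th j : ulim_to U (fun n => t n j) (h j) by exact: (ulim_ex UU (tC^~ j)).
have h0 j : 0 <= h j.
  by apply: (ulim_to_le UU (ulim_to_cst UU _) (th j)); apply: (ultraW UU) => n /=.
have hH : has_inf [set h j | j in setT].
  by split; [exists (h 0%N), 0%N|exists 0 => _ [j _ <-]].
(* [L] is the limiting r-th moment that no fixed truncation level captures. With h j <= L + e^r/2
   and h l >= L, the slab between [j] and the moving level costs at most e^r/2 plus twice e^r/4. *)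
set L := inf [set h j | j in setT].
have Lh j : L <= h j by apply: (ge_inf hH.2); exists j.
(* Quantifying over all k <= m makes [Q n] downward closed, so that the good levels for n form an
   initial segment. *)
pose Q n m := forall k, (k <= m)%N -> forall j, (j <= k)%N -> `|t n j - h j| < 2^-1 ^+ k.
have UQ m : U [set n | Q n m].
  apply: (ultraS UU) (@ultra_bigI U UU (fun k => [set n | forall j, (j < k.+1)%N ->
    `|t n j - h j| < 2^-1 ^+ k]) m.+1 _) => [n /= H k km j jk|k _].
    exact: H.
  apply: (@ultra_bigI U UU (fun j => [set n | `|t n j - h j| < 2^-1 ^+ k])) => j _.
  by apply: th; rewrite exprn_gt0// invr_gt0.
have /choice[k Hk] : forall n, exists k, (k <= n)%N /\ forall m, (m < n)%N -> (Q n m <-> (m < k)%N).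
  by move=> n; apply: downclosed_nat => m k mk Qk j jm; apply: Qk; exact: leq_trans mk.
(* [k n] counts the good levels, so the last good one is its predecessor. On a set of [U] the count
   is positive and the predecessor is genuine. *)
have Uk m : U [set n | (m <= (k n).-1)%N /\ Q n (k n).-1].
  apply: (ultraS UU) (ultraI UU (UQ m) (ultra_ge UU UN m.+1)) => n [/= Qm mn].
  have [kn Hn] := Hk n; have mk : (m < k n)%N by apply/(Hn m mn).
  have k0 : (0 < k n)%N by exact: leq_ltn_trans mk.
  split; first by rewrite -ltnS prednK.
  apply/(Hn (k n).-1); last by rewrite prednK.
  by apply: leq_trans kn; rewrite prednK.
exists (fun n => (k n).-1); split; last first.
  apply: (ulim_to0P UU) => e e0.
  (* Chosen so that m^(r-1) >= C/e; the Chebyshev-type bound [trunc_rest_powR] then makes the L^1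
     error at most e. *)
  pose m := (Num.truncn ((C / e) `^ (r - 1)^-1)).+1.
  have mC : (C / e) `^ (r - 1)^-1 < m%:R by exact: truncnS_gt.
  have r2 : 0 < r - 1 by lra.
  apply: (ultraS UU) (Uk m) => n [/= mk _].
  rewrite ger0_norm ?nrm_ge0//; set l := (k n).-1 in mk *.
  have l0 : 0 < l%:R :> R by rewrite ltr0n; apply: leq_trans mk.
  have H : nrm 1 (fun x => F n x - trunc l%:R (F n x)) * l%:R `^ (r - 1) <= C.
    apply: le_trans (FC n); rewrite nrm1E mulrC -meanZ; last first.
      exact/itg_norm/(mL_itg r1').
    rewrite momE; apply: le_mean; [by apply/itgZ/itg_norm/(mL_itg r1')|by case: (LF n)|].
    by move=> x; rewrite mulrC; exact: trunc_rest_powR.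
  have Ce : C / e <= l%:R `^ (r - 1).
    have -> : C / e = ((C / e) `^ (r - 1)^-1) `^ (r - 1).
      by rewrite -powRrM mulVf ?gt_eqF// powRr1// divr_ge0// ltW.
    rewrite ge0_ler_powR ?nnegrE ?powR_ge0 ?(ltW r2)//.
    by apply: le_trans (ltW mC) _; rewrite ler_nat.
  have lr : 0 < l%:R `^ (r - 1) by rewrite powR_gt0.
  rewrite -(ler_pM2r lr); apply: le_trans H _.
  by rewrite mulrC -ler_pdivrMr.
split.
  apply: bdd_dom bF => // n x; exact: trunc_le.
move=> e e0; have er : 0 < e `^ r by rewrite powR_gt0.
have er2 : 0 < e `^ r / 2 by rewrite divr_gt0.
have [_ [j _ <-] hj] := inf_adherent er2 hH.
have er4 : 0 < e `^ r / 4 by rewrite divr_gt0.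
have [q hq] : exists q : nat, 2^-1 ^+ q < e `^ r / 4.
  have /cvgrPdist_lt /(_ _ er4) [q _ Hq] : (fun q => 2^-1 ^+ q : R) @ \oo --> (0 : R).
    by apply: cvg_expr; rewrite ger0_norm ?invr_ge0// invf_lt1// ltr1n.
  exists q; have := Hq q (leqnn q); rewrite sub0r normrN ger0_norm//.
exists (fun n x => trunc j%:R (F n x)); split.
  split=> // ; exists j%:R; split=> // n x; exact: trunc_norm.
apply: (ultraS UU) (Uk (maxn j q)) => n [/=]; set l := (k n).-1.
rewrite geq_max => /andP[jl ql] Ql.
apply: nrm_le_mom => //; first exact: ltW.
have a1 := Ql l (leqnn l) j jl; have a2 := Ql l (leqnn l) l (leqnn l).
have lq : 2^-1 ^+ l <= 2^-1 ^+ q :> R.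
  by apply: ler_wiXn2l => //; rewrite invf_le1// ler1n.
have Ld : mL r (fun x => trunc l%:R (F n x) - trunc j%:R (F n x)).
  apply: mLB => //; apply: mL_dom (LF n); rewrite ?(ltW r0)// => x; exact: trunc_le.
have key : mom r (fun x => trunc l%:R (F n x) - trunc j%:R (F n x)) + t n l <= t n j.
  rewrite /t !momE -meanD; [|exact: Ld.2|exact: (Lrest n l).2].
  apply: le_mean; [by apply: itgD; [exact: Ld.2|exact: (Lrest n l).2]|exact: (Lrest n j).2|].
  by move=> x; apply: trunc_split_powR => //; rewrite ler_nat.
move: key; rewrite -lerBrDr => key; apply: le_trans key _.
move: a1 a2 hj (Lh l); rewrite -/L !ltr_norml => /andP[_ b1] /andP[b2 _] b3 b4.
have : t n j - h j + (h l - t n l) <= e `^ r / 4 + e `^ r / 4.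
  by apply: lerD; [|rewrite -lerN2 opprB]; apply: ltW; [apply: lt_le_trans b1 _|apply: le_lt_trans b2; rewrite lerN2]; apply: le_trans lq (ltW hq).
move: b3 b4; move: (e `^ r) (t n j) (t n l) (h j) (h l) (L) => A B1 B2 D1 D2 L'; lra.
Qed.

End Splitting.

(** * Characterisation by killing functionals, and bounded approximants *)

Section Approximation.
Context d (T : measurableType d) (R : realType) (P : probability T R).
Context (U : set (set nat)).
Hypothesis UU : is_ultrafilter U.
Hypothesis UN : nonprincipal U.
Implicit Types (f g h : T -> R) (F G : nat -> T -> R) (r s a K e : R).
Local Notation itg := (itg P).
Local Notation mean := (mean P).
Local Notation mL := (mL P).
Local Notation mom := (mom P).
Local Notation nrm := (nrm P).
Local Notation pr := (pr P).
Local Notation bdd := (bdd P).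
Local Notation nullr := (nullr P U).
Local Notation wnull := (wnull P U).
Local Notation wlim_to := (wlim_to P U).
Local Notation EI := (EI P U).

Lemma wnull_diff r s F G : conjg r s -> bdd r F -> bdd r G -> wnull s F -> wnull s G ->
  wnull s (fun n x => F n x - G n x).
Proof.
move=> c [LF _] [LG _] wF wG g Lg; rewrite -[0](subr0 0).
apply: (ulim_to_eq UU) (ulim_toB UU (wF g Lg) (wG g Lg)).
by apply: (ultraW UU) => n /=; rewrite (prBl c).
Qed.

Lemma pr_nullr_killed r s F phi : conjg r s -> bdd r F -> nullr r F -> bdd s phi ->
  ulim_to U (fun n => pr (phi n) (F n)) 0.
Proof.
move=> c [LF _] nF [Lp [C [C0 pC]]].
apply: (ulim_to_squeeze UU) (_ : ulim_to U (fun n => C * nrm r (F n)) 0); last first.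
  by rewrite -(mulr0 C); exact: ulim_toZ.
apply: (ultraW UU) => n /=; apply: le_trans (pr_bound (conjg_sym c) (Lp n) (LF n)) _.
by apply: ler_wpM2r; rewrite ?nrm_ge0.
Qed.

Lemma EI_nullr r F G : 1 <= r -> EI r F -> bdd r G ->
  nullr r (fun n x => G n x - F n x) -> EI r G.
Proof.
move=> r1 [[LF bF] H] [LG bG] nFG; split=> // e e0.
have e2 : 0 < e / 2 by rewrite divr_gt0.
have [E [uE hE]] := H _ e2; exists E; split=> //.
have r0 : 0 < r by lra.
have [LE _] := ubd_bdd P r0 uE.
apply: (ultraS UU) (ultraI UU hE (nFG _ e2)) => n [/= a].
rewrite subr0 ger0_norm ?nrm_ge0// => b.
have L1 := mLB r1 (LG n) (LF n); have L2 := mLB r1 (LF n) (LE n).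
have := nrmD r1 L1 L2.
have -> : (fun x => G n x - F n x + (F n x - E n x)) = (fun x => G n x - E n x).
  by apply/funext => x; rewrite addrA subrK.
move=> h; apply: le_trans h _; rewrite [e]splitr; apply: lerD => //; exact: ltW.
Qed.

(** Converse of [EI_killed]. Split [F]: its equi-integrable part is killed by these functionals
    anyway, so its L^1-null part is killed as well and is norm null by [null1_separated]. *)
Lemma EI_killing r s F : conjg r s -> bdd r F ->
  (forall phi, bdd s phi -> nullr 1 phi -> ulim_to U (fun n => pr (phi n) (F n)) 0) ->
  EI r F.
Proof.
move=> c bF H; have [r1 _ _] := c; have r1' := ltW r1.
have [l [EE n1]] := split_null1_EI UU UN r1 bF.
have [bE _] := EE.
have bD := bddB r1' bF bE.
apply: (EI_nullr r1' EE bF); apply: (null1_separated UU c bD n1) => phi bp np.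
rewrite -[0](subr0 0).
apply: (ulim_to_eq UU) (ulim_toB UU (H _ bp np) (EI_killed UU c EE bp np)).
by apply: (ultraW UU) => n /=; rewrite (prBr (conjg_sym c))//; [case: bp|case: bF|case: bE].
Qed.

(** The same argument with the roles exchanged: the equi-integrable part inherits weak nullity and
    the killing, so [EI_separated] removes it. *)
Lemma null1_killing r s F : conjg r s -> bdd r F -> wnull s F ->
  (forall phi, ubd phi -> wnull r phi -> ulim_to U (fun n => pr (phi n) (F n)) 0) ->
  nullr 1 F.
Proof.
move=> c bF wF H; have [r1 s1 _] := c; have r1' := ltW r1; have s0 : 0 < s by lra.
have [l [EE n1]] := split_null1_EI UU UN r1 bF.
have [bE _] := EE; have bD := bddB r1' bF bE.
have wD := null1_wnull UU c bD n1.
have wE := wnull_diff c bF bD wF wD.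
have EEq : (fun n x => F n x - (F n x - trunc (l n)%:R (F n x))) = (fun n x => trunc (l n)%:R (F n x)).
  by apply/funext => n; apply/funext => x; rewrite subKr.
rewrite EEq in wE.
have nE : nullr r (fun n x => trunc (l n)%:R (F n x)).
  apply: (EI_separated UU c EE wE) => phi up wp; rewrite -[0](subr0 0).
  apply: (ulim_to_eq UU) (ulim_toB UU (H _ up wp) (null1_killed UU r1' bD n1 up)).
  apply: (ultraW UU) => n /=; rewrite -(prBr (conjg_sym c)); last 3 first.
  - by have [] := ubd_bdd P s0 up.
  - by case: bF.
  - by case: bD.
  by congr pr; apply/funext => x; rewrite subKr.
have := nullrD UU (lexx 1) (bdd1 r1' bD) (bdd1 r1' bE) n1 (nullr_nullr1 UU r1' bE nE).
by under eq_fun do under eq_fun do rewrite subrK.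
Qed.

(** The n-th function is truncated with error below 1/(n+1). The bounds depend on n, but the
    selection only needs each single function to be bounded, and the error vanishes in the
    ultrapower. *)
Lemma null1_bounded_approx r F : 1 < r -> bdd r F -> nullr 1 F ->
  exists G, [/\ bdd r G, nullr 1 G, forall n, exists B : R, 0 <= B /\ forall x, `|G n x| <= B &
    nullr r (fun n x => F n x - G n x)].
Proof.
move=> r1 bF nF; have r1' := ltW r1; have r0 : 0 < r by lra.
have [LF _] := bF.
have h n : 0 < n.+1%:R^-1 :> R by rewrite invr_gt0.
have /choice[l Hl] : forall n, exists k : nat, nrm r (fun x => F n x - trunc k%:R (F n x)) < n.+1%:R^-1.
  by move=> n; have [k Hk] := trunc_approx r1' (LF n) (h n); exists k; exact: Hk.
have mt n : measurable_fun setT (fun x => trunc (l n)%:R (F n x)).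
  by apply: measurable_trunc; case: (LF n).
have le n x : `|trunc (l n)%:R (F n x)| <= `|F n x| by exact: trunc_le.
exists (fun n x => trunc (l n)%:R (F n x)); split.
- exact: bdd_dom bF.
- apply: (ulim_to_squeeze UU) nF; apply: (ultraW UU) => n /=; rewrite ger0_norm ?nrm_ge0//.
  by apply: nrm_dom => //; apply/mL1_itg; exact: mL_itg (LF n).
- by move=> n; exists (l n)%:R; split=> // x; exact: trunc_norm.
apply: (ulim_to_ge UU UN) => e e0; exists (Num.truncn e^-1) => n en.
rewrite ger0_norm ?nrm_ge0//; apply: le_trans (ltW (Hl n)) _.
rewrite -[X in _ <= X]invrK lef_pV2 ?posrE ?invr_gt0//.
apply: le_trans (ltW (truncnS_gt _)) _; by rewrite ler_nat.
Qed.

(** A bounded approximant [G] becomes weakly null after subtraction of its weak limit [w]. As [F] is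
    weakly null, [w] is also the weak limit of G - F, so its norm is at most e/2. *)
Lemma EI_ubd_approx r s F e : conjg r s -> EI r F -> wnull s F -> 0 < e ->
  exists G, [/\ ubd G, wnull s G & U [set n | nrm r (fun x => F n x - G n x) <= e]].
Proof.
move=> c [bF H] wF e0; have e2 : 0 < e / 2 by rewrite divr_gt0.
have [r1 s1 _] := c; have r1' := ltW r1; have r0 : 0 < r by lra. have [LF _] := bF.
have [G [uG hG]] := H _ e2; have [mG [K [K0 GK]]] := uG.
have [w [wG wK]] := wlim_ubd P UU c K0 mG GK; have [Lw Hw] := wG.
have bG := ubd_bdd P r0 uG; have [LG _] := bG.
exists (fun n x => G n x - w x); split.
- split=> [n|]; first by apply: measurable_funB => //; case: Lw.
  exists (K + K); split=> [|n x]; first exact: addr_ge0.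
  by apply: le_trans (ler_normB _ _) _; exact: lerD.
- exact: wnull_sub_wlim wG.
have nw : nrm r w <= e / 2.
  have LGF n := mLB r1' (LG n) (LF n).
  apply: (wlim_norm UU c LGF (ltW e2)).
    by apply: (ultraS UU) hG => n /=; rewrite nrmBC.
  split=> // g Lg; rewrite -[pr w g]subr0.
  apply: (ulim_to_eq UU) (ulim_toB UU (Hw g Lg) (wF g Lg)).
  by apply: (ultraW UU) => n /=; rewrite (prBl c).
apply: (ultraS UU) hG => n /= hn.
have -> : (fun x => F n x - (G n x - w x)) = (fun x => F n x - G n x + w x).
  by apply/funext => x; rewrite opprB addrA addrAC.
apply: le_trans (nrmD r1' (mLB r1' (LF n) (LG n)) Lw) _.
by rewrite [e]splitr; exact: lerD.
Qed.

End Approximation.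

(** * Partial sums and products over a selected set *)

Section BigSelected.
Context (V : Type) (idx : V) (op : Monoid.law idx) (A : set nat) (f : nat -> V).

Lemma big_selected_pred m n : (m < n)%N -> (forall k, (m < k < n)%N -> ~ A k) ->
  \big[op/idx]_(0 <= i < n | i \in A) f i = \big[op/idx]_(0 <= i < m.+1 | i \in A) f i.
Proof.
move=> mn H; rewrite (@big_cat_nat _ _ _ m.+1)//= [X in op _ X]big1_seq ?Monoid.mulm1//.
move=> i /andP[/set_mem Ai]; rewrite mem_index_iota => mi.
by case: (H i mi).
Qed.

Lemma big_selected_first n : (forall m, (m < n)%N -> ~ A m) ->
  \big[op/idx]_(0 <= i < n | i \in A) f i = idx.
Proof.
move=> H; rewrite big1_seq// => i /andP[/set_mem Ai]; rewrite mem_index_iota => /andP[_ ni].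
by case: (H i ni).
Qed.

Lemma big_selected_recr N : \big[op/idx]_(0 <= i < N.+1 | i \in A) f i =
  op (\big[op/idx]_(0 <= i < N | i \in A) f i) (if N \in A then f N else idx).
Proof. by rewrite big_mkcond big_nat_recr//= -big_mkcond. Qed.

End BigSelected.

(** * Upper estimates; the L^1-null case *)

Section UpperEstimate.
Context d (T : measurableType d) (R : realType) (P : probability T R).
Context (U : set (set nat)).
Implicit Types (f g h : T -> R) (y : nat -> T -> R) (r s t : R) (a : nat -> R) (A : set nat).
Local Notation itg := (itg P).
Local Notation mean := (mean P).
Local Notation mL := (mL P).
Local Notation mom := (mom P).
Local Notation nrm := (nrm P).
Local Notation bdd := (bdd P).
Local Notation nullr := (nullr P U).

(** The upper t-estimate |sum a_n y_n| <= C (sum |a_n|^t)^(1/t) in L^r, along the indices in [A], in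
    normalised form. *)
Definition upper_est r t A y := exists C : R, 0 <= C /\ forall N a,
  \sum_(0 <= n < N | n \in A) `|a n| `^ t <= 1 ->
  nrm r (fun x => \sum_(0 <= n < N | n \in A) a n * y n x) <= C.

Lemma upper_est_sub r t A B y : 0 < t -> B `<=` A -> upper_est r t A y -> upper_est r t B y.
Proof.
move=> t0 BA [C [C0 H]]; exists C; split=> // N a ha.
pose b n := if n \in B then a n else 0.
have E (V : nmodType) (f g : nat -> V) : (forall n, n \in B -> f n = g n) ->
    (forall n, n \notin B -> g n = 0) ->
    \sum_(0 <= n < N | n \in B) f n = \sum_(0 <= n < N | n \in A) g n.
  move=> e1 e2; rewrite [LHS]big_mkcond [RHS]big_mkcond; apply: eq_bigr => n _.
  have [nB|nB] := boolP (n \in B).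
    by rewrite e1// mem_set//; apply: BA; exact: set_mem.
  by rewrite e2//; case: ifP.
have := H N b; rewrite -(E _ (fun n => `|a n| `^ t)); last 2 first.
- by move=> n nB; rewrite /b nB.
- by move=> n /negbTE nB; rewrite /b nB normr0 powR0// gt_eqF.
move=> /(_ ha); rewrite (_ : (fun x => \sum_(0 <= n < N | n \in A) b n * y n x) =
  (fun x => \sum_(0 <= n < N | n \in B) a n * y n x))//.
apply/funext => x; apply/esym/E => n nB; first by rewrite /b nB.
by rewrite /b (negbTE nB) mul0r.
Qed.

Lemma upper_estI r t A y (C : R) : 0 < t -> 0 <= C ->
  (forall N a, (forall n, `|a n| <= 1) ->
    \sum_(0 <= n < N | n \in A) `|a n| `^ t <= 1 ->
    nrm r (fun x => \sum_(0 <= n < N | n \in A) a n * y n x) <= C) -> upper_est r t A y.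
Proof.
move=> t0 C0 H; exists C; split=> // N a ha.
pose b n := if (n < N)%N && (n \in A) then a n else 0.
have bE n : (n < N)%N -> n \in A -> b n = a n by rewrite /b => -> ->.
have b1 n : `|b n| <= 1.
  rewrite /b; case: ifP => [/andP[nN nA]|_]; last by rewrite normr0.
  have : `|a n| `^ t <= 1.
    apply: le_trans ha; rewrite (@big_cat_nat _ _ _ n)//=; last exact: ltnW.
    rewrite -[X in X <= _]add0r; apply: lerD.
      by apply: sumr_ge0 => i _; exact: powR_ge0.
    by rewrite big_ltn_cond// nA lerDl; apply: sumr_ge0 => i _; exact: powR_ge0.
  move=> h; rewrite leNgt; apply/negP => h1.
  have : 1 `^ t < `|a n| `^ t by rewrite gt0_ltr_powR// nnegrE.
  by rewrite powR1 ltNge h.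
have -> : (fun x => \sum_(0 <= n < N | n \in A) a n * y n x) =
    (fun x => \sum_(0 <= n < N | n \in A) b n * y n x).
  apply/funext => x; rewrite big_nat_cond [RHS]big_nat_cond.
  by apply: eq_bigr => n /andP[/andP[_ nN] nA]; rewrite bE.
apply: H => //; apply: le_trans ha; rewrite le_eqVlt; apply/orP; left; apply/eqP.
rewrite big_nat_cond [RHS]big_nat_cond.
by apply: eq_bigr => n /andP[/andP[_ nN] nA]; rewrite bE.
Qed.

Hypothesis UU : is_ultrafilter U.
Hypothesis UN : nonprincipal U.
Hypothesis US : selective U.

Lemma measurable_selected_sum A y a N : (forall n, measurable_fun setT (y n)) ->
  measurable_fun setT (fun x => \sum_(0 <= n < N | n \in A) a n * y n x).
Proof.
move=> my; elim: N => [|N IH].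
  by under eq_fun do rewrite big_nil; exact: measurable_cst.
under eq_fun do rewrite big_selected_recr/=.
by case: (N \in A) => //; apply: measurable_funD => //; exact: measurable_scale.
Qed.

(* By powR_expand the r-th moments of the partial sums are additive up to
   errors that the selection of A makes summable. *)
Lemma upper_est_null1 r y : 1 < r -> bdd r y -> nullr 1 y ->
  (forall n, exists B : R, 0 <= B /\ forall x, `|y n x| <= B) ->
  exists A, U A /\ upper_est r r A y.
Proof.
move=> r1 by' ny /choice[B HB]; have r1' := ltW r1; have r0 : 0 < r by lra.
have r2 : 0 <= r - 1 by lra.
have [Ly _] := by'; have [C [C0 yC]] := bdd_mom r0 by'.
have my n : measurable_fun setT (y n) by case: (Ly n).
have B0 n : 0 <= B n by have [] := HB n.
have yB n x : `|y n x| <= B n by have [_ ] := HB n.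
(* If m precedes n in [A], the partial sum before n is bounded pointwise by [be m], a number that
   does not depend on n. This makes the error at n selectable. *)
pose be m := \sum_(0 <= i < m.+1) B i.
have be0 m : 0 <= be m by apply: sumr_ge0.
pose er m n := 2 `^ r * (be m `^ (r - 1) * nrm 1 (y n) + be m * mom (r - 1) (y n)).
have er0 m : ulim_to U (er m) 0.
  rewrite -(mulr0 (2 `^ r)); apply: (ulim_toZ UU); rewrite -[0](addr0 0); apply: (ulim_toD UU).
    by rewrite -(mulr0 (be m `^ (r - 1))); apply: (ulim_toZ UU).
  by rewrite -(mulr0 (be m)); apply: (ulim_toZ UU); exact: null1_mom.
have [A [UA HA]] : exists A, U A /\ forall m n, A m -> A n -> (m < n)%N -> `|er m n - 0| < 2^-1 ^+ m.
  by apply: (selection UU US) => m; apply: er0; rewrite exprn_gt0// invr_gt0.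
exists A; split=> //.
have CC : 0 <= C + 2 by lra.
(* [C] comes from the moments of the y n, weighted by a sum of |a n|^r that is at most 1; the 2 is
   the total of the selected errors. *)
apply: (@upper_estI _ _ _ _ ((C + 2) `^ r^-1)) => //; first exact: powR_ge0.
move=> N a a1 ha.
pose S n x := \sum_(0 <= i < n | i \in A) a i * y i x.
have mS n : measurable_fun setT (S n) by exact: measurable_selected_sum.
pose sB n := \sum_(0 <= i < n | i \in A) B i.
have SB n x : `|S n x| <= sB n.
  apply: le_trans (ler_norm_sum _ _ _) _; apply: ler_sum => i _; rewrite normrM.
  by rewrite -[X in _ <= X]mul1r; apply: ler_pM.
have sB0 n : 0 <= sB n by apply: sumr_ge0.
have ayB n x : `|a n * y n x| <= B n by rewrite normrM -[X in _ <= X]mul1r; apply: ler_pM.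
have may n : measurable_fun setT (fun x => a n * y n x) by exact: measurable_scale.
pose u n x := `|S n x| `^ (r - 1) * `|a n * y n x|.
pose v n x := `|S n x| * `|a n * y n x| `^ (r - 1).
have u0 n x : 0 <= u n x by rewrite mulr_ge0// powR_ge0.
have v0 n x : 0 <= v n x by rewrite mulr_ge0// powR_ge0.
have mu' n : measurable_fun setT (u n).
  by apply: measurable_funM; [exact: measurable_abs_powR|exact: measurable_abs].
have mv n : measurable_fun setT (v n).
  by apply: measurable_funM; [exact: measurable_abs|exact: measurable_abs_powR].
have powB (z b : R) : `|z| <= b -> `|z| `^ (r - 1) <= b `^ (r - 1).
  by move=> h; rewrite ge0_ler_powR// nnegrE//; exact: le_trans h.
have ub n b x : `|S n x| <= b -> u n x <= b `^ (r - 1) * `|y n x|.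
  move=> h; apply: ler_pM; rewrite ?powR_ge0//; first exact: powB.
  by rewrite normrM -[X in _ <= X]mul1r ler_wpM2r.
have vb n b x : `|S n x| <= b -> v n x <= b * `|y n x| `^ (r - 1).
  move=> h; apply: ler_pM; rewrite ?powR_ge0// ge0_ler_powR ?nnegrE//.
  by rewrite normrM -[X in _ <= X]mul1r ler_wpM2r.
have i1 n : itg (fun x => `|y n x|) by apply/itg_norm/(mL_itg r1').
have i2 n : itg (fun x => `|y n x| `^ (r - 1)).
  apply: (@itg_bounded _ _ _ _ _ (B n `^ (r - 1))); first exact: measurable_abs_powR.
  by move=> x; rewrite ger0_norm ?powR_ge0//; exact: powB.
have iu n : itg (u n).
  apply: itg_dom (itgZ (sB n `^ (r - 1)) (i1 n)) => // x; rewrite ger0_norm//.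
  exact: ub.
have iv n : itg (v n).
  apply: itg_dom (itgZ (sB n) (i2 n)) => // x; rewrite ger0_norm//; exact: vb.
pose e n := 2 `^ r * (mean (u n) + mean (v n)).
have step n : mom r (S n) <= \sum_(0 <= i < n | i \in A) (`|a i| `^ r * C + e i).
  elim: n => [|n IH].
    rewrite big_nil momE; have -> : (fun x => `|S 0%N x| `^ r) = (fun=> 0).
      by apply/funext => x; rewrite /S big_nil normr0 powR0// gt_eqF.
    by rewrite mean_cst.
  rewrite big_selected_recr /=; case: (boolP (n \in A)) => nA; last first.
    rewrite addr0 (_ : S n.+1 = S n)//; apply/funext => x.
    by rewrite /S big_selected_recr/= (negbTE nA) addr0.
  have SE : S n.+1 = (fun x => S n x + a n * y n x).
    by apply/funext => x; rewrite /S big_selected_recr/= nA.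
  have LS : itg (fun x => `|S n x| `^ r).
    by have [] := mL_bounded P (ltW r0) (mS n) (SB n).
  have Lay : itg (fun x => `|a n * y n x| `^ r).
    by have [] := mL_bounded P (ltW r0) (may n) (ayB n).
  have iuv : itg (fun x => 2 `^ r * (u n x + v n x)) by apply: itgZ; exact: itgD.
  have h x : 0 <= `|S n x + a n * y n x| `^ r <=
      (`|S n x| `^ r + `|a n * y n x| `^ r) + 2 `^ r * (u n x + v n x).
    by rewrite powR_ge0 powR_expand.
  have mm : measurable_fun setT (fun x => `|S n x + a n * y n x| `^ r).
    by apply: measurable_abs_powR; exact: measurable_funD.
  have [_] := mean_le_dom mm h (itgD (itgD LS Lay) iuv).
  rewrite -(momE P r (fun x => S n x + a n * y n x)) -SE => hm; apply: le_trans hm _.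
  rewrite meanD//; last exact: itgD.
  rewrite meanD// meanZ; last exact: itgD.
  rewrite meanD// -(momE P r (S n)) -(momE P r (fun x => a n * y n x)) momZ//.
  rewrite addrA; apply: lerD => //; apply: lerD => //.
  by apply: ler_wpM2l; rewrite ?powR_ge0.
have se : \sum_(0 <= i < N | i \in A) e i <= 0 + 1 * 2.
  apply: selected_sum => //.
    move=> m n Am An mn pm; rewrite mul1r.
    have Sb x : `|S n x| <= be m.
      apply: le_trans (SB n x) _; rewrite /sB (big_selected_pred _ _ mn pm) /be.
      by rewrite big_mkcond; apply: ler_sum => i _; case: ifP.
    apply: le_trans (_ : er m n <= _); last first.
      by apply: ltW; apply: le_lt_trans (HA m n Am An mn); rewrite subr0 ler_norm.
    rewrite /e /er; apply: ler_wpM2l; rewrite ?powR_ge0//; apply: lerD.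
      rewrite nrm1E -meanZ//; apply: le_mean => //; first exact: itgZ.
      by move=> x; exact: ub.
    rewrite momE -meanZ//; apply: le_mean => //; first exact: itgZ.
    by move=> x; exact: vb.
  move=> n An H; have S0 x : S n x = 0 by rewrite /S big_selected_first.
  have -> : e n = 0; last by [].
  rewrite /e; have -> : u n = (fun=> 0).
    by apply/funext => x; rewrite /u S0 normr0 powR0 ?mul0r// gt_eqF// subr_gt0.
  have -> : v n = (fun=> 0) by apply/funext => x; rewrite /v S0 normr0 mul0r.
  by rewrite mean_cst addr0 mulr0.
apply: nrm_le_mom => //; first exact: powR_ge0.
rewrite -powRrM mulVf ?gt_eqF// powRr1//.
apply: le_trans (step N) _; rewrite big_split/= -mulr_suml; apply: lerD.
  by rewrite -[X in _ <= X]mul1r ler_wpM2r.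
by rewrite add0r mul1r in se.
Qed.

End UpperEstimate.

(** * Riesz products; the uniformly bounded weakly null case *)

Section RieszProduct.
Context d (T : measurableType d) (R : realType) (P : probability T R).
Context (U : set (set nat)).
Hypothesis UU : is_ultrafilter U.
Hypothesis US : selective U.
Implicit Types (f g h z : T -> R) (y : nat -> T -> R) (r s t : R) (a : nat -> R) (A : set nat).
Local Notation itg := (itg P).
Local Notation mean := (mean P).
Local Notation mL := (mL P).
Local Notation mom := (mom P).
Local Notation nrm := (nrm P).
Local Notation upper_est := (upper_est P).

Definition mbd f := measurable_fun setT f /\ exists K : R, forall x, `|f x| <= K.

Lemma mbd_cst c : mbd (fun=> c).
Proof. by split=> //; exists `|c|. Qed.

Lemma mbdM f g : mbd f -> mbd g -> mbd (fun x => f x * g x).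
Proof.
move=> [mf [K fK]] [mg [L gL]]; split; first exact: measurable_funM.
by exists (K * L) => x; rewrite normrM; exact: ler_pM.
Qed.

Lemma mbdD f g : mbd f -> mbd g -> mbd (fun x => f x + g x).
Proof.
move=> [mf [K fK]] [mg [L gL]]; split; first exact: measurable_funD.
by exists (K + L) => x; apply: le_trans (ler_normD _ _) _; exact: lerD.
Qed.

Lemma mbd_itg f : mbd f -> itg f.
Proof. by move=> [mf [K fK]]; exact: itg_bounded fK. Qed.

(* The sum of |mean (w * z)| over all words w in y 0, ..., y (k - 1). *)
Fixpoint word_sum y k z : R :=
  if k is k'.+1 then word_sum y k' z + word_sum y k' (fun x => y k' x * z x)
  else `|mean z|.

Lemma word_sum_ge0 y k z : 0 <= word_sum y k z.
Proof. by elim: k z => [|k IH] z //=; rewrite addr_ge0. Qed.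

(** All words multiply the same last factor y n, and the rest of each word is a fixed bounded
    function, against which [y] is null. *)
Lemma word_sum_null y k g : (forall n, mbd (y n)) ->
  (forall g, mbd g -> ulim_to U (fun n => mean (fun x => g x * y n x)) 0) -> mbd g ->
  ulim_to U (fun n => word_sum y k (fun x => g x * y n x)) 0.
Proof.
move=> my wy; elim: k g => [|k IH] g mg /=.
  by have := ulim_to_abs UU (wy g mg); rewrite normr0.
rewrite -[0](addr0 0); apply: (ulim_toD UU); first exact: IH.
have -> : (fun n => word_sum y k (fun x => y k x * (g x * y n x))) =
    (fun n => word_sum y k (fun x => (y k x * g x) * y n x)).
  by apply/funext => n; congr word_sum; apply/funext => x; rewrite mulrA.
by apply: IH; exact: mbdM.
Qed.

Definition riesz_prod A y a N (x : T) : R :=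
  \prod_(0 <= n < N | n \in A) (1 + a n * y n x).

Lemma mbd_riesz_prod A y a N : (forall n, mbd (y n)) -> mbd (riesz_prod A y a N).
Proof.
move=> my; elim: N => [|N IH].
  rewrite (_ : riesz_prod _ _ _ _ = fun=> 1); first exact: mbd_cst.
  by apply/funext => x; rewrite /riesz_prod big_nil.
rewrite (_ : riesz_prod _ _ _ _ = fun x => riesz_prod A y a N x * (if N \in A then 1 + a N * y N x else 1)).
  apply: mbdM => //; case: (N \in A); last exact: mbd_cst.
  apply: mbdD; first exact: mbd_cst.
  by apply: mbdM => //; exact: mbd_cst.
by apply/funext => x; rewrite /riesz_prod big_selected_recr.
Qed.

(** Expanding the product gives words with coefficients of modulus at most 1. The right-hand side is
    free of [a], so one selection serves all coefficient sequences. *)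
Lemma riesz_prod_word_sum A y a N z : (forall n, mbd (y n)) -> (forall n, `|a n| <= 1) ->
  mbd z -> `|mean (fun x => riesz_prod A y a N x * z x)| <= word_sum y N z.
Proof.
move=> my a1; elim: N z => [|N IH] z mz /=.
  rewrite (_ : (fun x => _) = z)//.
  by apply/funext => x; rewrite /riesz_prod big_nil mul1r.
have mp := mbd_riesz_prod A a N my.
case: (boolP (N \in A)) => NA; last first.
  rewrite (_ : riesz_prod A y a N.+1 = riesz_prod A y a N).
    by apply: le_trans (IH z mz) _; rewrite lerDl word_sum_ge0.
  by apply/funext => x; rewrite /riesz_prod big_selected_recr/= (negbTE NA) mulr1.
have -> : (fun x => riesz_prod A y a N.+1 x * z x) = (fun x => riesz_prod A y a N x * z x
    + a N * (riesz_prod A y a N x * (y N x * z x))).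
  by apply/funext => x; rewrite /riesz_prod big_selected_recr/= NA; ring.
have i1 := mbd_itg (mbdM mp mz); have i2 := mbd_itg (mbdM mp (mbdM (my N) mz)).
rewrite meanD//; last exact: itgZ.
rewrite meanZ//; apply: le_trans (ler_normD _ _) _; apply: lerD; first exact: IH.
rewrite normrM -[X in _ <= X]mul1r; apply: ler_pM => //.
by apply: IH; exact: mbdM.
Qed.

(** The bound 1/2 puts each factor in the range of [expR_riesz] and makes it nonnegative, so the
    inequalities may be multiplied. *)
Lemma expR_riesz_prod A y a N x : (forall n, `|a n * y n x| <= 2^-1) ->
  0 <= riesz_prod A y a N x /\
  expR (\sum_(0 <= n < N | n \in A) a n * y n x) <=
  riesz_prod A y a N x * expR (2 * \sum_(0 <= n < N | n \in A) (a n * y n x) ^+ 2).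
Proof.
move=> h; elim: N => [|N [p0 IH]].
  by rewrite /riesz_prod !big_nil mulr0 expR0 mulr1.
rewrite /riesz_prod !big_selected_recr/= -/(riesz_prod A y a N x).
case: (N \in A); last by rewrite !addr0 !mulr1.
have hN : - 2^-1 <= a N * y N x by have := h N; rewrite ler_norml => /andP[].
have q0 : 0 <= 1 + a N * y N x by move: hN; move: (a N * y N x) => w; lra.
split; first exact: mulr_ge0.
rewrite [2 * (_ + _)]mulrDr !expRD [X in _ <= X]mulrACA; apply: ler_pM => //; rewrite ?expR_ge0//.
exact: expR_riesz.
Qed.

(* Riesz products bound the exponential moments of the sums, hence all their moments. *)
Lemma upper_est_ubd y : ubd y ->
  (forall g K, measurable_fun setT g -> (forall x, `|g x| <= K) ->
     ulim_to U (fun n => pr P (y n) g) 0) ->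
  exists A, U A /\ forall r, 1 <= r -> upper_est r 2 A y.
Proof.
move=> [mmy [K [K0 yK]]] wy.
have my n : mbd (y n) by split=> //; exists K.
have wy' g : mbd g -> ulim_to U (fun n => mean (fun x => g x * y n x)) 0.
  move=> [mg [L gL]]; apply: (ulim_to_eq UU) (wy g L mg gL).
  by apply: (ultraW UU) => n /=; rewrite prC.
have W0 k : ulim_to U (fun n => word_sum y k (y n)) 0.
  have := word_sum_null k my wy' (mbd_cst 1).
  by under eq_fun do under eq_fun do rewrite mul1r.
have [A [UA HA]] : exists A, U A /\ forall m n, A m -> A n -> (m < n)%N ->
    `|word_sum y m.+1 (y n) - 0| < 2^-1 ^+ m.
  by apply: (selection UU US) => m; apply: W0; rewrite exprn_gt0// invr_gt0.
exists A; split=> // r r1; have r0 : 0 < r by lra.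
(* With this scale l |a n| |y n| <= 1/2, as [expR_riesz_prod] requires. *)
pose l : R := (2 * (K + 1))^-1.
have K1 : 0 < 2 * (K + 1) by lra.
have l0 : 0 < l by rewrite invr_gt0.
have lK : l * K <= 2^-1.
  rewrite /l mulrC ler_pdivrMr// mulrA mulVf// mul1r; lra.
have l1 : l <= 1 by rewrite /l invf_le1//; lra.
(* The mean of the Riesz product is at most 1 (empty product) plus K (first selected factor) plus 2
   (geometric errors). The exponential bounds the quadratic correction, as the squares sum to at
   most 1. *)
pose M := (1 + (K + 1 * 2)) * expR 2.
have M0 : 0 <= M by rewrite mulr_ge0 ?expR_ge0//; lra.
have main N a : (forall n, `|a n| <= 1) ->
    \sum_(0 <= n < N | n \in A) `|a n| `^ 2 <= 1 ->
    let S x := \sum_(0 <= n < N | n \in A) a n * y n x in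
    itg (fun x => expR (l * S x)) /\ mean (fun x => expR (l * S x)) <= M.
  move=> a1 ha S; pose b n := l * a n.
  have b1 n : `|b n| <= 1.
    by rewrite normrM -[1]mul1r; apply: ler_pM => //; rewrite ger0_norm// ltW.
  have byx n x : `|b n * y n x| <= 2^-1.
    rewrite /b -mulrA normrM (ger0_norm (ltW l0)); apply: le_trans lK.
    apply: ler_wpM2l; first exact: ltW.
    by rewrite normrM -[K]mul1r; exact: ler_pM.
  have SE x : l * S x = \sum_(0 <= n < N | n \in A) b n * y n x.
    by rewrite mulr_sumr; apply: eq_bigr => n _; rewrite /b mulrA.
  have mp N' := mbd_riesz_prod A b N' my.
  have mean_prod : mean (riesz_prod A y b N) <= 1 + (K + 1 * 2).
    pose e n := `|mean (fun x => riesz_prod A y b n x * y n x)|.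
    have s1 : \sum_(0 <= n < N | n \in A) e n <= K + 1 * 2.
      apply: selected_sum => //.
        move=> m n Am An mn pm; rewrite mul1r; apply: le_trans (_ : word_sum y m.+1 (y n) <= _); last first.
          by apply: ltW; apply: le_lt_trans (HA m n Am An mn); rewrite subr0 ler_norm.
        rewrite /e (_ : riesz_prod A y b n = riesz_prod A y b m.+1).
          exact: riesz_prod_word_sum.
        by apply/funext => x; exact: big_selected_pred.
      move=> n An H; rewrite /e; apply: mean_bounded.
        by apply: measurable_funM => //; case: (mp n).
      by move=> x; rewrite /riesz_prod big_selected_first// mul1r.
    suff h n : mean (riesz_prod A y b n) <= 1 + \sum_(0 <= i < n | i \in A) e i.
      by apply: le_trans (h N) _; rewrite lerD2l.
    elim: n => [|n IH].
      rewrite big_nil addr0 (_ : riesz_prod _ _ _ _ = fun=> 1) ?mean_cst//.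
      by apply/funext => x; rewrite /riesz_prod big_nil.
    rewrite big_selected_recr/=; case: (boolP (n \in A)) => nA; last first.
      rewrite addr0 (_ : riesz_prod A y b n.+1 = riesz_prod A y b n)//.
      by apply/funext => x; rewrite /riesz_prod big_selected_recr/= (negbTE nA) mulr1.
    have -> : riesz_prod A y b n.+1 = (fun x => riesz_prod A y b n x + b n * (riesz_prod A y b n x * y n x)).
      by apply/funext => x; rewrite /riesz_prod big_selected_recr/= nA; ring.
    have i1 := mbd_itg (mbdM (mp n) (my n)).
    rewrite meanD; [|exact: mbd_itg|exact: itgZ].
    rewrite meanZ// addrA; apply: lerD => //; apply: le_trans (ler_norm _) _.
    by rewrite normrM -[X in _ <= X]mul1r; exact: ler_pM.
  have sq x : \sum_(0 <= n < N | n \in A) (b n * y n x) ^+ 2 <= 1.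
    apply: le_trans ha; apply: ler_sum => n _.
    have hb : `|b n * y n x| <= `|a n|.
      rewrite (_ : b n * y n x = a n * (l * y n x)); last by rewrite /b; ring.
      rewrite normrM ler_piMr// normrM (ger0_norm (ltW l0)).
      apply: (@le_trans _ _ (l * K)); first by rewrite ler_wpM2l// ltW.
      by apply: le_trans lK _; lra.
    by rewrite powR_mulrn// -real_normK ?num_real// lerXn2r// nnegrE.
  have bd x : 0 <= expR (l * S x) <= expR 2 * riesz_prod A y b N x.
    rewrite expR_ge0/= SE mulrC; have [p0 h] := expR_riesz_prod A N (byx^~ x).
    apply: le_trans h _; rewrite ler_wpM2l// ler_expR -[X in _ <= X]mulr1 ler_wpM2l//.
  have mS : measurable_fun setT (fun x => expR (l * S x)).
    by apply: (measurableT_comp (@measurable_expR R)); apply: measurable_scale; exact: measurable_selected_sum.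
  have iP := mbd_itg (mp N).
  have [i h] := mean_le_dom mS bd (itgZ (expR 2) iP); split=> //.
  by apply: le_trans h _; rewrite meanZ// mulrC /M ler_wpM2r// expR_ge0.
pose Q := (r / l) `^ r * (M + M).
have Q0 : 0 <= Q by rewrite mulr_ge0 ?powR_ge0 ?addr_ge0.
apply: (@upper_estI _ _ _ _ _ _ _ _ (Q `^ r^-1)) => //; first exact: powR_ge0.
move=> N a a1 ha; pose S x := \sum_(0 <= n < N | n \in A) a n * y n x.
have [i1 h1] := main N a a1 ha.
(* The same [A] serves the coefficients -a; the two exponentials together dominate every power of
   |S|. *)
have [||i2 h2] := main N (fun n => - a n).
- by move=> n; rewrite normrN.
- by under eq_bigr do rewrite normrN.
have NE x : \sum_(0 <= n < N | n \in A) - a n * y n x = - S x.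
  by rewrite -sumrN; apply: eq_bigr => n _; rewrite mulNr.
have NE' : (fun x => expR (l * (\sum_(0 <= n < N | n \in A) - a n * y n x))) = (fun x => expR (l * - S x)).
  by apply/funext => x; rewrite NE.
rewrite NE' in i2 h2.
apply: nrm_le_mom => //; first exact: powR_ge0.
rewrite -powRrM mulVf ?gt_eqF// powRr1// -/S.
have mS : measurable_fun setT S by exact: measurable_selected_sum.
have bd x : 0 <= `|S x| `^ r <= (r / l) `^ r * (expR (l * S x) + expR (l * - S x)).
  rewrite powR_ge0/=; apply: le_trans (powR_le_expR r0 l0 (normr_ge0 _)) _.
  rewrite ler_wpM2l ?powR_ge0//; case: (ger0P (S x)) => _.
    by rewrite lerDl expR_ge0.
  by rewrite lerDr expR_ge0.
have [_ h] := mean_le_dom (measurable_abs_powR r mS) bd (itgZ _ (itgD i1 i2)).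
rewrite momE; apply: le_trans h _; rewrite meanZ; last exact: itgD.
by rewrite meanD// ler_wpM2l ?powR_ge0//; exact: lerD.
Qed.

End RieszProduct.

(** If the sum S exceeded 1, the extremal sequence of Hoelder's inequality, [dualf s' c] divided by
    S^(1/s), would have norm 1 and pair with [c] to S^(1/s') > 1. *)
Lemma finite_dual (R : realType) (s s' : R) (A : set nat) (N : nat) (c : nat -> R) :
  conjg s s' ->
  (forall a : nat -> R, \sum_(0 <= n < N | n \in A) `|a n| `^ s <= 1 ->
     `|\sum_(0 <= n < N | n \in A) a n * c n| <= 1) ->
  \sum_(0 <= n < N | n \in A) `|c n| `^ s' <= 1.
Proof.
move=> cj H; set S := (X in X <= 1); have [s1 s1' ss] := cj.
have s0 : 0 < s by lra. have s0' : 0 < s' by lra.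
rewrite leNgt; apply/negP => S1; have S0 : 0 < S by apply: lt_trans S1.
pose b n := dualf s' c n / S `^ s^-1.
have Ss : 0 < S `^ s^-1 by rewrite powR_gt0.
have := H b; have -> : \sum_(0 <= n < N | n \in A) `|b n| `^ s = 1.
  rewrite -(@mulfV _ S) ?gt_eqF// mulr_suml; apply: eq_bigr => n _.
  rewrite /b normrM powRM// (dualf_powR _ _ (conjg_sym cj)) normfV (ger0_norm (ltW Ss)).
  by rewrite -powRN -powRrM mulNr mulVf ?gt_eqF// powR_inv1// ltW.
move=> /(_ (lexx _)).
have -> : \sum_(0 <= n < N | n \in A) b n * c n = S `^ s'^-1.
  rewrite (eq_bigr (fun n => `|c n| `^ s' / S `^ s^-1)); last first.
    by move=> n _; rewrite /b mulrAC [dualf _ _ _ * _]mulrC dualf_mul.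
  rewrite -mulr_suml -/S -{1}[S]powRr1 ?(ltW S0)// -{1}ss addrC powRD.
    by rewrite mulfK// gt_eqF.
  by rewrite (gt_eqF S0) implybT.
rewrite ger0_norm ?powR_ge0// leNgt => /negP; apply.
have -> : 1 = 1 `^ s'^-1 :> R by rewrite powR1.
by rewrite gt0_ltr_powR ?invr_gt0// nnegrE// ltW.
Qed.

(** * Diagonal operators built from a sequence of functionals and a sequence of targets *)

Section DiagonalOperator.
Context d (T : measurableType d) (R : realType) (P : probability T R).
Context (U : set (set nat)).
Hypothesis UU : is_ultrafilter U.
Implicit Types (f g h : T -> R) (y phi : nat -> T -> R) (p q r s t : R) (a : nat -> R) (A : set nat).
Local Notation mL := (mL P).
Local Notation nrm := (nrm P).
Local Notation pr := (pr P).
Local Notation bdd := (bdd P).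
Local Notation wnull := (wnull P U).
Local Notation wlim_to := (wlim_to P U).
Local Notation upper_est := (upper_est P).

(** Linearity is required only after pairing with L^q, because the values of [S] are functions
    picked as weak limits, which are determined only almost everywhere. *)
Definition lin_op p q (S : (T -> R) -> T -> R) :=
  [/\ forall f, mL p f -> mL p (S f),
      exists C : R, 0 <= C /\ forall f, mL p f -> nrm p (S f) <= C * nrm p f &
      forall (a : R) f g h, mL p f -> mL p g -> mL q h ->
        pr (S (fun x => a * f x + g x)) h = a * pr (S f) h + pr (S g) h].

Lemma powR_le1_exp s t (u : R) : 0 < s -> s <= t -> 0 <= u -> u `^ s <= 1 -> u `^ t <= u `^ s.
Proof.
move=> s0 st u0 us; have t0 : 0 < t by lra.
have [->|un0] := eqVneq u 0; first by rewrite !powR0// gt_eqF.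
have up : 0 < u by rewrite lt_neqAle eq_sym un0.
apply: ger_powR st; rewrite up/= leNgt; apply/negP => u1.
have : 1 `^ s < u `^ s by rewrite gt0_ltr_powR// nnegrE.
by rewrite powR1 ltNge us.
Qed.

Lemma powR_sum_le1 s t A N (c : nat -> R) : 0 < s -> s <= t ->
  \sum_(0 <= n < N | n \in A) `|c n| `^ s <= 1 ->
  \sum_(0 <= n < N | n \in A) `|c n| `^ t <= 1.
Proof.
move=> s0 st; elim: N => [|N IH]; first by rewrite !big_nil.
suff H : \sum_(0 <= n < N.+1 | n \in A) `|c n| `^ s <= 1 ->
    \sum_(0 <= n < N.+1 | n \in A) `|c n| `^ t <= \sum_(0 <= n < N.+1 | n \in A) `|c n| `^ s.
  by move=> h; apply: le_trans (H h) h.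
move=> h; rewrite big_nat_cond [X in _ <= X]big_nat_cond.
apply: ler_sum => n /andP[/andP[_ nN] nA]; apply: powR_le1_exp => //.
apply: le_trans h; rewrite (@big_cat_nat _ _ _ n)//=; last exact: ltnW.
rewrite -[X in X <= _]add0r; apply: lerD.
  by apply: sumr_ge0 => i _; exact: powR_ge0.
by rewrite big_ltn_cond// nA lerDl; apply: sumr_ge0 => i _; exact: powR_ge0.
Qed.

Lemma mL_selected_sum r A y a N : 1 <= r -> (forall n, mL r (y n)) ->
  mL r (fun x => \sum_(0 <= n < N | n \in A) a n * y n x).
Proof. by move=> r1 Ly; apply: mL_sum => // n _; exact: mLZ. Qed.

(** By duality, the upper s-estimate of [phi] puts the coefficients <phi n, f> in l^s' with norm at
    most a multiple of |f|. Since s' <= t, that is 1/s + 1/t <= 1, they lie in l^t, where the upper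
    t-estimate of [y] applies. *)
Lemma diag_bound p q s s' t A phi y : conjg p q -> conjg s s' -> s' <= t ->
  (forall n, mL q (phi n)) -> (forall n, mL p (y n)) ->
  upper_est q s A phi -> upper_est p t A y ->
  exists C : R, 0 <= C /\ forall N f, mL p f ->
    nrm p (fun x => \sum_(0 <= n < N | n \in A) pr (phi n) f * y n x) <= C * nrm p f.
Proof.
move=> pq ss st Lp Ly [C1 [C10 H1]] [C2 [C20 H2]].
have [p1 q1 _] := pq; have [s1 s1' _] := ss; have p0 : 0 < p by lra.
have [p1' q1'] := (ltW p1, ltW q1); have s0' : 0 < s' by lra.
exists ((C1 + 1) * C2); split=> [|N f Lf].
  by rewrite mulr_ge0//; lra.
have C11 : 0 < C1 + 1 by lra.
have [f0|f0] := eqVneq (nrm p f) 0.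
  have -> : (fun x => \sum_(0 <= n < N | n \in A) pr (phi n) f * y n x) = (fun=> 0).
    apply/funext => x; rewrite big1// => n _.
    have := pr_bound (conjg_sym pq) (Lp n) Lf; rewrite f0 mulr0 normr_le0 => /eqP ->.
    by rewrite mul0r.
  by rewrite nrm0// mulr_ge0 ?nrm_ge0// mulr_ge0// ltW.
have fp : 0 < nrm p f by rewrite lt_neqAle eq_sym f0 nrm_ge0.
(* The added 1 keeps the scale positive when C1 = 0. *)
pose k := (C1 + 1) * nrm p f; have k0 : 0 < k by rewrite mulr_gt0.
pose c n := pr (phi n) f / k.
have cs : \sum_(0 <= n < N | n \in A) `|c n| `^ s' <= 1.
  apply: (finite_dual ss) => b hb.
  have -> : \sum_(0 <= n < N | n \in A) b n * c n =
      pr (fun x => \sum_(0 <= n < N | n \in A) b n * phi n x) f / k.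
    rewrite (pr_suml _ (conjg_sym pq))//; last by move=> n _; exact: mLZ.
    rewrite mulr_suml; apply: eq_bigr => n _.
    by rewrite (prZl _ (conjg_sym pq))// mulrA.
  rewrite normrM normfV (ger0_norm (ltW k0)) ler_pdivrMr// mul1r.
  apply: le_trans (pr_bound (conjg_sym pq) (mL_selected_sum A b N q1' Lp) Lf) _.
  rewrite /k; apply: ler_wpM2r; first exact: nrm_ge0.
  by apply: le_trans (H1 N b hb) _; rewrite lerDl.
have := H2 N c (powR_sum_le1 s0' st cs) => hy.
have -> : (fun x => \sum_(0 <= n < N | n \in A) pr (phi n) f * y n x) =
    (fun x => k * \sum_(0 <= n < N | n \in A) c n * y n x).
  apply/funext => x; rewrite mulr_sumr; apply: eq_bigr => n _.
  by rewrite /c mulrA [k * _]mulrC divfK// gt_eqF.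
rewrite nrmZ//; last exact: mL_selected_sum.
rewrite (ger0_norm (ltW k0)) -[X in _ <= X]mulrA [C2 * _]mulrC [X in _ <= X]mulrA.
exact: (ler_wpM2l (ltW k0) hy).
Qed.

(** S f is the weak limit along [U] of the uniformly bounded partial sums, so no convergence of the
    series in norm has to be shown. *)
Lemma diag_op p q s s' t A phi y : conjg p q -> conjg s s' -> s' <= t ->
  (forall n, mL q (phi n)) -> (forall n, mL p (y n)) ->
  upper_est q s A phi -> upper_est p t A y ->
  exists S, lin_op p q S /\ forall f h, mL p f -> mL q h ->
    ulim_to U (fun N => \sum_(0 <= n < N | n \in A) pr (phi n) f * pr (y n) h) (pr (S f) h).
Proof.
move=> pq ss st Lp Ly e1 e2; have [C [C0 HC]] := diag_bound pq ss st Lp Ly e1 e2.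
have [p1 q1 _] := pq; have [p1' q1'] := (ltW p1, ltW q1).
pose D f N x := \sum_(0 <= n < N | n \in A) pr (phi n) f * y n x.
have LD f N : mL p (D f N) by exact: mL_selected_sum.
have bD f : mL p f -> bdd p (D f).
  move=> Lf; split=> //; exists (C * nrm p f); split=> [|N]; last exact: HC.
  by rewrite mulr_ge0// nrm_ge0.
have /choice[S HS] : forall f, exists g, mL p f -> wlim_to p q (D f) g.
  move=> f; have [Lf|nL] := pselect (mL p f); last by exists (fun=> 0).
  by have [g Hg] := wlim_ex UU pq (bD f Lf); exists g.
have lim f h : mL p f -> mL q h ->
    ulim_to U (fun N => \sum_(0 <= n < N | n \in A) pr (phi n) f * pr (y n) h) (pr (S f) h).
  move=> Lf Lh; have [_ H] := HS f Lf; apply: (ulim_to_eq UU) (H h Lh).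
  apply: (ultraW UU) => N /=; rewrite (pr_suml _ pq)//; last by move=> n _; exact: mLZ.
  by apply: eq_bigr => n _; rewrite (prZl _ pq).
exists S; split=> //; split.
- by move=> f Lf; have [] := HS f Lf.
- exists C; split=> // f Lf; apply: (wlim_norm UU pq (LD f)) (HS f Lf).
    by rewrite mulr_ge0// nrm_ge0.
  by apply: (ultraW UU) => N /=; exact: HC.
move=> a f g h Lf Lg Lh; have Laf : mL p (fun x => a * f x) by exact: mLZ.
apply: (ulim_to_unique UU (lim _ h (mLD p1' Laf Lg) Lh)).
apply: (ulim_to_eq UU) (ulim_toD UU (ulim_toZ UU a (lim f h Lf Lh)) (lim g h Lg Lh)).
apply: (ultraW UU) => N /=; rewrite mulr_sumr -big_split/=; apply: eq_bigr => n _.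
by rewrite (prDr (conjg_sym pq))// (prZr _ (conjg_sym pq))// mulrDl mulrA.
Qed.

Lemma adjoint p q S h : conjg p q -> lin_op p q S -> mL q h ->
  exists g, mL q g /\ forall f, mL p f -> pr (S f) h = pr f g.
Proof.
move=> pq [LS [C [C0 HC]] lS] Lh.
have Ch : 0 <= C * nrm q h by rewrite mulr_ge0// nrm_ge0.
have [] := @riesz_representation _ _ _ P p q (C * nrm q h) (fun f => pr (S f) h) pq Ch.
- by move=> a f g Lf Lg; exact: lS.
- move=> f Lf; apply: le_trans (pr_bound pq (LS f Lf) Lh) _.
  by rewrite mulrAC; apply: ler_wpM2r; rewrite ?nrm_ge0// HC.
by move=> g [Lg H]; exists g.
Qed.

End DiagonalOperator.

Lemma big_selected_D1 (V : nmodType) (A : set nat) (f : nat -> V) m N : (m < N)%N -> A m ->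
  \sum_(0 <= n < N | n \in A) f n =
  f m + \sum_(0 <= n < N | (n \in A) && (n != m)) f n.
Proof.
move=> mN Am; rewrite big_mkcond (bigD1_seq m)/= ?iota_uniq ?mem_index_iota//.
rewrite mem_set//; congr (_ + _); rewrite big_mkcond [RHS]big_mkcond.
by apply: eq_bigr => n _; case: (n \in A); case: (n != m).
Qed.

(** * Selecting away the off-diagonal terms *)

Section Cross.
Context (R : realType) (U : set (set nat)).
Hypothesis UU : is_ultrafilter U.
Hypothesis US : selective U.

(** The bound has to hold for every m in [A] at once, so the matrix must be small on both sides of
    the diagonal: for n < m because m is selected after n, for n > m because n is selected after
    m. *)
Lemma cross_select (w : nat -> R) (a : nat -> nat -> R) (e : R) : 0 < e ->
  (forall n, 0 <= w n) -> (forall n m, 0 <= a n m) ->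
  ulim_to U w 0 -> (forall n, ulim_to U (a n) 0) -> (forall m, ulim_to U (a^~ m) 0) ->
  exists A, U A /\ forall B m N, B `<=` A -> A m ->
    \sum_(0 <= n < N | (n \in B) && (n != m)) (w n + a n m) <= e.
Proof.
move=> e0 w0 a0 hw ha ha'.
(* The three sums below contribute 3c, 2c and 2c, which is less than 8c. *)
pose c := e / 8; have c0 : 0 < c by rewrite divr_gt0.
have h0 k : 0 < 2^-1 ^+ k :> R by rewrite exprn_gt0// invr_gt0.
have ck k : 0 < c * 2^-1 ^+ k by rewrite mulr_gt0.
pose X k := [set n | w n <= c * 2^-1 ^+ k] `&` ([set n | a k n <= c * 2^-1 ^+ k] `&`
  [set n | forall m, (m < k.+1)%N -> a n m <= c * 2^-1 ^+ k]).
have lim0 x l : ulim_to U x 0 -> 0 < l -> U [set n | x n <= l].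
  move=> hx l0; apply: (ultraS UU) (hx _ l0) => n /=; rewrite subr0 => h.
  by apply: ltW; apply: le_lt_trans h; exact: ler_norm.
have UX k : U (X k).
  apply: (ultraI UU); first exact: lim0.
  apply: (ultraI UU); first exact: lim0.
  by apply: (ultra_bigI UU (A := fun m => [set n | a n m <= c * 2^-1 ^+ k])) => m _; exact: lim0.
have [A [UA HA]] := selection UU US UX.
pose A' := A `&` [set n | w n <= c].
have UA' : U A' by apply: (ultraI UU) => //; exact: lim0.
exists A'; split=> // B m N BA Am.
(* [e1] is the part n > m, charged to the predecessor k >= m of n in [A]; [e2] is the part n < m,
   where a n m <= c 2^-n directly. *)
pose e1 n := if (n <= m)%N then 0 else a n m.
pose e2 n := if (n < m)%N then a n m else 0.
have s1 : \sum_(0 <= n < N | n \in A') w n <= c + c * 2.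
  apply: selected_sum => //; rewrite ?(ltW c0)//.
    by move=> k n [Ak _] [An _] kn _; have [] := HA k n Ak An kn.
  by move=> n [].
have s2 : \sum_(0 <= n < N | n \in A') e1 n <= 0 + c * 2.
  apply: selected_sum => //; rewrite ?(ltW c0)//.
    move=> k n Ak An kn pk; rewrite /e1; case: leqP => nm; first exact/ltW/ck.
    have mk : (m <= k)%N.
      by rewrite leqNgt; apply/negP => km; apply: (pk m) Am; rewrite km nm.
    by have [_ [_]] := HA k n Ak.1 An.1 kn; exact.
  move=> n An H; rewrite /e1; case: leqP => // mn; by case: (H m mn).
have s3 : \sum_(0 <= n < N | n \in A') e2 n <= c * 2.
  apply: (@le_trans _ _ (\sum_(0 <= n < N) c * 2^-1 ^+ n)).
    rewrite big_mkcond; apply: ler_sum => n _; case: ifP => [/set_mem An|_]; last exact/ltW/ck.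
    rewrite /e2; case: ifP => nm; last exact/ltW/ck.
    by have [_ []] := HA n m An.1 Am.1 nm.
  by rewrite -mulr_sumr; apply: ler_wpM2l; [exact: ltW|exact: sum_half_le2].
apply: (@le_trans _ _ (\sum_(0 <= n < N | n \in A') (w n + (e1 n + e2 n)))).
  rewrite big_mkcond [X in _ <= X]big_mkcond; apply: ler_sum => n _.
  have r0 : 0 <= w n + (e1 n + e2 n).
    by rewrite !addr_ge0//; rewrite /e1 /e2; case: ifP.
  case: ifP => [/andP[/set_mem Bn nm]|_]; last by case: ifP.
  rewrite mem_set; last exact: BA.
  rewrite lerD2l /e1 /e2; case: (ltngtP n m) nm => // h _; by rewrite ?addr0 ?add0r.
rewrite big_split/= big_split/=.
have -> : e = (c + c * 2) + ((0 + c * 2) + c * 2) + c by rewrite /c; field.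
apply: (@le_trans _ _ (c + c * 2 + (0 + c * 2 + c * 2))); last by rewrite lerDl ltW.
by apply: lerD => //; exact: lerD.
Qed.

End Cross.

(** * Approximation of rank-one maps, and its obstruction *)

Section RankOne.
Context d (T : measurableType d) (R : realType) (P : probability T R).
Context (U : set (set nat)).
Hypothesis UU : is_ultrafilter U.
Hypothesis UN : nonprincipal U.
Hypothesis US : selective U.
Implicit Types (f g h : T -> R) (y phi F : nat -> T -> R) (p q s t : R) (A : set nat).
Local Notation mL := (mL P).
Local Notation nrm := (nrm P).
Local Notation pr := (pr P).
Local Notation bdd := (bdd P).
Local Notation wnull := (wnull P U).
Local Notation upper_est := (upper_est P).
Local Notation lin_op := (lin_op P).

Definition eventual_est r t y := exists A, U A /\ upper_est r t A y.

Lemma ulim_to_sum0 k (x : nat -> nat -> R) : (forall i, (i < k)%N -> ulim_to U (x i) 0) ->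
  ulim_to U (fun n => \sum_(0 <= i < k) `|x i n|) 0.
Proof.
elim: k => [|k IH] H.
  by under eq_fun do rewrite big_nil; exact: ulim_to_cst.
have h1 := IH (fun i ik => H i (ltnW ik)).
have h2 := ulim_to_abs UU (H k (ltnSn k)); rewrite normr0 in h2.
have := ulim_toD UU h1 h2; rewrite addr0; apply: (ulim_to_eq UU).
by apply: (ultraW UU) => n /=; rewrite big_nat_recr.
Qed.

Lemma ler_sum_term k (f : nat -> R) i : (i < k)%N -> (forall j, 0 <= f j) ->
  f i <= \sum_(0 <= j < k) f j.
Proof.
move=> ik f0; rewrite (@big_cat_nat _ _ _ i)//=; last exact: ltnW.
rewrite (big_ltn ik) -[X in X <= _]add0r; apply: lerD; first exact: sumr_ge0.
by rewrite lerDl; exact: sumr_ge0.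
Qed.

(** Applied to x i m, the diagonal operator produces the wanted term n = m and the cross terms <phi
    n, x i m> y n. Splitting x i m into its weak limit h i and a weakly null rest, the cross
    coefficients are small because [phi] is weakly null (in n) and the rest is weakly null (in m);
    [cross_select] sums them. *)
Lemma rank_one_approx p q s s' t phi y k (x : nat -> nat -> T -> R) (h : nat -> T -> R) (e : R) :
  conjg p q -> conjg s s' -> s' <= t ->
  bdd q phi -> wnull p phi -> eventual_est q s phi -> bdd p y -> eventual_est p t y ->
  (forall i, (i < k)%N -> [/\ mL p (h i), bdd p (x i) & wnull q (fun n z => x i n z - h i z)]) ->
  0 < e ->
  exists S, lin_op p q S /\ U [set n | forall i, (i < k)%N ->
    nrm p (fun z => S (x i n) z - pr (phi n) (x i n) * y n z) <= e].
Proof.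
move=> pq ss st [Lp _] wp [A1 [UA1 E1]] [Ly [D [D0 yD]]] [A2 [UA2 E2]] Hx e0.
have [p1 q1 _] := pq; have [p1' q1'] := (ltW p1, ltW q1); have qp := conjg_sym pq.
have [s1 s1' _] := ss; have s0 : 0 < s by lra. have t0 : 0 < t by lra.
have D1 : 0 < D + 1 by lra.
have e1 : 0 < e / (D + 1) by rewrite divr_gt0.
pose w n := \sum_(0 <= i < k) `|pr (phi n) (h i)|.
pose a n m := \sum_(0 <= i < k) `|pr (phi n) (fun z => x i m z - h i z)|.
have Lxh i m : (i < k)%N -> mL p (fun z => x i m z - h i z).
  by move=> ik; have [? [? _] _] := Hx i ik; exact: mLB.
have [A3 [UA3 H3]] : exists A, U A /\ forall B m N, B `<=` A -> A m ->
    \sum_(0 <= n < N | (n \in B) && (n != m)) (w n + a n m) <= e / (D + 1).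
  apply: (cross_select UU US) => //.
  - by move=> n; exact: sumr_ge0.
  - by move=> n m; exact: sumr_ge0.
  - by apply: ulim_to_sum0 => i ik; apply: wp; have [] := Hx i ik.
  - move=> n; apply: ulim_to_sum0 => i ik; have [_ _ wx] := Hx i ik.
    by apply: (ulim_to_eq UU) (wx _ (Lp n)); apply: (ultraW UU) => m /=; rewrite prC.
  - by move=> m; apply: ulim_to_sum0 => i ik; apply: wp; exact: Lxh.
pose A := A1 `&` (A2 `&` A3).
have UA : U A by apply: (ultraI UU) => //; exact: (ultraI UU).
have {}E1 : upper_est q s A phi by apply: upper_est_sub E1 => // n [].
have {}E2 : upper_est p t A y by apply: upper_est_sub E2 => // n [_ []].
have [S [LS HS]] := diag_op UU pq ss st Lp Ly E1 E2.
exists S; split=> //; apply: (ultraS UU) UA => m Am /= i ik.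
have [Lh [Lx bx] wx] := Hx i ik; have [LS1 _ _] := LS.
apply: (nrm_le_dual pq) => //; [|exact: ltW|].
  by apply: mLB => //; [exact: LS1|exact: mLZ].
move=> g Lg; rewrite -/(pr _ g) (prBl pq)//; last 2 first.
- exact: LS1.
- exact: mLZ.
rewrite (prZl _ pq)//.
set v := pr (phi m) (x i m) * pr (y m) g.
have lim := HS _ g (Lx m) Lg.
apply: (ulim_to_le UU (ulim_to_abs UU (ulim_toB UU lim (ulim_to_cst UU v))) (ulim_to_cst UU _)).
apply: (ultraS UU) (ultra_ge UU UN m.+1) => N /= mN.
rewrite (big_selected_D1 _ mN Am) -/v addrAC subrr add0r; apply: le_trans (ler_norm_sum _ _ _) _.
apply: (@le_trans _ _ (\sum_(0 <= n < N | (n \in A) && (n != m)) (w n + a n m) * (D * nrm q g))).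
  apply: ler_sum => n _; rewrite normrM; apply: ler_pM => //.
    have -> : pr (phi n) (x i m) = pr (phi n) (h i) + pr (phi n) (fun z => x i m z - h i z).
      rewrite -(prDr qp)//; last exact: Lxh.
      by congr pr; apply/funext => z; rewrite addrC subrK.
    apply: le_trans (ler_normD _ _) _; apply: lerD.
      exact: (@ler_sum_term k (fun i => `|pr (phi n) (h i)|)).
    exact: (@ler_sum_term k (fun i => `|pr (phi n) (fun z => x i m z - h i z)|)).
  apply: le_trans (pr_bound pq (Ly n) Lg) _.
  by apply: ler_wpM2r; rewrite ?nrm_ge0.
rewrite -mulr_suml mulrA; apply: ler_wpM2r; first exact: nrm_ge0.
apply: (@le_trans _ _ (e / (D + 1) * (D + 1))); last by rewrite divfK// gt_eqF.
apply: ler_pM => //.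
- apply: sumr_ge0 => n _; rewrite addr_ge0//; exact: sumr_ge0.
- by apply: H3; [move=> n [_ []]|case: Am => _ []].
- by rewrite lerDl.
Qed.

Lemma adjoint_wnull p q S F : conjg p q -> lin_op p q S -> (forall n, mL p (F n)) ->
  wnull q F -> wnull q (fun n => S (F n)).
Proof.
move=> pq LS LF wF h Lh; have [g [Lg Hg]] := adjoint pq LS Lh.
by apply: (ulim_to_eq UU) (wF g Lg); apply: (ultraW UU) => n /=; rewrite Hg.
Qed.

Lemma lin_op_sum p q S F A (a : nat -> R) N g : conjg p q -> lin_op p q S ->
  (forall n, mL p (F n)) -> mL q g ->
  pr (S (fun x => \sum_(0 <= n < N | n \in A) a n * F n x)) g =
  \sum_(0 <= n < N | n \in A) a n * pr (S (F n)) g.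
Proof.
move=> pq LS LF Lg; have [h [Lh Hh]] := adjoint pq LS Lg.
have [/ltW p1 _ _] := pq; rewrite Hh; last exact: mL_selected_sum.
rewrite (pr_suml _ pq)//; last by move=> n _; exact: mLZ.
by apply: eq_bigr => n _; rewrite (prZl _ pq)// Hh.
Qed.

Lemma card_selected_unbounded A k : U A -> exists N,
  k%:R <= \sum_(0 <= n < N | n \in A) 1 :> R.
Proof.
move=> UA; elim: k => [|k [N IH]]; first by exists 0%N; rewrite big_nil.
have [n [Nn An]] := ultra_inf UU UN N UA; exists n.+1.
rewrite big_selected_recr/= mem_set// -natr1 lerD2r; apply: le_trans IH _.
by rewrite [X in _ <= X](@big_cat_nat _ _ _ N)//= lerDl; apply: sumr_ge0.
Qed.

Lemma upper_est_card r t A y : 1 <= r -> 0 < t -> (forall n, mL r (y n)) ->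
  upper_est r t A y -> exists C : R, 0 <= C /\ forall N, let k := \sum_(0 <= n < N | n \in A) 1 in
  0 < k -> nrm r (fun x => \sum_(0 <= n < N | n \in A) 1 * y n x) <= C * k `^ t^-1.
Proof.
move=> r1 t0 Ly [C [C0 H]]; exists C; split=> // N k k0.
have kt : 0 < k `^ t^-1 by rewrite powR_gt0.
have := H N (fun=> (k `^ t^-1)^-1); rewrite (ger0_norm (x := (k `^ t^-1)^-1)); last first.
  by rewrite invr_ge0 ltW.
have -> : \sum_(0 <= n < N | n \in A) (k `^ t^-1)^-1 `^ t = 1 :> R.
  rewrite -powRN -powRrM mulNr mulVf ?gt_eqF// powR_inv1 ?(ltW k0)//.
  rewrite -(@mulfV _ k) ?gt_eqF// {1}/k mulr_suml.
  by apply: eq_bigr => n _; rewrite mul1r.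
move=> /(_ (lexx _)); have -> : (fun x => \sum_(0 <= n < N | n \in A) (k `^ t^-1)^-1 * y n x) =
    (fun x => (k `^ t^-1)^-1 * \sum_(0 <= n < N | n \in A) 1 * y n x).
  by apply/funext => x; rewrite mulr_sumr; apply: eq_bigr => n _; rewrite mul1r.
rewrite nrmZ; [|lra|exact: mL_selected_sum].
by rewrite ger0_norm ?invr_ge0 ?(ltW kt)// mulrC ler_pdivrMr.
Qed.

(* If <phi n, S (F n)> stays away from 0, then summing k selected diagonal terms
   gives growth of order k, against k^(1/s + 1/t) from the upper estimates. *)
Lemma obstruction p q s t S phi F : conjg p q -> lin_op p q S ->
  bdd q phi -> wnull p phi -> eventual_est q s phi ->
  bdd p F -> wnull q F -> eventual_est p t F -> 0 < s -> 0 < t -> s^-1 + t^-1 < 1 ->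
  ulim_to U (fun n => pr (phi n) (S (F n))) 0.
Proof.
move=> pq LS bp wp [A1 [UA1 E1]] bF wF [A2 [UA2 E2]] s0 t0 st.
have [p1 q1 _] := pq; have [p1' q1'] := (ltW p1, ltW q1); have qp := conjg_sym pq.
have [LS1 [CS [CS0 HCS]] _] := LS.
have [Lp [Cp [Cp0 HCp]]] := bp; have [LF [CF [CF0 HCF]]] := bF.
pose c n := pr (phi n) (S (F n)).
have cb n : `|c n| <= Cp * (CS * CF).
  apply: le_trans (pr_bound qp (Lp n) (LS1 _ (LF n))) _.
  apply: ler_pM; rewrite ?nrm_ge0//; apply: le_trans (HCS _ (LF n)) _.
  by apply: ler_wpM2l.
have lim := ulim_ex UU cb; set L := ulim U c in lim.
suff -> : 0 = L by [].
apply/eqP; rewrite eq_sym; apply/negPn/negP => L0.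
(* Diagonal terms within [dl] of L have modulus at least [dl]; cross terms of total at most dl/2
   leave at least dl/2 for each selected m. *)
pose dl := `|L| / 2; have dl0 : 0 < dl by rewrite divr_gt0// normr_gt0.
have dl4 : 0 < dl / 2 by rewrite divr_gt0.
have [A3 [UA3 H3]] : exists A, U A /\ forall B m N, B `<=` A -> A m ->
    \sum_(0 <= n < N | (n \in B) && (n != m)) (0 + `|pr (phi n) (S (F m))|) <= dl / 2.
  apply: (cross_select UU US (w := fun=> 0)) => //; first exact: ulim_to_cst.
    move=> n; rewrite -(@normr0 _ R); apply: (ulim_to_abs UU).
    apply: (ulim_to_eq UU) (adjoint_wnull pq LS LF wF (Lp n)).
    by apply: (ultraW UU) => m /=; rewrite prC.
  by move=> m; rewrite -(@normr0 _ R); apply: (ulim_to_abs UU); apply: wp; exact: LS1.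
pose A := (A1 `&` A2) `&` (A3 `&` [set n | `|c n - L| < dl]).
have UA : U A by apply: (ultraI UU); apply: (ultraI UU) => //; exact: lim.
have {}E1 : upper_est q s A phi by apply: upper_est_sub E1 => // n [[]].
have {}E2 : upper_est p t A F by apply: upper_est_sub E2 => // n [[]].
have [C1 [C10 H1]] := upper_est_card q1' s0 Lp E1.
have [C2 [C20 H2]] := upper_est_card p1' t0 LF E2.
(* The estimates below say k dl/2 <= C1 CS C2 k^(1 - th), that is k^th <= Q. The number k of
   selected terms is taken above Q^(1/th). *)
pose th := 1 - (s^-1 + t^-1); have th0 : 0 < th by rewrite /th; lra.
pose Q := C1 * (CS * C2) / (dl / 2).
have Q0 : 0 <= Q by rewrite divr_ge0 ?(ltW dl4)// !mulr_ge0.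
pose k0 := (Num.truncn (Q `^ th^-1)).+1.
have [N HN] := card_selected_unbounded k0 UA.
set k := (X in _ <= X) in HN.
have Qk : Q `^ th^-1 < k by apply: lt_le_trans HN; exact: truncnS_gt.
have k1 : 0 < k by apply: le_lt_trans Qk; exact: powR_ge0.
pose f x := \sum_(0 <= n < N | n \in A) 1 * F n x.
pose g x := \sum_(0 <= n < N | n \in A) 1 * phi n x.
have Lf : mL p f by exact: mL_selected_sum.
have Lg : mL q g by exact: mL_selected_sum.
have up : `|pr (S f) g| <= C1 * (CS * C2) * k `^ (s^-1 + t^-1).
  apply: le_trans (pr_bound pq (LS1 _ Lf) Lg) _.
  have k0' : (s^-1 + t^-1 == 0) ==> (k != 0) by rewrite (gt_eqF k1) implybT.
  rewrite powRD//; apply: (@le_trans _ _ (CS * (C2 * k `^ t^-1) * (C1 * k `^ s^-1))).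
    apply: ler_pM; rewrite ?nrm_ge0//; last exact: H1.
    by apply: le_trans (HCS _ Lf) _; apply: ler_wpM2l => //; exact: H2.
  by rewrite le_eqVlt; apply/orP; left; apply/eqP; ring.
have lo : k * (dl / 2) <= `|pr (S f) g|.
  rewrite (lin_op_sum A (fun=> 1) N pq LS LF Lg).
  have E m : A m -> (m < N)%N -> pr (S (F m)) g = c m +
      \sum_(0 <= n < N | (n \in A) && (n != m)) pr (phi n) (S (F m)).
    move=> Am mN; rewrite prC (pr_suml _ qp)//; [|by move=> n _; exact: mLZ|exact: LS1].
    rewrite (big_selected_D1 _ mN Am).
    rewrite (prZl _ qp)//; last exact: LS1.
    rewrite mul1r; congr (_ + _); apply: eq_bigr => n _.
    by rewrite (prZl _ qp)// ?mul1r//; exact: LS1.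
  (* Multiplication by the sign of L makes all contributions positive, so they add up without
     cancellation. *)
  have sg m : A m -> (m < N)%N -> dl / 2 <= Num.sg L * pr (S (F m)) g.
    move=> Am mN; rewrite E// mulrDr.
    have a1 : dl <= Num.sg L * c m.
      have -> : Num.sg L * c m = `|L| + Num.sg L * (c m - L).
        by rewrite mulrBr -normrEsg addrC subrK.
      have b1 : - dl <= Num.sg L * (c m - L).
        rewrite lerNl; apply: le_trans (ler_norm _) _; rewrite normrN normrM.
        rewrite normr_sg L0 mul1r; apply: ltW; by case: Am => _ [].
      rewrite (_ : dl = `|L| + - dl) ?lerD2l//; rewrite /dl; move: `|L| => z; lra.
    have a2 : - (dl / 2) <= Num.sg L *
        \sum_(0 <= n < N | (n \in A) && (n != m)) pr (phi n) (S (F m)).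
      rewrite lerNl; apply: le_trans (ler_norm _) _; rewrite normrN normrM.
      rewrite normr_sg L0 mul1r; apply: le_trans (ler_norm_sum _ _ _) _.
      have := H3 A m N; under eq_bigr do rewrite add0r; apply; last by case: Am => _ [].
      by move=> n [_ []].
    rewrite (_ : dl / 2 = dl + - (dl / 2)); first exact: lerD.
    by apply/eqP; rewrite eq_sym subr_eq -splitr.
  have <- : `|Num.sg L * \sum_(0 <= n < N | n \in A) 1 * pr (S (F n)) g| =
      `|\sum_(0 <= n < N | n \in A) 1 * pr (S (F n)) g|.
    by rewrite normrM normr_sg L0 mul1r.
  apply: le_trans (ler_norm _); rewrite /k mulr_suml mulr_sumr.
  rewrite big_nat_cond [X in _ <= X]big_nat_cond.
  by apply: ler_sum => m /andP[/andP[_ mN] /set_mem Am]; rewrite !mul1r; exact: sg.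
have := le_trans lo up; apply/negP; rewrite -ltNge.
have kE : k = k `^ th * k `^ (s^-1 + t^-1).
  rewrite -powRD; last by rewrite (gt_eqF k1) implybT.
  by rewrite /th subrK powRr1// ltW.
rewrite [X in _ < X](_ : _ = k `^ th * (dl / 2) * k `^ (s^-1 + t^-1)); last first.
  by rewrite {1}kE mulrAC.
rewrite ltr_pM2r ?powR_gt0// -ltr_pdivrMr// -/Q.
have -> : Q = (Q `^ th^-1) `^ th by rewrite -powRrM mulVf ?gt_eqF// powRr1.
by rewrite gt0_ltr_powR ?nnegrE ?powR_ge0// ltW.
Qed.

End RankOne.

(** * Lebesgue measure on the unit interval as a probability *)

Lemma mu01_setT (R : realType) : mu01 R setT = 1%:E.
Proof.
by rewrite /mu01 /mrestr setTI lebesgue_measure_itv/= lte_fin ltr01 -EFinB subr0.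
Qed.

(* A copy of mu01 under another name, to carry the probability structure. *)
Definition unif01 (R : realType) := mrestr (@lebesgue_measure R) (@measurable_01 R).
Arguments unif01 : clear implicits.
HB.instance Definition _ (R : realType) :=
  Measure.copy (unif01 R) (mrestr (@lebesgue_measure R) (@measurable_01 R)).
HB.instance Definition _ (R : realType) :=
  Measure_isProbability.Build _ _ _ (unif01 R) (@mu01_setT R).
Definition P01 (R : realType) : probability (measurableTypeR R) R := unif01 R.
Arguments P01 : clear implicits.

(** * From functions to L^p and its ultrapower *)

Section LpLevel.
Context (R : realType) (p : R) (p1 : (1 <= p%:E)%E).
Notation Lf := (LfunType (mu01 R) p1).
Local Notation T := (measurableTypeR R).
Local Notation P := (P01 R).
Implicit Types (f g h : Lf) (F G : nat -> Lf) (phi psi : nat -> T -> R).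

Definition rawf f : T -> R := f.
Arguments rawf : simpl never.

Lemma p_ge1 : 1 <= p.
Proof. by rewrite -lee_fin. Qed.

Lemma p_gt0 : 0 < p.
Proof. exact: lt_le_trans ltr01 p_ge1. Qed.

Lemma Lf_mL f : mL P p (rawf f).
Proof.
apply: finite_norm_mL; first by rewrite gt_eqF// p_gt0.
  exact: (measurable_funPT f).
exact: Lfunction_finite.
Qed.

Lemma lpnE f : lpn p1 f = nrm P p (rawf f).
Proof. by rewrite /lpn [X in fine X](LnormE (Lf_mL f)). Qed.

Lemma l2nE f : mL P 2 (rawf f) -> l2n p1 f = nrm P 2 (rawf f).
Proof. by move=> L2; rewrite /l2n [X in fine X](LnormE L2). Qed.

Lemma mL_Lfun (u : T -> R) : mL P p u -> u \in Lfun (mu01 R) p%:E.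
Proof.
move=> Lu; apply/andP; split; first by rewrite inE; case: Lu.
by rewrite inE; exact: (mL_finite_norm Lu).
Qed.

Definition mkLf (u : T -> R) : Lf :=
  if pselect (u \in Lfun (mu01 R) p%:E) is left h then Lfun_Sub p1 h else 0.

Lemma mkLfE (u : T -> R) : mL P p u -> rawf (mkLf u) = u.
Proof.
move=> /mL_Lfun Lu; rewrite /mkLf /rawf; case: pselect => // h.
Qed.

Lemma mkLfK f : mkLf (rawf f) = f.
Proof. by apply/LfuneqP => x; have /(congr1 (@^~ x)) := mkLfE (Lf_mL f). Qed.

Lemma rawfD f g : rawf (f + g) = (fun x => rawf f x + rawf g x).
Proof. by []. Qed.

Lemma rawfZ (a : R) f : rawf (a *: f) = (fun x => a * rawf f x).
Proof. by []. Qed.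

Lemma rawfB f g : rawf (f - g) = (fun x => rawf f x - rawf g x).
Proof. by []. Qed.

Lemma rawfN f : rawf (- f) = (fun x => - rawf f x).
Proof. by []. Qed.

Lemma rawf_inj f g : rawf f = rawf g -> f = g.
Proof. by move=> fg; rewrite -(mkLfK f) fg mkLfK. Qed.

Lemma rawf0 : rawf 0 = (fun=> 0).
Proof. by []. Qed.

Lemma lpn_ge0 f : 0 <= lpn p1 f.
Proof. by rewrite lpnE nrm_ge0. Qed.

Lemma lpnD f g : lpn p1 (f + g) <= lpn p1 f + lpn p1 g.
Proof. by rewrite !lpnE rawfD; apply: nrmD; [exact: p_ge1|exact: Lf_mL|exact: Lf_mL]. Qed.

Lemma lpnZ (a : R) f : lpn p1 (a *: f) = `|a| * lpn p1 f.
Proof. by rewrite !lpnE rawfZ nrmZ//; [exact: p_gt0|exact: Lf_mL]. Qed.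

Lemma lpn0 : lpn p1 0 = 0.
Proof. by rewrite lpnE rawf0 nrm0//; exact: p_gt0. Qed.

Lemma lpnN f : lpn p1 (- f) = lpn p1 f.
Proof. by rewrite -scaleN1r lpnZ normrN1 mul1r. Qed.

Lemma lpnBC f g : lpn p1 (f - g) = lpn p1 (g - f).
Proof. by rewrite -opprB lpnN. Qed.

Lemma lpnB f g : lpn p1 (f - g) <= lpn p1 f + lpn p1 g.
Proof. by rewrite -(lpnN g); exact: lpnD. Qed.

Lemma lpn_triangle f g h : lpn p1 (f - h) <= lpn p1 (f - g) + lpn p1 (g - h).
Proof. by have -> : f - h = (f - g) + (g - h); [rewrite addrA subrK|exact: lpnD]. Qed.

Definition raws F : nat -> T -> R := fun n => rawf (F n).

Lemma ubddP F : ubounded p1 F <-> bdd P p (raws F).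
Proof.
split=> [[C H]|[_ [C [_ H]]]]; last by exists C => n; rewrite lpnE; exact: H.
split=> [n|]; first exact: Lf_mL.
exists `|C|; split=> // n; rewrite -lpnE; apply: le_trans (H n) _; exact: ler_norm.
Qed.

Lemma ubdd_cst f : ubounded p1 (fun=> f).
Proof. by exists (lpn p1 f). Qed.

Lemma ubddD F G : ubounded p1 F -> ubounded p1 G -> ubounded p1 (seq_add p1 F G).
Proof.
move=> [C H] [D K]; exists (C + D) => n; apply: le_trans (lpnD _ _) _; exact: lerD.
Qed.

Lemma ubddZ (a : R) F : ubounded p1 F -> ubounded p1 (seq_scale p1 a F).
Proof. by move=> [C H]; exists (`|a| * C) => n; rewrite lpnZ ler_wpM2l. Qed.

Lemma ubddB F G : ubounded p1 F -> ubounded p1 G -> ubounded p1 (Defs.seq_sub p1 F G).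
Proof.
move=> [C H] [D K]; exists (C + D) => n; apply: le_trans (lpnB _ _) _; exact: lerD.
Qed.

(** By [pr_ext], linearity tested against L^q becomes the vanishing of the p-norm of the defect,
    which is the linearity asked by [lp_op]. *)
Lemma lin_op_lp_op q (S : (T -> R) -> T -> R) : conjg p q -> lin_op P p q S ->
  lp_op p1 (fun f => mkLf (S (rawf f))).
Proof.
move=> pq [LS [C [C0 HC]] lS]; have LL f := Lf_mL f.
split=> [a f g|]; last first.
  by exists C => f; rewrite !lpnE mkLfE; [exact: HC|exact: LS].
have E u : rawf (mkLf (S (rawf u))) = S (rawf u) by rewrite mkLfE//; exact: LS.
have E' u x : rawf (mkLf (S (rawf u))) x = S (rawf u) x by rewrite E.
have E3 : rawf (mkLf (S (rawf (a *: f + g)))) = S (fun x => a * rawf f x + rawf g x) by exact: E.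
rewrite lpnE (_ : rawf _ = (fun x => S (fun y => a * rawf f y + rawf g y) x -
  (a * S (rawf f) x + S (rawf g) x))); last first.
  by apply/funext => x; rewrite -!E' -(congr1 (@^~ x) E3).
apply: (pr_ext pq); first by apply: LS; apply: mLD p_ge1 _ _ => //; exact: mLZ.
  by apply: mLD p_ge1 _ _; [apply: mLZ|]; exact: LS.
move=> h Lh; rewrite lS// (pr_linl _ pq)//; exact: LS.
Qed.

Lemma lp_op_lin_op q (S : Lf -> Lf) : conjg p q -> lp_op p1 S ->
  lin_op P p q (fun u => rawf (S (mkLf u))).
Proof.
move=> pq [lS [C HC]]; split=> [u _||a u v h Lu Lv Lh]; first exact: Lf_mL.
  exists `|C|; split=> // u Lu; rewrite -lpnE; apply: le_trans (HC _) _.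
  by rewrite lpnE mkLfE// ler_wpM2r ?nrm_ge0// ler_norm.
have := lS a (mkLf u) (mkLf v); rewrite lpnE rawfB rawfD rawfZ => n0.
have -> : mkLf (fun x => a * u x + v x) = a *: mkLf u + mkLf v.
  by rewrite -[RHS]mkLfK rawfD rawfZ !mkLfE.
rewrite -(pr_linl _ pq)//; try exact: Lf_mL.
apply/eqP; rewrite -subr_eq0 -(prBl pq)//; last 2 first.
- exact: Lf_mL.
- by apply: mLD p_ge1 _ _; [apply: mLZ|]; exact: Lf_mL.
have LB : mL P p (fun x => rawf (S (a *: mkLf u + mkLf v)) x -
    (a * rawf (S (mkLf u)) x + rawf (S (mkLf v)) x)).
  by apply: mLB p_ge1 _ _; [|apply: mLD p_ge1 _ _; [apply: mLZ|]]; exact: Lf_mL.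
by rewrite -normr_le0; have := pr_bound pq LB Lh; rewrite n0 mul0r.
Qed.

Lemma lp_func_pr q (u : T -> R) : conjg p q -> mL P q u ->
  lp_func p1 (fun f => pr P (rawf f) u).
Proof.
move=> pq Lu; split=> [a f g|]; first by rewrite rawfD rawfZ (pr_linl _ pq)//; exact: Lf_mL.
exists (nrm P q u) => f; rewrite lpnE mulrC; apply: (pr_bound pq) => //; exact: Lf_mL.
Qed.

Lemma lp_func_rep q (phi : Lf -> R) : conjg p q -> lp_func p1 phi ->
  exists u, mL P q u /\ forall f, phi f = pr P (rawf f) u.
Proof.
move=> pq [lphi [C HC]].
have [] := @riesz_representation _ _ _ P p q `|C| (fun u => phi (mkLf u)) pq (normr_ge0 _).
- move=> a u v Lu Lv; rewrite -lphi; congr phi.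
  by rewrite -[RHS]mkLfK rawfD rawfZ !mkLfE.
- move=> u Lu; apply: le_trans (HC _) _; rewrite lpnE mkLfE// ler_wpM2r ?nrm_ge0//.
  exact: ler_norm.
move=> u [Lu H]; exists u; split=> // f; rewrite -[in LHS](mkLfK f) H//; exact: Lf_mL.
Qed.

Context (U : set (set nat)).
Hypothesis UU : is_ultrafilter U.

Lemma unullP F : unull p1 U F <-> nullr P U p (raws F).
Proof.
suff -> : unull p1 U F = nullr P U p (raws F) by [].
by rewrite /unull /nullr; congr ulim_to; apply/funext => n; rewrite lpnE.
Qed.

Lemma unull_near F (e : R) : unull p1 U F -> 0 < e -> U [set n | lpn p1 (F n) <= e].
Proof.
move=> nF e0; apply: (ultraS UU) (nF _ e0) => n /=.
by rewrite subr0 ger0_norm ?lpn_ge0// => /ltW.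
Qed.

Lemma unullI F : (forall e : R, 0 < e -> U [set n | lpn p1 (F n) <= e]) -> unull p1 U F.
Proof.
move=> H; apply: (ulim_to0P UU) => e e0; apply: (ultraS UU) (H e e0) => n /=.
by rewrite ger0_norm ?lpn_ge0.
Qed.

Lemma unull_le F G : (forall n, lpn p1 (F n) <= lpn p1 (G n)) -> unull p1 U G -> unull p1 U F.
Proof.
move=> FG; apply: (ulim_to_squeeze UU); apply: (ultraW UU) => n /=.
by rewrite ger0_norm ?lpn_ge0.
Qed.

Lemma unullD F G : unull p1 U F -> unull p1 U G -> unull p1 U (seq_add p1 F G).
Proof.
move=> nF nG; have := ulim_toD UU nF nG; rewrite addr0; apply: (ulim_to_squeeze UU).
apply: (ultraW UU) => n /=; rewrite ger0_norm ?lpn_ge0//; exact: lpnD.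
Qed.

Lemma unullZ (a : R) F : unull p1 U F -> unull p1 U (seq_scale p1 a F).
Proof.
move=> nF; have := ulim_toZ UU `|a| nF; rewrite mulr0; apply: (ulim_to_eq UU).
by apply: (ultraW UU) => n /=; rewrite lpnZ.
Qed.

Lemma unull_sub_sym F G : unull p1 U (Defs.seq_sub p1 F G) -> unull p1 U (Defs.seq_sub p1 G F).
Proof. by apply: unull_le => n; rewrite lpnBC. Qed.

Lemma unull_sub_trans F G H : unull p1 U (Defs.seq_sub p1 F G) -> unull p1 U (Defs.seq_sub p1 G H) ->
  unull p1 U (Defs.seq_sub p1 F H).
Proof.
move=> n1 n2; have := unullD n1 n2; congr unull.
by apply/funext => n; rewrite /seq_add /Defs.seq_sub addrA subrK.
Qed.

Lemma unull_sub_refl F : unull p1 U (Defs.seq_sub p1 F F).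
Proof.
apply: unullI => e e0; apply: (ultraW UU) => n /=.
by rewrite /Defs.seq_sub subrr lpn0 ltW.
Qed.

Lemma unorm_lim F : ubounded p1 F -> ulim_to U (fun n => lpn p1 (F n)) (unorm p1 U F).
Proof.
by move=> [C H]; apply: (ulim_ex UU (C := C)) => n; rewrite ger0_norm ?lpn_ge0.
Qed.

Lemma unorm_ge0 F : ubounded p1 F -> 0 <= unorm p1 U F.
Proof.
move=> bF; apply: (ulim_to_le UU (ulim_to_cst UU _) (unorm_lim bF)).
by apply: (ultraW UU) => n /=; exact: lpn_ge0.
Qed.

Lemma unorm_le F (e : R) : ubounded p1 F -> U [set n | lpn p1 (F n) <= e] ->
  unorm p1 U F <= e.
Proof. by move=> bF H; apply: (ulim_to_le UU (unorm_lim bF) (ulim_to_cst UU _)). Qed.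

Lemma unorm_unull F : ubounded p1 F -> unorm p1 U F = 0 -> unull p1 U F.
Proof. by move=> bF h; have := unorm_lim bF; rewrite h. Qed.

Lemma uhatP q F : conjg p q -> uhat p1 U F <-> ubounded p1 F /\ wnull P U q (raws F).
Proof.
move=> pq; split=> -[bF H]; split=> //.
  by move=> u Lu; exact: (H _ (lp_func_pr pq Lu)).
move=> phi lphi; have [u [Lu Hu]] := lp_func_rep pq lphi.
by apply: (ulim_to_eq UU) (H u Lu); apply: (ultraW UU) => n /=; rewrite Hu.
Qed.

Definition uval phi F : R := ulim U (fun n => pr P (phi n) (rawf (F n))).

Section Values.
Variable q : R.
Hypothesis pq : conjg p q.
Let qp : conjg q p := conjg_sym pq.

Lemma uval_lim phi F : bdd P q phi -> ubounded p1 F ->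
  ulim_to U (fun n => pr P (phi n) (rawf (F n))) (uval phi F).
Proof.
move=> [Lp [C [C0 HC]]] [D HD]; apply: (ulim_ex UU (C := C * D)) => n.
apply: le_trans (pr_bound qp (Lp n) (Lf_mL _)) _.
by apply: ler_pM; rewrite ?nrm_ge0// -lpnE.
Qed.

Lemma uval_lin phi (a : R) F G : bdd P q phi -> ubounded p1 F -> ubounded p1 G ->
  uval phi (seq_add p1 (seq_scale p1 a F) G) = a * uval phi F + uval phi G.
Proof.
move=> bp bF bG; apply: (ulimE UU).
apply: (ulim_to_eq UU) (ulim_toD UU (ulim_toZ UU a (uval_lim bp bF)) (uval_lim bp bG)).
apply: (ultraW UU) => n /=; have [Lp _] := bp.
have LL f := Lf_mL f.
have LF : mL P p (rawf (seq_scale p1 a F n)) by exact: (mLZ a (LL (F n))).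
by rewrite rawfD (prDr qp (Lp n) LF (LL (G n))) rawfZ (prZr _ qp (Lp n) (LL (F n))).
Qed.

Lemma uvalB phi F G : bdd P q phi -> ubounded p1 F -> ubounded p1 G ->
  uval phi (Defs.seq_sub p1 F G) = uval phi F - uval phi G.
Proof.
move=> bp bF bG; have := uval_lin (-1) bp bG bF; rewrite mulN1r addrC => <-.
by congr uval; apply/funext => n; rewrite /seq_add /seq_scale scaleN1r addrC.
Qed.

Lemma uvalD phi F G : bdd P q phi -> ubounded p1 F -> ubounded p1 G ->
  uval phi (seq_add p1 F G) = uval phi F + uval phi G.
Proof.
move=> bp bF bG; have := uval_lin 1 bp bF bG; rewrite mul1r => <-.
by congr uval; apply/funext => n; rewrite /seq_add /seq_scale scale1r.
Qed.

Lemma uval_linl phi psi (a : R) F : bdd P q phi -> bdd P q psi -> ubounded p1 F ->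
  uval (fun n x => a * phi n x + psi n x) F = a * uval phi F + uval psi F.
Proof.
move=> bp bs bF; apply: (ulimE UU).
apply: (ulim_to_eq UU) (ulim_toD UU (ulim_toZ UU a (uval_lim bp bF)) (uval_lim bs bF)).
apply: (ultraW UU) => n /=; have [Lp _] := bp; have [Ls _] := bs.
by rewrite (pr_linl _ qp)//; exact: Lf_mL.
Qed.

Lemma uval_bound phi : bdd P q phi -> exists C : R, 0 <= C /\
  forall F, ubounded p1 F -> `|uval phi F| <= C * unorm p1 U F.
Proof.
move=> bp; have [Lp [C [C0 HC]]] := bp; exists C; split=> // F bF.
apply: (ulim_to_le UU (ulim_to_abs UU (uval_lim bp bF)) (ulim_toZ UU C (unorm_lim bF))).
apply: (ultraW UU) => n /=; apply: le_trans (pr_bound qp (Lp n) (Lf_mL _)) _.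
by rewrite lpnE; apply: ler_wpM2r; rewrite ?nrm_ge0.
Qed.

Lemma uval_unull phi F : bdd P q phi -> ubounded p1 F -> unull p1 U F -> uval phi F = 0.
Proof.
move=> bp bF nF; have [C [C0 H]] := uval_bound bp.
apply/eqP; rewrite -normr_le0; apply: le_trans (H F bF) _.
by rewrite [unorm _ _ _](ulimE UU nF) mulr0.
Qed.

Lemma uval_eq phi F G : bdd P q phi -> ubounded p1 F -> ubounded p1 G ->
  unull p1 U (Defs.seq_sub p1 F G) -> uval phi F = uval phi G.
Proof.
move=> bp bF bG nFG; apply/eqP; rewrite -subr_eq0 -uvalB//; apply/eqP.
by apply: uval_unull => //; exact: ubddB.
Qed.

Lemma ufunc_uval phi : bdd P q phi -> ufunc p1 U (uval phi).
Proof.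
move=> bp; split=> [a F G bF bG|]; first exact: uval_lin.
by have [C [_ H]] := uval_bound bp; exists C.
Qed.

(** L^p, its complement, M, N and L^p + M all take this form. Closedness and saturation are then
    proved once, and WOT limits preserve invariance because the [uval phi] are bounded
    functionals. *)
Definition annih (Phi : set (nat -> T -> R)) : set (nat -> Lf) :=
  [set F | ubounded p1 F /\ forall phi, Phi phi -> uval phi F = 0].

Lemma annih_usubspace Phi : (forall phi, Phi phi -> bdd P q phi) -> usubspace p1 U (annih Phi).
Proof.
move=> bPhi; split.
- by move=> F [].
- split; first exact: ubdd_cst.
  move=> phi /bPhi bp; apply: uval_unull => //; first exact: ubdd_cst.
  apply: unullI => e e0; apply: (ultraW UU) => n /=; by rewrite lpn0 ltW.
- move=> a F G [bF HF] [bG HG]; split; first by apply: ubddD => //; exact: ubddZ.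
  by move=> phi Pp; rewrite uval_lin ?HF ?HG ?mulr0 ?addr0//; exact: bPhi.
- move=> F G [bF HF] bG nFG; split=> // phi Pp.
  by rewrite -(uval_eq (bPhi _ Pp) bF bG nFG) HF.
- move=> F bF H; split=> // phi Pp; have bp := bPhi _ Pp.
  have [C [C0 HC]] := uval_bound bp.
  apply/eqP; rewrite -normr_le0; apply/ler_addgt0Pl => e e0; rewrite addr0.
  have C1 : 0 < C + 1 by rewrite ltr_wpDl.
  have e1 : 0 < e / (C + 1) by rewrite divr_gt0.
  have [G [[bG HG] lt]] := H _ e1.
  have bFG := ubddB bF bG.
  have -> : uval phi F = uval phi (Defs.seq_sub p1 F G) by rewrite uvalB// HG// subr0.
  apply: le_trans (HC _ bFG) _.
  apply: (@le_trans _ _ ((C + 1) * (e / (C + 1)))); last by rewrite mulrC divfK// gt_eqF.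
  by apply: ler_pM => //; [exact: unorm_ge0|rewrite lerDl|exact: ltW].
Qed.

End Values.

End LpLevel.

Ltac lf_ring := apply: rawf_inj; apply/funext => ?;
  rewrite /Defs.seq_sub /seq_add /seq_scale !(rawfD, rawfN, rawfZ, rawf0) /=; ring.

(** * Operators on the ultrapower, and maps approximated by ultrapowers of operators *)

Section Operators.
Context (R : realType) (p : R) (p1 : (1 <= p%:E)%E) (U : set (set nat)).
Hypothesis UU : is_ultrafilter U.
Notation Lf := (LfunType (mu01 R) p1).
Local Notation T := (measurableTypeR R).
Local Notation P := (P01 R).
Local Notation ubd := (ubounded p1).
Local Notation unull := (unull p1 U).
Local Notation unorm := (unorm p1 U).
Local Notation usub := (Defs.seq_sub p1).
Local Notation uadd := (seq_add p1).
Local Notation usc := (seq_scale p1).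
Local Notation lpn := (lpn p1).
Implicit Types (f g h : Lf) (F G : nat -> Lf).

Lemma lp_op_sub (S : Lf -> Lf) : lp_op p1 S -> exists C : R, 0 <= C /\
  forall f g, lpn (S f - S g) <= C * lpn (f - g).
Proof.
move=> [lS [C HC]]; exists `|C|; split=> // f g.
have h := lS 1 (f - g) g; rewrite !scale1r subrK in h.
have -> : S f - S g = (S f - (S (f - g) + S g)) + S (f - g).
  by rewrite opprD addrA addrAC subrK.
apply: le_trans (lpnD _ _) _; rewrite h add0r; apply: le_trans (HC _) _.
by rewrite ler_wpM2r ?lpn_ge0// ler_norm.
Qed.

Lemma lp_op_ubd S F : lp_op p1 S -> ubd F -> ubd (Tult p1 S F).
Proof.
move=> [_ [C HC]] [D HD]; exists (`|C| * D) => n; apply: le_trans (HC _) _.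
apply: (@le_trans _ _ (`|C| * lpn (F n))); first by rewrite ler_wpM2r ?lpn_ge0// ler_norm.
by rewrite ler_wpM2l.
Qed.

Lemma lp_op0 : lp_op p1 (fun=> 0).
Proof.
split=> [a f g|]; first by rewrite scaler0 addr0 subrr lpn0.
by exists 0 => f; rewrite lpn0 mul0r.
Qed.

Lemma lp_opD S S' : lp_op p1 S -> lp_op p1 S' -> lp_op p1 (fun f => S f + S' f).
Proof.
move=> [lS [C HC]] [lS' [C' HC']]; split=> [a f g|]; last first.
  exists (C + C') => f; apply: le_trans (lpnD _ _) _; rewrite mulrDl; exact: lerD.
apply/eqP; rewrite eq_le lpn_ge0 andbT.
have -> : S (a *: f + g) + S' (a *: f + g) - (a *: (S f + S' f) + (S g + S' g)) =
    (S (a *: f + g) - (a *: S f + S g)) + (S' (a *: f + g) - (a *: S' f + S' g)).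
  by rewrite scalerDr [X in _ - X]addrACA opprD addrACA.
by apply: le_trans (lpnD _ _) _; rewrite lS lS' addr0.
Qed.

Lemma lp_op_rank1 q (u : T -> R) h : conjg p q -> mL P q u ->
  lp_op p1 (fun f => pr P u (rawf f) *: h).
Proof.
move=> pq Lu; split=> [a f g|].
  rewrite rawfD rawfZ prC (pr_linl _ pq)//; try exact: Lf_mL.
  by rewrite scalerDl -scalerA prC [pr P (rawf g) u]prC subrr lpn0.
exists (nrm P q u * lpn h) => f; rewrite lpnZ mulrAC ler_wpM2r ?lpn_ge0//.
by rewrite lpnE; apply: (pr_bound (conjg_sym pq)) => //; exact: Lf_mL.
Qed.

Lemma Tult_uop S : lp_op p1 S -> uop p1 U (Tult p1 S).
Proof.
move=> lS; split=> [F bF|a F G bF bG|]; first exact: lp_op_ubd.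
  apply: (unullI UU) => e e0; apply: (ultraW UU) => n /=.
  by rewrite /Defs.seq_sub /seq_add /seq_scale /Tult lS.1 ltW.
have [_ [C HC]] := lS; exists C => F bF.
apply: (ulim_to_le UU (unorm_lim UU (lp_op_ubd lS bF)) (ulim_toZ UU C (unorm_lim UU bF))).
by apply: (ultraW UU) => n /=; exact: HC.
Qed.

Section Uop.
Variable S : (nat -> Lf) -> nat -> Lf.
Hypothesis uS : uop p1 U S.

Lemma uop_ubd F : ubd F -> ubd (S F).
Proof. by case: uS => h _ _; exact: h. Qed.

Lemma uop_unull F : ubd F -> unull F -> unull (S F).
Proof.
move=> bF nF; have [_ _ [C HC]] := uS; have bS := uop_ubd bF.
apply: (unorm_unull UU bS); apply/eqP; rewrite eq_le (unorm_ge0 UU bS) andbT.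
by apply: le_trans (HC F bF) _; rewrite (ulimE UU nF : unorm F = 0) mulr0.
Qed.

Lemma uop_lin a F G : ubd F -> ubd G ->
  unull (usub (S (uadd (usc a F) G)) (uadd (usc a (S F)) (S G))).
Proof. by case: uS => _ h _; exact: h. Qed.

Lemma uop_sub F G : ubd F -> ubd G -> unull (usub F G) -> unull (usub (S F) (S G)).
Proof.
move=> bF bG nFG; have bFG := ubddB bF bG.
have h := uop_lin 1 bFG bG.
have e : uadd (usc 1 (usub F G)) G = F.
  by apply/funext => n; rewrite /seq_add /seq_scale /Defs.seq_sub scale1r subrK.
rewrite e in h; have h2 := unullD UU h (uop_unull bFG nFG); move: h2; congr unull.
apply/funext => n; rewrite /seq_add /seq_scale /Defs.seq_sub scale1r opprD addrA addrAC.
by rewrite subrK.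
Qed.

End Uop.

(** Membership in the strong operator closure of the T^U, stated on representatives. Norm
    approximation at finitely many points adds up and passes to limits in the target, and it implies
    the weak version. *)
Definition near_op (G : (nat -> Lf) -> nat -> Lf) :=
  forall k (x : nat -> nat -> Lf) (e : R), 0 < e ->
  (forall i, (i < k)%N -> ubd (x i)) ->
  exists S, lp_op p1 S /\ forall i, (i < k)%N ->
    U [set n | lpn (S (x i n) - G (x i) n) <= e].

Lemma near_op0 : near_op (fun _ _ => 0).
Proof.
move=> k x e e0 _; exists (fun=> 0); split; first exact: lp_op0.
by move=> i _; apply: (ultraW UU) => n /=; rewrite subrr lpn0 ltW.
Qed.

Lemma near_opD (G H : (nat -> Lf) -> nat -> Lf) : near_op G -> near_op H -> near_op (fun F n => G F n + H F n).
Proof.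
move=> nG nH k x e e0 bx; have e2 : 0 < e / 2 by rewrite divr_gt0.
have [S [lS HS]] := nG k x _ e2 bx; have [S' [lS' HS']] := nH k x _ e2 bx.
exists (fun f => S f + S' f); split; first exact: lp_opD.
move=> i ik; apply: (ultraS UU) (ultraI UU (HS i ik) (HS' i ik)) => n [/= a b].
rewrite opprD addrACA [e]splitr; apply: le_trans (lpnD _ _) _; exact: lerD.
Qed.

Lemma near_op_ext (G H : (nat -> Lf) -> nat -> Lf) : (forall F, ubd F -> G F = H F) -> near_op H -> near_op G.
Proof.
move=> GH nH k x e e0 bx; have [S [lS HS]] := nH k x e e0 bx.
by exists S; split=> // i ik; rewrite GH; [exact: HS|exact: bx].
Qed.

Definition rank1 (phi : nat -> T -> R) (y : nat -> Lf) (F : nat -> Lf) n :=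
  uval U phi F *: y n.

Lemma near_rank1_approx phi y :
  (forall e : R, 0 < e -> exists y', near_op (rank1 phi y') /\
    U [set n | lpn (y' n - y n) <= e]) -> near_op (rank1 phi y).
Proof.
move=> H k x e e0 bx.
pose B := \sum_(0 <= i < k) `|uval U phi (x i)|.
have B0 : 0 <= B by exact: sumr_ge0.
have B1 : 0 < B + 1 by rewrite ltr_wpDl.
have e2 : 0 < e / 2 by rewrite divr_gt0.
have e3 : 0 < e / 2 / (B + 1) by rewrite divr_gt0.
have [y' [ny' Uy]] := H _ e3; have [S [lS HS]] := ny' k x _ e2 bx.
exists S; split=> // i ik; apply: (ultraS UU) (ultraI UU (HS i ik) Uy) => n [/= a b].
apply: le_trans (lpn_triangle _ (rank1 phi y' (x i) n) _) _.
rewrite [e]splitr; apply: lerD => //; rewrite /rank1 -scalerBr lpnZ.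
apply: (@le_trans _ _ ((B + 1) * (e / 2 / (B + 1)))); last by rewrite mulrC divfK// gt_eqF.
apply: ler_pM => //; first exact: lpn_ge0.
apply: (@le_trans _ _ B); last by rewrite lerDl.
exact: (@ler_sum_term R k (fun i => `|uval U phi (x i)|)).
Qed.

Lemma near_rank1D phi y y' : near_op (rank1 phi y) -> near_op (rank1 phi y') ->
  near_op (rank1 phi (uadd y y')).
Proof.
move=> h h'; apply: near_op_ext (near_opD h h') => F _.
by apply/funext => n; rewrite /rank1 scalerDr.
Qed.

Lemma near_rank1_cst q (u : T -> R) y : conjg p q -> mL P q u -> uLp p1 U y ->
  near_op (rank1 (fun=> u) y).
Proof.
move=> pq Lu [by' [h nh]]; apply: near_rank1_approx => e e0; exists (fun=> h); split; last first.
  by apply: (ultraS UU) (unull_near UU nh e0) => n /=; rewrite lpnBC.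
move=> k x e' e0' bx; exists (fun f => pr P u (rawf f) *: h); split; first exact: lp_op_rank1 Lu.
move=> i ik; have := uval_lim UU pq (bdd_cst Lu) (bx i ik).
have h1 : 0 < lpn h + 1 by rewrite ltr_wpDl// lpn_ge0.
have e1 : 0 < e' / (lpn h + 1) by rewrite divr_gt0.
move=> /(_ _ e1); apply: (ultraS UU) => n /= hn.
rewrite /rank1 -scalerBl lpnZ.
apply: (@le_trans _ _ (e' / (lpn h + 1) * (lpn h + 1))); last by rewrite divfK// gt_eqF.
by apply: ler_pM => //; [exact: lpn_ge0|exact: ltW|rewrite lerDl].
Qed.

(* A finite-dimensional projection G onto the span of the x i, made of elements
   of Phi (x) X, together with the operator H = S o G, which is again near. *)
Lemma finite_projection q (Phi : set (nat -> T -> R)) (X : set (nat -> Lf)) S :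
  conjg p q -> (forall phi, Phi phi -> bdd P q phi) ->
  (forall (a : R) phi psi, Phi phi -> Phi psi -> Phi (fun n x => a * phi n x + psi n x)) ->
  usubspace p1 U X ->
  (forall F, X F -> (forall phi, Phi phi -> uval U phi F = 0) -> unull F) ->
  uop p1 U S ->
  (forall phi z, Phi phi -> X z -> near_op (rank1 phi (S z))) ->
  forall k (x : nat -> nat -> Lf), (forall i, (i < k)%N -> X (x i)) ->
  exists G H : (nat -> Lf) -> nat -> Lf, [/\ forall F, ubd F -> X (G F),
    forall F, ubd F -> ubd (H F) /\ unull (usub (S (G F)) (H F)),
    near_op H,
    forall F F', ubd F -> ubd F' ->
      (forall phi, Phi phi -> uval U phi F = uval U phi F') -> H F = H F' &
    (forall psi, Phi psi -> exists psi', Phi psi' /\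
      forall F, ubd F -> uval U psi (G F) = uval U psi' F) /\
    forall i, (i < k)%N -> unull (usub (x i) (G (x i)))].
Proof.
move=> pq bPhi lin uX sep uS nr; have [Xb X0 Xlin Xsat _] := uX.
have vlin := uval_lin UU pq.
have n0 : unull (fun=> 0).
  by apply: (unullI UU) => e e0; apply: (ultraW UU) => n /=; rewrite lpn0 ltW.
elim=> [|k IH] x Xx.
  exists (fun _ _ => 0), (fun _ _ => 0); split=> //.
  - move=> F bF; split; first exact: ubdd_cst.
    apply: (unull_le UU) (uop_unull uS (ubdd_cst 0) n0) => n.
    by rewrite /Defs.seq_sub subr0.
  - exact: near_op0.
  split=> // psi Pp; exists (fun n x => -1 * psi n x + psi n x); split; first exact: lin.
  move=> F bF; rewrite (uval_linl UU pq)//; try exact: bPhi.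
  by rewrite mulN1r addNr; apply: (uval_unull UU pq (bPhi _ Pp)) => //; exact: ubdd_cst.
have [G [H [GX HS nH Hext [Gfac Gx]]]] := IH x (fun i ik => Xx i (ltnW ik)).
have Xk := Xx k (ltnSn k); have bk := Xb _ Xk.
pose z := usub (x k) (G (x k)).
have Gb F : ubd F -> ubd (G F) by move=> /GX /Xb.
have Xz : X z.
  have := Xlin (-1) _ _ (GX _ bk) Xk; congr X.
  by apply/funext => n; rewrite /seq_add /seq_scale /z /Defs.seq_sub scaleN1r addrC.
have bz := Xb _ Xz.
have [nz|nz] := pselect (unull z).
  exists G, H; split=> //; split=> // i; rewrite ltnS leq_eqVlt => /predU1P[->//|]; exact: Gx.
have [phi0 [Pphi0 v0]] : exists phi, Phi phi /\ uval U phi z <> 0.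
  apply: contrapT => /forallNP h; apply: nz; apply: sep => // phi Pp.
  by apply: contrapT => v; apply: (h phi).
have v0' : uval U phi0 z != 0 by exact/eqP.
(* The functional is normalised to take the value 1 at [z]. [lin] only provides combinations a phi +
   psi, so the zero element is written as -1 * phi0 + phi0. *)
pose phi n (t : T) := (uval U phi0 z)^-1 * phi0 n t + (-1 * phi0 n t + phi0 n t).
have Pphi : Phi phi by exact: (lin _ _ _ Pphi0 (lin _ _ _ Pphi0 Pphi0)).
have v1 : uval U phi z = 1.
  have b0 := bPhi _ Pphi0; have b1 := bPhi _ (lin (-1) _ _ Pphi0 Pphi0).
  by rewrite (uval_linl UU pq)// (uval_linl UU pq)// mulN1r addNr addr0 mulVf.
have [psi [Ppsi Hpsi]] := Gfac _ Pphi.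
(* [psi] represents phi o G, so phi' = phi o (1 - G) vanishes at the earlier x i and equals 1 at x
   k. Adding phi' (x) z to G therefore corrects x k and leaves the others fixed. *)
pose phi' n (t : T) := -1 * psi n t + phi n t.
have Pphi' : Phi phi' by exact: lin.
have v' F : ubd F -> uval U phi' F = uval U phi (usub F (G F)).
  move=> bF; have b0 := bPhi _ Pphi; have b1 := bPhi _ Ppsi.
  rewrite (uval_linl UU pq)// (uvalB UU pq b0 bF (Gb F bF)) -Hpsi// mulN1r addrC//.
exists (fun F => uadd (usc (uval U phi' F) z) (G F)),
  (fun F n => H F n + rank1 phi' (S z) F n); split.
- by move=> F bF; apply: Xlin => //; exact: GX.
- move=> F bF; have [bH nHS] := HS F bF; have bSz := uop_ubd uS bz.
  split; first by apply: ubddD => //; exact: ubddZ.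
  have l1 := uop_lin uS (uval U phi' F) bz (Gb F bF).
  have l2 := unullD UU l1 nHS; move: l2; congr unull; apply/funext => n.
  by rewrite /rank1; lf_ring.
- by apply: near_opD => //; exact: nr.
- move=> F F' bF bF' e; rewrite (Hext F F' bF bF' e); apply/funext => n.
  by rewrite /rank1 e.
split=> [ps Pps|i].
  have [ps1 [Pps1 Hps1]] := Gfac _ Pps.
  exists (fun n t => uval U ps z * phi' n t + ps1 n t); split; first exact: lin.
  move=> F bF; have b0 := bPhi _ Pps; rewrite vlin//; last exact: Gb.
  by rewrite Hps1// (uval_linl UU pq) ?[uval _ ps z * _]mulrC//; exact: bPhi.
rewrite ltnS leq_eqVlt => /predU1P[->|ik].
  rewrite v'// -/z v1; apply: (unull_le UU) (unull_sub_refl UU z) => n.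
  rewrite /Defs.seq_sub /seq_add /seq_scale scale1r /z /Defs.seq_sub.
  by rewrite subrK !subrr.
have bi := Xb _ (Xx i (ltnW ik)).
rewrite v'// (uval_unull UU pq (bPhi _ Pphi)); [|exact: ubddB bi (Gb _ bi)|exact: Gx].
apply: (unull_le UU) (Gx i ik) => n.
by rewrite /Defs.seq_sub /seq_add /seq_scale scale0r add0r.
Qed.

End Operators.

(** * The abstract dichotomy: WOT closure and invariant subspaces *)

Section Dichotomy.
Context (R : realType) (p : R) (p1 : (1 <= p%:E)%E) (U : set (set nat)).
Hypothesis UU : is_ultrafilter U.
Notation Lf := (LfunType (mu01 R) p1).
Local Notation T := (measurableTypeR R).
Local Notation P := (P01 R).
Local Notation ubd := (ubounded p1).
Local Notation unull := (unull p1 U).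
Local Notation unorm := (unorm p1 U).
Local Notation usub := (Defs.seq_sub p1).
Local Notation uadd := (seq_add p1).
Local Notation usc := (seq_scale p1).
Local Notation lpn := (lpn p1).
Local Notation uLp := (uLp p1 U).
Local Notation uhat := (uhat p1 U).
Local Notation usum := (usum p1 U).
Local Notation uzero := (uzero p1 U).
Local Notation annih := (@annih R p p1 U).
Local Notation near_op := (near_op (p1 := p1) U).
Local Notation rank1 := (rank1 (p1 := p1) U).
Implicit Types (f g h : Lf) (F G : nat -> Lf).

Variable q : R.
Hypothesis pq : conjg p q.

Definition cst_functionals : set (nat -> T -> R) :=
  [set phi | exists u, mL P q u /\ phi = (fun=> u)].
Local Notation P0 := cst_functionals.

Definition hat_annih (Phi : set (nat -> T -> R)) := annih (P0 `|` Phi).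

(** [PM] separates the points of M and [PN] those of N, while M is defined as what [PN] kills and N
    as what [PM] kills. The hypotheses are asymmetric: functionals of N reach every target in the
    weakly null part, functionals of M only those in M, and [PN_op] forbids any T^U to lead from M
    to N. For p > 2 the pair (M, N) is (D, E), for p < 2 it is (E, D). *)
Variables PM PN : set (nat -> T -> R).
Local Notation spaceM := (hat_annih PN).
Local Notation spaceN := (hat_annih PM).

Hypothesis bPM : forall phi, PM phi -> bdd P q phi /\ wnull P U p phi.
Hypothesis bPN : forall phi, PN phi -> bdd P q phi /\ wnull P U p phi.
Hypothesis linM : forall (a : R) phi psi, PM phi -> PM psi -> PM (fun n x => a * phi n x + psi n x).
Hypothesis linN : forall (a : R) phi psi, PN phi -> PN psi -> PN (fun n x => a * phi n x + psi n x).
Hypothesis dec : forall F, ubd F -> exists f m n,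
  [/\ spaceM m, spaceN n & unull (usub F (uadd (fun=> f) (uadd m n)))].
Hypothesis sepM : forall F, spaceM F -> (forall phi, PM phi -> uval U phi F = 0) -> unull F.
Hypothesis sepN : forall F, spaceN F -> (forall phi, PN phi -> uval U phi F = 0) -> unull F.
Hypothesis nearM : forall phi y, PM phi -> spaceM y -> near_op (rank1 phi y).
Hypothesis nearN : forall phi y, PN phi -> uhat y -> near_op (rank1 phi y).
Hypothesis PN_op : forall S phi F, lp_op p1 S -> PN phi -> spaceM F ->
  uval U phi (Tult p1 S F) = 0.
Variables (f0 : Lf) (m0 n0 : nat -> Lf).
Hypothesis f0_nz : lpn f0 <> 0.
Hypothesis Mm0 : spaceM m0.
Hypothesis m0_nz : ~ unull m0.
Hypothesis Nn0 : spaceN n0.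
Hypothesis n0_nz : ~ unull n0.

Let bP0 phi : P0 phi -> bdd P q phi.
Proof. by move=> [u [Lu ->]]; exact: bdd_cst. Qed.
Let bPM' phi : PM phi -> bdd P q phi. Proof. by move=> /bPM[]. Qed.
Let bPN' phi : PN phi -> bdd P q phi. Proof. by move=> /bPN[]. Qed.
Let b0N phi : (P0 `|` PN) phi -> bdd P q phi.
Proof. by case=> [/bP0|/bPN']. Qed.
Let b0M phi : (P0 `|` PM) phi -> bdd P q phi.
Proof. by case=> [/bP0|/bPM']. Qed.
Let bMN phi : (PM `|` PN) phi -> bdd P q phi.
Proof. by case=> [/bPM'|/bPN']. Qed.

Lemma uhat_annih : uhat = annih P0.
Proof.
apply/seteqP; split=> F.
  move=> /(uhatP UU F pq)[bF wF]; split=> // phi [u [Lu ->]]; apply: (ulimE UU).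
  by apply: (ulim_to_eq UU) (wF u Lu); apply: (ultraW UU) => n /=; rewrite prC.
move=> [bF H]; apply/(uhatP UU F pq); split=> // u Lu.
have Pu : P0 (fun=> u) by exists u.
rewrite -(H _ Pu); apply: (ulim_to_eq UU) (uval_lim UU pq (bP0 Pu) bF).
by apply: (ultraW UU) => n /=; rewrite prC.
Qed.

Let usub_hat : usubspace p1 U uhat.
Proof. by rewrite uhat_annih; exact: (annih_usubspace p1 UU pq bP0). Qed.

Let usub_M : usubspace p1 U spaceM.
Proof. exact: (annih_usubspace p1 UU pq b0N). Qed.

Let usub_N : usubspace p1 U spaceN.
Proof. exact: (annih_usubspace p1 UU pq b0M). Qed.

Let M_hat F : spaceM F -> uhat F.
Proof. by rewrite uhat_annih => -[bF H]; split=> // phi Pp; apply: H; left. Qed.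

Let N_hat F : spaceN F -> uhat F.
Proof. by rewrite uhat_annih => -[bF H]; split=> // phi Pp; apply: H; left. Qed.

Let hat_M F : uhat F -> (forall phi, PN phi -> uval U phi F = 0) -> spaceM F.
Proof.
by rewrite uhat_annih => -[bF H] H'; split=> // phi [/H|/H'].
Qed.

Let kill_cst phi f : PM phi \/ PN phi -> uval U phi (fun=> f) = 0.
Proof.
move=> h; have [bp wp] : bdd P q phi /\ wnull P U p phi by case: h => [/bPM|/bPN].
by apply: (ulimE UU); apply: wp; exact: Lf_mL.
Qed.

Let uval_dec phi F f m n : bdd P q phi -> ubd F -> ubd m -> ubd n ->
  unull (usub F (uadd (fun=> f) (uadd m n))) ->
  uval U phi F = uval U phi (fun=> f) + (uval U phi m + uval U phi n).
Proof.
move=> bp bF bm bn nF; have bmn := ubddD bm bn; have bf := ubdd_cst f.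
by rewrite (uval_eq UU pq bp bF (ubddD bf bmn) nF) (uvalD UU pq bp bf bmn) (uvalD UU pq bp bm bn).
Qed.

Let MPN F phi : spaceM F -> PN phi -> uval U phi F = 0.
Proof. by move=> [_ H] Pp; apply: H; right. Qed.
Let NPM F phi : spaceN F -> PM phi -> uval U phi F = 0.
Proof. by move=> [_ H] Pp; apply: H; right. Qed.
Let MP0 F phi : spaceM F -> P0 phi -> uval U phi F = 0.
Proof. by move=> [_ H] Pp; apply: H; left. Qed.
Let NP0 F phi : spaceN F -> P0 phi -> uval U phi F = 0.
Proof. by move=> [_ H] Pp; apply: H; left. Qed.

(** Each family sees only its own component of a decomposition, so an element killed by both has
    null components in M and N by [sepM] and [sepN]. *)
Lemma uLp_annih : uLp = annih (PM `|` PN).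
Proof.
apply/seteqP; split=> F.
  move=> [bF [f nf]]; split=> // phi Pp.
  by rewrite (uval_eq UU pq (bMN Pp) bF (ubdd_cst f) nf) kill_cst.
move=> [bF H]; split=> //; have [f [m [n [Mm Nn nF]]]] := dec bF; exists f.
have [bm _] := Mm; have [bn _] := Nn.
have nm : unull m.
  apply: sepM => // phi Pp; have := uval_dec (bPM' Pp) bF bm bn nF.
  by rewrite H; [|by left]; rewrite kill_cst; [|by left]; rewrite (NPM Nn Pp) add0r addr0.
have nn : unull n.
  apply: sepN => // phi Pp; have := uval_dec (bPN' Pp) bF bm bn nF.
  by rewrite H; [|by right]; rewrite kill_cst; [|by right]; rewrite (MPN Mm Pp) !add0r.
have := unullD UU nF (unullD UU nm nn); congr unull; apply/funext => k.
by lf_ring.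
Qed.

Let usub_Lp : usubspace p1 U uLp.
Proof. by rewrite uLp_annih; exact: (annih_usubspace p1 UU pq bMN). Qed.

Lemma usum_LpM : usum uLp spaceM = annih PN.
Proof.
apply/seteqP; split=> F.
  move=> [bF [G [H [LG MH nF]]]]; split=> // phi Pp; have [bG _] := LG; have [bH _] := MH.
  rewrite (uval_eq UU pq (bPN' Pp) bF (ubddD bG bH) nF) (uvalD UU pq (bPN' Pp) bG bH).
  by rewrite (MPN MH Pp) addr0; move: LG; rewrite uLp_annih => -[_]; apply; right.
move=> [bF H]; split=> //; have [f [m [n [Mm Nn nF]]]] := dec bF.
have [bm _] := Mm; have [bn _] := Nn.
have nn : unull n.
  apply: sepN => // phi Pp; have := uval_dec (bPN' Pp) bF bm bn nF.
  by rewrite H// kill_cst; [|by right]; rewrite (MPN Mm Pp) !add0r.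
exists (fun=> f), m; split=> //.
  by split; [exact: ubdd_cst|exists f; exact: unull_sub_refl].
have := unullD UU nF nn; congr unull; apply/funext => k.
by lf_ring.
Qed.

Let cst_nz f : (forall phi, P0 phi -> uval U phi (fun=> f) = 0) -> lpn f = 0.
Proof.
move=> H; apply/eqP; rewrite eq_le lpn_ge0 andbT lpnE.
apply: (nrm_le_dual pq) => //; first exact: Lf_mL.
move=> u Lu; rewrite mul0r normr_le0; apply/eqP.
have Pu : P0 (fun=> u) by exists u.
have := H _ Pu; rewrite [uval _ _ _](ulimE UU (ulim_to_cst UU _)) => <-.
by rewrite -/(pr P (rawf f) u) prC.
Qed.

Lemma usum_MN : usum spaceM spaceN = uhat.
Proof.
apply/seteqP; split=> F.
  move=> [bF [G [H [MG NH nF]]]]; rewrite uhat_annih; split=> // phi Pp.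
  have [bG _] := MG; have [bH _] := NH.
  rewrite (uval_eq UU pq (bP0 Pp) bF (ubddD bG bH) nF) (uvalD UU pq (bP0 Pp) bG bH).
  by rewrite (MP0 MG Pp) (NP0 NH Pp) addr0.
rewrite uhat_annih => -[bF H]; split=> //; have [f [m [n [Mm Nn nF]]]] := dec bF.
have [bm _] := Mm; have [bn _] := Nn.
have lf0 : lpn f = 0.
  apply: cst_nz => phi Pp; have := uval_dec (bP0 Pp) bF bm bn nF.
  by rewrite H// (MP0 Mm Pp) (NP0 Nn Pp) !addr0.
have nf : unull (fun=> f).
  by apply: (unullI UU) => e e0; apply: (ultraW UU) => k /=; rewrite lf0 ltW.
exists m, n; split=> //; have := unullD UU nF nf; congr unull; apply/funext => k.
by lf_ring.
Qed.

Lemma capMN : spaceM `&` spaceN = uzero.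
Proof.
apply/seteqP; split=> F.
  move=> [MF NF]; split; first by case: MF.
  by apply: sepM => // phi Pp; exact: NPM.
move=> [bF nF]; split; split=> // phi Pp; apply: (uval_unull UU pq) => //;
  by [exact: b0N|exact: b0M].
Qed.

Let uLp_cst f : uLp (fun=> f).
Proof. by split; [exact: ubdd_cst|exists f; exact: unull_sub_refl]. Qed.

Let cst_unull f : unull (fun=> f) -> lpn f = 0.
Proof. by move=> nf; have := ulim_to_unique UU nf (ulim_to_cst UU (lpn f)). Qed.

Lemma Tult_uLp S F : lp_op p1 S -> uLp F -> uLp (Tult p1 S F).
Proof.
move=> lS [bF [f nf]]; split; first exact: lp_op_ubd.
exists (S f); have [C [C0 HC]] := lp_op_sub lS.
apply: (unull_le UU) (unullZ UU C nf) => n.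
by rewrite /Defs.seq_sub /seq_scale /Tult lpnZ (ger0_norm C0); exact: HC.
Qed.

Lemma Tult_uhat S F : lp_op p1 S -> uhat F -> uhat (Tult p1 S F).
Proof.
move=> lS /(uhatP UU F pq)[bF wF]; apply/(uhatP UU _ pq); split; first exact: lp_op_ubd.
have LF n : mL P p (raws F n) by exact: Lf_mL.
have h := adjoint_wnull UU pq (lp_op_lin_op pq lS) LF wF.
move=> u Lu; apply: (ulim_to_eq UU) (h u Lu); apply: (ultraW UU) => n /=.
by rewrite /raws /Tult mkLfK.
Qed.

Lemma Tult_M S F : lp_op p1 S -> spaceM F -> spaceM (Tult p1 S F).
Proof.
move=> lS MF; apply: hat_M; first by apply: Tult_uhat => //; exact: M_hat.
by move=> phi Pp; exact: PN_op.
Qed.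

(** One functional and one vector suffice: [uval U phi] vanishes at all T^U F, hence is arbitrarily
    small at S F. *)
Let wot_annih S Phi : (forall phi, Phi phi -> bdd P q phi) -> uop p1 U S ->
  wot_closure_ult p1 U S -> (forall A, lp_op p1 A -> uinvariant p1 (annih Phi) (Tult p1 A)) ->
  uinvariant p1 (annih Phi) S.
Proof.
move=> bPhi uS wS inv F AF; have [bF _] := AF; split; first exact: (uop_ubd uS).
move=> phi Pp; apply/eqP; rewrite -normr_le0; apply/ler_addgt0Pl => e e0; rewrite addr0.
have [|A [lA HA]] := wS 1%N (fun=> F) (fun=> uval U phi) e e0.
  by move=> i _; split=> //; apply: (ufunc_uval p1 UU pq); exact: bPhi.
have := HA 0%N isT; have [_ H] := inv A lA F AF.
by rewrite H// subr0 => /ltW.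
Qed.

Lemma wot_invariant S : uop p1 U S -> wot_closure_ult p1 U S ->
  [/\ uinvariant p1 uLp S, uinvariant p1 uhat S & uinvariant p1 spaceM S].
Proof.
move=> uS wS; split.
- rewrite uLp_annih; apply: (wot_annih bMN uS wS) => A lA F; rewrite -uLp_annih.
  exact: Tult_uLp.
- rewrite uhat_annih; apply: (wot_annih bP0 uS wS) => A lA F; rewrite -uhat_annih.
  exact: Tult_uhat.
- by apply: (wot_annih b0N uS wS) => A lA F; exact: Tult_M.
Qed.

Let uop3 S (f g h : nat -> Lf) : uop p1 U S -> ubd f -> ubd g -> ubd h ->
  unull (usub (S (uadd f (uadd g h))) (uadd (S f) (uadd (S g) (S h)))).
Proof.
have sc1 (F G : nat -> Lf) : uadd (usc 1 F) G = uadd F G.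
  by apply/funext => n; rewrite /seq_add /seq_scale scale1r.
move=> uS bf bg bh; have h1 := uop_lin uS 1 bf (ubddD bg bh).
have h2 := uop_lin uS 1 bg bh; rewrite !sc1 in h1 h2.
have := unullD UU h1 h2; congr unull; apply/funext => n; lf_ring.
Qed.

(* Each of the three components of the x i is reproduced by a finite-dimensional
   projection, and composing these with S gives a near operator. *)
Lemma density S k (x : nat -> nat -> Lf) (e : R) : uop p1 U S ->
  uinvariant p1 uLp S -> uinvariant p1 uhat S -> uinvariant p1 spaceM S ->
  0 < e -> (forall i, (i < k)%N -> ubd (x i)) ->
  exists A, lp_op p1 A /\ forall i, (i < k)%N ->
    U [set n | lpn (A (x i n) - S (x i) n) <= e].
Proof.
move=> uS iL ih iM e0 bx.
have /choice[f Hf] : forall i, exists f, (i < k)%N -> exists m n,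
    [/\ spaceM m, spaceN n & unull (usub (x i) (uadd (fun=> f) (uadd m n)))].
  move=> i; case: (ltnP i k) => [ik|_]; last by exists 0.
  by have [f h] := dec (bx i ik); exists f.
have /choice[m Hm] : forall i, exists m, (i < k)%N -> exists n,
    [/\ spaceM m, spaceN n & unull (usub (x i) (uadd (fun=> f i) (uadd m n)))].
  move=> i; case: (ltnP i k) => [ik|_]; last by exists m0.
  by have [m h] := Hf i ik; exists m.
have /choice[n Hn] : forall i, exists n, (i < k)%N ->
    [/\ spaceM (m i), spaceN n & unull (usub (x i) (uadd (fun=> f i) (uadd (m i) n)))].
  move=> i; case: (ltnP i k) => [ik|_]; last by exists m0.
  by have [n h] := Hm i ik; exists n.
have bm i : (i < k)%N -> ubd (m i) by move=> /Hn[[]].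
have bn i : (i < k)%N -> ubd (n i) by move=> /Hn[_ []].
have lin0 (a : R) phi psi : P0 phi -> P0 psi -> P0 (fun n x => a * phi n x + psi n x).
  move=> [u [Lu ->]] [v [Lv ->]]; exists (fun x => a * u x + v x); split=> //.
  by apply: mLD => //; [case: pq => _ /ltW|exact: mLZ].
have sep0 F : uLp F -> (forall phi, P0 phi -> uval U phi F = 0) -> unull F.
  move=> [bF [g ng]] H; have g0 : lpn g = 0.
    apply: cst_nz => phi Pp; rewrite -(uval_eq UU pq (bP0 Pp) bF (ubdd_cst g) ng); exact: H.
  have ng' : unull (fun=> g).
    by apply: (unullI UU) => e' e0'; apply: (ultraW UU) => j /=; rewrite g0 ltW.
  have := unullD UU ng ng'; congr unull; apply/funext => j.
  by lf_ring.
have [G0 [H0 [GX0 HS0 nH0 ext0 [_ G0x]]]] := finite_projection UU pq bP0 lin0 usub_Lp sep0 uS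
  (fun phi z (Pp : P0 phi) Lz => match Pp with ex_intro u (conj Lu e) =>
     eq_ind_r (fun phi => near_op (rank1 phi (S z))) (near_rank1_cst UU pq Lu (iL z Lz)) e end)
  (fun i (_ : (i < k)%N) => uLp_cst (f i)).
have [GM [HM [GXM HSM nHM extM [_ GMx]]]] := finite_projection UU pq bPM' linM usub_M sepM uS
  (fun phi z Pp Mz => nearM Pp (iM z Mz)) (fun i ik => let: And3 h _ _ := Hn i ik in h).
have [GN [HN [GXN HSN nHN extN [_ GNx]]]] := finite_projection UU pq bPN' linN usub_N sepN uS
  (fun phi z Pp Nz => nearN Pp (ih z (N_hat Nz))) (fun i ik => let: And3 _ h _ := Hn i ik in h).
have e2 : 0 < e / 2 by rewrite divr_gt0.
have [A [lA HA]] := near_opD UU nH0 (near_opD UU nHM nHN) e2 bx.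
exists A; split=> // i ik; have [Mm Nn nx] := Hn i ik.
have bi := bx i ik; have bmi := bm i ik; have bni := bn i ik; have bfi := ubdd_cst (f i).
have part (X : set (nat -> Lf)) (G H : (nat -> Lf) -> nat -> Lf) F : (forall F, ubd F -> ubd (G F)) ->
    (forall F, ubd F -> ubd (H F) /\ unull (usub (S (G F)) (H F))) -> ubd F ->
    unull (usub F (G F)) -> unull (usub (S F) (H F)).
  move=> bG HS bF nF; apply: (unull_sub_trans UU) (HS F bF).2.
  exact: (uop_sub UU uS bF (bG F bF) nF).
have bX (X : set (nat -> Lf)) (G : (nat -> Lf) -> nat -> Lf) : usubspace p1 U X ->
    (forall F, ubd F -> X (G F)) -> forall F, ubd F -> ubd (G F).
  by move=> [h _ _ _ _] GX F /GX /h.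
have n1 := part setT _ _ _ (bX _ _ usub_Lp GX0) HS0 bfi (G0x i ik).
have n2 := part setT _ _ _ (bX _ _ usub_M GXM) HSM bmi (GMx i ik).
have n3 := part setT _ _ _ (bX _ _ usub_N GXN) HSN bni (GNx i ik).
(* Each of the three operators depends on its argument only through its own family of functionals,
   which kills the other two components. Its value at x i is thus its value at one component. *)
have E0 : H0 (x i) = H0 (fun=> f i).
  apply: ext0 => // phi Pp; rewrite (uval_dec (bP0 Pp) bi bmi bni nx).
  by rewrite (MP0 Mm Pp) (NP0 Nn Pp) !addr0.
have EM : HM (x i) = HM (m i).
  apply: extM => // phi Pp; rewrite (uval_dec (bPM' Pp) bi bmi bni nx).
  by rewrite kill_cst; [|by left]; rewrite (NPM Nn Pp) add0r addr0.
have EN : HN (x i) = HN (n i).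
  apply: extN => // phi Pp; rewrite (uval_dec (bPN' Pp) bi bmi bni nx).
  by rewrite kill_cst; [|by right]; rewrite (MPN Mm Pp) !add0r.
have nS : unull (usub (S (x i)) (fun j => H0 (x i) j + (HM (x i) j + HN (x i) j))).
  rewrite E0 EM EN.
  have s1 := uop_sub UU uS bi (ubddD bfi (ubddD bmi bni)) nx.
  apply: (unull_sub_trans UU) s1 _; apply: (unull_sub_trans UU) (uop3 uS bfi bmi bni) _.
  have := unullD UU n1 (unullD UU n2 n3); congr unull; apply/funext => j.
  by lf_ring.
apply: (ultraS UU) (ultraI UU (HA i ik) (unull_near UU nS e2)) => j [/= a b].
apply: le_trans (lpn_triangle _ (H0 (x i) j + (HM (x i) j + HN (x i) j)) _) _.
by rewrite [e]splitr; apply: lerD => //; rewrite lpnBC.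
Qed.

Lemma invariant_wot S : uop p1 U S -> uinvariant p1 uLp S -> uinvariant p1 uhat S ->
  uinvariant p1 spaceM S -> wot_closure_ult p1 U S.
Proof.
move=> uS iL ih iM k x phi e e0 Hx.
have /choice[C HC] : forall i, exists C : R, (i < k)%N -> 0 <= C /\
    forall F, ubd F -> `|phi i F| <= C * unorm F.
  move=> i; case: (ltnP i k) => [ik|_]; last by exists 0.
  have [_ [_ [C HC]]] := Hx i ik; exists `|C| => _; split=> // F bF.
  by apply: le_trans (HC F bF) _; rewrite ler_wpM2r ?(unorm_ge0 UU)// ler_norm.
pose B := \sum_(0 <= i < k) `|C i|; have B0 : 0 <= B by exact: sumr_ge0.
have B1 : 0 < B + 1 by rewrite ltr_wpDl.
have e1 : 0 < e / 2 / (B + 1) by rewrite !divr_gt0.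
have [A [lA HA]] := density uS iL ih iM e1 (fun i ik => (Hx i ik).1).
exists A; split=> // i ik; have [bx [lphi _]] := Hx i ik; have [C0 HCi] := HC i ik.
have bT := lp_op_ubd lA bx; have bS := uop_ubd uS bx.
have -> : phi i (S (x i)) - phi i (Tult p1 A (x i)) = phi i (usub (S (x i)) (Tult p1 A (x i))).
  have := lphi (-1) _ _ bT bS; rewrite mulN1r addrC => <-; congr (phi i).
  by apply/funext => n; rewrite /seq_add /seq_scale scaleN1r addrC.
have bD := ubddB bS bT.
apply: le_lt_trans (HCi _ bD) _.
have un : unorm (usub (S (x i)) (Tult p1 A (x i))) <= e / 2 / (B + 1).
  apply: (unorm_le UU bD); apply: (ultraS UU) (HA i ik) => n /=.
  by rewrite /Defs.seq_sub lpnBC.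
apply: (@le_lt_trans _ _ ((B + 1) * (e / 2 / (B + 1)))).
  apply: ler_pM => //; first exact: (unorm_ge0 UU).
  apply: (@le_trans _ _ B); last by rewrite lerDl.
  apply: le_trans (ler_norm _) _; exact: (@ler_sum_term R k (fun i => `|C i|)).
rewrite mulrC divfK ?gt_eqF//; by rewrite ltr_pdivrMr// mulr_natr mulr2n ltrDl.
Qed.

Section Classification.
Variable Y : set (nat -> Lf).
Hypothesis uY : usubspace p1 U Y.
Hypothesis iY : forall S, lp_op p1 S -> uinvariant p1 Y (Tult p1 S).

Let near_mem (G : (nat -> Lf) -> nat -> Lf) F : near_op G -> Y F -> ubd (G F) -> Y (G F).
Proof.
move=> nG YF bG; have [Yb _ _ _ Ycl] := uY; have bF := Yb _ YF.
apply: Ycl => // e e0; have e2 : 0 < e / 2 by rewrite divr_gt0.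
have [S [lS HS]] := nG 1%N (fun=> F) _ e2 (fun _ _ => bF).
exists (Tult p1 S F); split; first exact: iY.
apply: (@le_lt_trans _ _ (e / 2)); last by rewrite ltr_pdivrMr// mulr_natr mulr2n ltrDl.
apply: (unorm_le UU); first by apply: ubddB => //; exact: lp_op_ubd.
by apply: (ultraS UU) (HS 0%N isT) => n /=; rewrite /Defs.seq_sub lpnBC.
Qed.

Let rank1_mem phi y F : near_op (rank1 phi y) -> Y F -> ubd y -> uval U phi F <> 0 -> Y y.
Proof.
move=> nr YF by' v; have [_ Y0 Ylin _ _] := uY.
have YG := near_mem nr YF (ubddZ (uval U phi F) by').
have := Ylin (uval U phi F)^-1 _ _ YG Y0; congr Y; apply/funext => n.
by rewrite /seq_add /seq_scale /rank1 scalerA mulVf ?scale1r ?addr0//; exact/eqP.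
Qed.

(** If some phi in [Phi] is nonzero at an F in Y, the approximable maps phi (x) y send F to a
    nonzero multiple of y, so Y contains every y in [X]. *)
Let alt (Phi X : set _) : (forall phi, Phi phi -> bdd P q phi) ->
  (forall phi y, Phi phi -> X y -> near_op (rank1 phi y)) -> X `<=` ubdd p1 ->
  Y `<=` annih Phi \/ X `<=` Y.
Proof.
move=> bPhi nX Xb; have [Yb _ _ _ _] := uY.
have [h|/existsNP[F /not_implyP[YF /not_andP[]]]] := pselect (forall F, Y F ->
    ubd F /\ forall phi, Phi phi -> uval U phi F = 0); first by left.
  by move=> /(_ (Yb _ YF)).
move=> /existsNP[phi /not_implyP[Pp v]]; right=> y Xy.
exact: (rank1_mem (nX _ _ Pp Xy) YF (Xb _ Xy) v).
Qed.

(** The alternative is applied to the constant functionals, to [PM] and to [PN]. A Y not killed by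
    [PN] contains the whole weakly null part, which makes the question for [PM] moot; so 4 + 2
    outcomes remain. *)
Lemma invariant_classification : [\/ Y = uzero, Y = ubdd p1, Y = uLp |
  Y = uhat \/ Y = spaceM \/ Y = usum uLp spaceM].
Proof.
have [Yb Y0 Ylin Ysat _] := uY.
have near0 phi y : P0 phi -> uLp y -> near_op (rank1 phi y).
  by move=> [u [Lu ->]]; exact: (near_rank1_cst UU pq Lu).
have A0 := alt bP0 near0 (fun F (h : uLp F) => h.1).
have AM := alt bPM' nearM (fun F (h : spaceM F) => h.1).
have AN := alt bPN' nearN (fun F (h : uhat F) => h.1).
have add F G : Y F -> Y G -> Y (uadd F G).
  move=> YF YG; have := Ylin 1 _ _ YF YG; congr Y.
  by apply/funext => n; rewrite /seq_add /seq_scale scale1r.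
case: AN => [YN|hY].
  case: AM => [YM|MY].
    have YL : Y `<=` uLp.
      move=> F YF; rewrite uLp_annih; split; first exact: Yb.
      by move=> phi [Pp|Pp]; [have [_] := YM F YF|have [_] := YN F YF]; exact.
    case: A0 => [Y0'|LY]; last first.
      by apply: Or43; apply/seteqP; split.
    apply: Or41; apply/seteqP; split=> F.
      move=> YF; split; first exact: Yb.
      have MF : spaceM F.
        split; first exact: Yb.
        by move=> phi [Pp|Pp]; [have [_] := Y0' F YF|have [_] := YN F YF]; exact.
      by apply: sepM => // phi Pp; have [_] := YM F YF; exact.
    move=> [bF nF]; apply: Ysat Y0 bF _; apply: (unull_le UU) nF => n.
    by rewrite /Defs.seq_sub sub0r lpnN.
  apply: Or44; right; case: A0 => [Y0'|LY].
    left; apply/seteqP; split=> // F YF; split; first exact: Yb.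
    by move=> phi [Pp|Pp]; [have [_] := Y0' F YF|have [_] := YN F YF]; exact.
  right; apply/seteqP; split; first by rewrite usum_LpM.
  move=> F [bF [G [H [LG MH nF]]]]; apply: Ysat (add _ _ (LY _ LG) (MY _ MH)) bF _.
  exact: (unull_sub_sym UU).
case: A0 => [Y0'|LY].
  by apply: Or44; left; apply/seteqP; split=> //; rewrite uhat_annih.
apply: Or42; apply/seteqP; split=> // F bF.
have [f [m [n [Mm Nn nF]]]] := dec bF.
apply: Ysat (add _ _ (LY _ (uLp_cst f)) (add _ _ (hY _ (M_hat Mm)) (hY _ (N_hat Nn)))) bF _.
exact: (unull_sub_sym UU).
Qed.

End Classification.

Let cst_not_hat : ~ uhat (fun=> f0).
Proof. by rewrite uhat_annih => -[_ /cst_nz]. Qed.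

Let not_uLp_m0 : ~ uLp m0.
Proof.
rewrite uLp_annih => -[_ H]; apply: m0_nz; apply: sepM => // phi Pp; apply: H; by left.
Qed.

Let not_annihPN_n0 : ~ annih PN n0.
Proof. by move=> [_ H]; apply: n0_nz; apply: sepN. Qed.

Let not_M_n0 : ~ spaceM n0.
Proof. by move=> [bn H]; apply: not_annihPN_n0; split=> // phi Pp; apply: H; right. Qed.

Lemma spaceM_property : M_property p1 U spaceM.
Proof.
split=> //.
  by exists spaceN; split=> //; [exact: usum_MN|exact: capMN].
move=> S uS; split; first exact: wot_invariant.
by move=> [iL ih iM]; exact: invariant_wot.
Qed.

Lemma Tult_wot S : lp_op p1 S -> wot_closure_ult p1 U (Tult p1 S).
Proof. by move=> lS k x phi e e0 _; exists S; split=> // i _; rewrite subrr normr0. Qed.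

(* A rank-one map from M to N leaves L^p and its complement invariant, but not M. *)
Lemma spaceM_unique M' : M_property p1 U M' -> M' = spaceM.
Proof.
move=> [uM' hM' _ wM'].
have inv S : lp_op p1 S -> uinvariant p1 M' (Tult p1 S).
  by move=> lS; have [] := (wM' _ (Tult_uop UU lS)).1 (Tult_wot lS).
have [phi [Pphi v]] : exists phi, PM phi /\ uval U phi m0 <> 0.
  apply: contrapT => /forallNP h; apply: m0_nz; apply: sepM => // phi Pp.
  by apply: contrapT => v; apply: (h phi).
have bp := bPM' Pphi; have [bn _] := Nn0.
have uS : uop p1 U (rank1 phi n0).
  split=> [F bF|a F G bF bG|]; first exact: ubddZ.
    rewrite (_ : usub _ _ = usub n0 n0); first exact: unull_sub_refl.
    apply/funext => k; rewrite /Defs.seq_sub /seq_add /seq_scale /rank1 subrr.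
    by rewrite (uval_lin UU pq)// scalerDl scalerA subrr.
  have [C [C0 HC]] := uval_bound p1 UU pq bp; exists (C * unorm n0) => F bF.
  have -> : unorm (rank1 phi n0 F) = `|uval U phi F| * unorm n0.
    apply: (ulimE UU); apply: (ulim_to_eq UU) (ulim_toZ UU `|uval U phi F| (unorm_lim UU bn)).
    by apply: (ultraW UU) => k /=; rewrite /rank1 lpnZ.
  rewrite mulrAC; apply: ler_wpM2r; [exact: unorm_ge0|exact: HC].
have [_ h0 hlin _ _] := usub_hat; have [_ L0 _ Lsat _] := usub_Lp.
have scale_n F : uhat (rank1 phi n0 F).
  have := hlin (uval U phi F) _ _ (N_hat Nn0) h0; congr uhat.
  by apply/funext => k; rewrite /seq_add /seq_scale addr0.
have iL : uinvariant p1 uLp (rank1 phi n0).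
  move=> F; rewrite {1}uLp_annih => -[bF H].
  have -> : rank1 phi n0 F = (fun=> 0); last exact: L0.
  by apply/funext => k; rewrite /rank1 H ?scale0r//; left.
have niM : ~ uinvariant p1 spaceM (rank1 phi n0).
  move=> /(_ _ Mm0) h; apply: not_M_n0; have [_ M0 Mlin _ _] := usub_M.
  have := Mlin (uval U phi m0)^-1 _ _ h M0; congr spaceM; apply/funext => k.
  by rewrite /seq_add /seq_scale /rank1 scalerA mulVf ?scale1r ?addr0//; exact/eqP.
have nw : ~ wot_closure_ult p1 U (rank1 phi n0).
  by move=> /(wot_invariant uS)[_ _].
have notinv : ~ uinvariant p1 M' (rank1 phi n0).
  by move=> h; apply: nw; apply/(wM' _ uS); split=> // F _.
(* The zero space and the weakly null part are invariant under the rank-one map, against [notinv].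
   The whole space, L^p and L^p + M contain the nonzero constant class of [f0], against M' being
   inside the weakly null part. *)
case: (invariant_classification uM' inv) => [e|e|e|[e|[//|e]]].
- exfalso; apply: notinv; rewrite e => F [bF nF]; split; first exact: ubddZ.
  rewrite (_ : rank1 phi n0 F = fun=> 0); last first.
    by apply/funext => k; rewrite /rank1 (uval_unull UU pq bp bF nF) scale0r.
  by apply: (unullI UU) => e' e0'; apply: (ultraW UU) => k /=; rewrite lpn0 ltW.
- by exfalso; apply: cst_not_hat; apply: hM'; rewrite e; exact: ubdd_cst.
- by exfalso; apply: cst_not_hat; apply: hM'; rewrite e; exact: uLp_cst.
- by exfalso; apply: notinv; rewrite e => F _; exact: scale_n.
- exfalso; apply: cst_not_hat; apply: hM'; rewrite e usum_LpM; split; first exact: ubdd_cst.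
  by move=> psi Pp; apply: kill_cst; right.
Qed.

Definition four_invariant_subspaces M := M_property p1 U M /\
  (forall M', M_property p1 U M' -> M' = M) /\
  (forall Y, Y = uLp \/ Y = uhat \/ Y = M \/ Y = usum uLp M ->
     [/\ usubspace p1 U Y, Y <> uzero & Y <> ubdd p1]) /\
  [/\ uLp <> uhat, uLp <> M, uLp <> usum uLp M,
      uhat <> M & uhat <> usum uLp M] /\
  M <> usum uLp M /\
  (forall Y, usubspace p1 U Y -> Y <> uzero -> Y <> ubdd p1 ->
     ((forall S, lp_op p1 S -> uinvariant p1 Y (Tult p1 S)) <->
      (Y = uLp \/ Y = uhat \/ Y = M \/ Y = usum uLp M))).

Lemma dichotomy : four_invariant_subspaces spaceM.
Proof.
have Lf0 := uLp_cst f0.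
have sLf0 : annih PN (fun=> f0).
  by split; [exact: ubdd_cst|move=> phi Pp; apply: kill_cst; right].
have sm0 : annih PN m0 by split; [case: Mm0|move=> phi Pp; exact: MPN].
have hm0 := M_hat Mm0; have hn0 := N_hat Nn0.
have bf0 : ubdd p1 (fun=> f0) := ubdd_cst f0.
have bm0 : ubdd p1 m0 := Mm0.1.
have bn0 : ubdd p1 n0 := Nn0.1.
have zf0 : ~ uzero (fun=> f0) by move=> [_ /cst_unull].
have zm0 : ~ uzero m0 by case.
have nMf0 : ~ spaceM (fun=> f0) by move=> /M_hat.
split; first exact: spaceM_property.
split; first exact: spaceM_unique.
split; first move=> Y [->|[->|[->|->]]].
- split=> //; first by move=> e; move: Lf0; rewrite e.
  by move=> e; apply: not_uLp_m0; rewrite e.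
- split=> //; first by move=> e; move: hm0; rewrite e.
  by move=> e; apply: cst_not_hat; rewrite e.
- split=> //; first by move=> e; move: Mm0; rewrite e.
  by move=> e; apply: nMf0; rewrite e.
- rewrite usum_LpM; split; first exact: (annih_usubspace p1 UU pq bPN').
    by move=> e; move: sLf0; rewrite e.
  by move=> e; apply: not_annihPN_n0; rewrite e.
split; first split.
- by move=> e; apply: cst_not_hat; rewrite -e.
- by move=> e; apply: nMf0; rewrite -e.
- by rewrite usum_LpM => e; apply: not_uLp_m0; rewrite e.
- by move=> e; apply: not_M_n0; rewrite -e.
- by rewrite usum_LpM => e; apply: cst_not_hat; rewrite e.
split; first by rewrite usum_LpM => e; apply: nMf0; rewrite e.
move=> Y uY Yz Yb; split.
  by move=> inv; case: (invariant_classification uY inv) => [//|//|->|[->|[->|->]]]; tauto.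
move=> [->|[->|[->|->]]] S lS F.
- exact: Tult_uLp.
- exact: Tult_uhat.
- exact: Tult_M.
move=> [bF [G [H [LG MH nF]]]]; split; first exact: lp_op_ubd.
exists (Tult p1 S G), (Tult p1 S H); split; [exact: Tult_uLp|exact: Tult_M|].
have uS := Tult_uop UU lS; have bG := LG.1; have bH := MH.1.
apply: (unull_sub_trans UU) (uop_sub UU uS bF (ubddD bG bH) nF) _.
have := uop_lin uS 1 bG bH; congr unull; apply/funext => k.
by rewrite /Defs.seq_sub /Tult /seq_add /seq_scale !scale1r.
Qed.

End Dichotomy.

(** * The spaces D and E and their functionals *)

Section Instances.
Context (R : realType) (p : R) (p1 : (1 <= p%:E)%E) (U : set (set nat)).
Hypothesis UU : is_ultrafilter U.
Hypothesis UN : nonprincipal U.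
Hypothesis US : selective U.
Notation Lf := (LfunType (mu01 R) p1).
Local Notation T := (measurableTypeR R).
Local Notation P := (P01 R).
Local Notation unull := (unull p1 U).
Local Notation usub := (Defs.seq_sub p1).
Local Notation uadd := (seq_add p1).
Local Notation lpn := (lpn p1).
Implicit Types (F y : nat -> Lf) (phi psi : nat -> T -> R).
Variable q : R.
Hypothesis pq : conjg p q.
Let qp : conjg q p := conjg_sym pq.
Let p_gt1 : 1 < p. Proof. by case: pq. Qed.
Let q_gt1 : 1 < q. Proof. by case: pq. Qed.
Let p_ge1' : 1 <= p := ltW p_gt1.
Let q_ge1 : 1 <= q := ltW q_gt1.
Let p_gt0' : 0 < p. Proof. exact: lt_trans p_gt1. Qed.
Let q_gt0 : 0 < q. Proof. exact: lt_trans q_gt1. Qed.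

(** [PhiD] are the functionals on D, [PhiE] those on E. Uniformly bounded sequences suffice for
    [PhiE], since the truncations of [EI_separated] are of this kind. *)
Definition PhiD : set (nat -> T -> R) := [set phi | bdd P q phi /\ nullr P U 1 phi].
Definition PhiE : set (nat -> T -> R) := [set phi | ubd phi /\ wnull P U p phi].
Local Notation spaceD := (@hat_annih R p p1 U q PhiE).
Local Notation spaceE := (@hat_annih R p p1 U q PhiD).

Lemma bPhiD phi : PhiD phi -> bdd P q phi /\ wnull P U p phi.
Proof. by move=> [bp np]; split=> //; exact: (null1_wnull UU qp bp np). Qed.

Lemma bPhiE phi : PhiE phi -> bdd P q phi /\ wnull P U p phi.
Proof. by move=> [up wp]; split=> //; exact: ubd_bdd. Qed.

Lemma linPhiD (a : R) phi psi : PhiD phi -> PhiD psi ->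
  PhiD (fun n x => a * phi n x + psi n x).
Proof.
move=> [bp np] [bs ns]; have bap := bddZ a q_ge1 bp.
split; first exact: (bddD q_ge1 bap bs).
apply: (nullrD UU (lexx 1) (bdd1 q_ge1 bap) (bdd1 q_ge1 bs)) => //.
have := ulim_toZ UU `|a| np; rewrite mulr0; apply: (ulim_to_eq UU).
by apply: (ultraW UU) => n /=; rewrite nrmZ//; case: (bdd1 q_ge1 bp).
Qed.

Lemma linPhiE (a : R) phi psi : PhiE phi -> PhiE psi ->
  PhiE (fun n x => a * phi n x + psi n x).
Proof.
move=> Pp Ps; have [[mp [K [K0 pK]]] wp] := Pp; have [[ms [L [L0 sL]]] ws] := Ps.
have [[Lp _] _] := bPhiE Pp; have [[Ls _] _] := bPhiE Ps.
split.
  split=> [n|]; first by apply: measurable_funD => //; exact: measurable_scale.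
  exists (`|a| * K + L); split=> [|n x]; first by rewrite addr_ge0// mulr_ge0.
  by apply: le_trans (ler_normD _ _) _; apply: lerD => //; rewrite normrM ler_wpM2l.
move=> u Lu; have := ulim_toD UU (ulim_toZ UU a (wp u Lu)) (ws u Lu); rewrite mulr0 addr0.
by apply: (ulim_to_eq UU); apply: (ultraW UU) => n /=; rewrite (pr_linl _ qp).
Qed.

Let uval0 phi F : bdd P q phi -> ubounded p1 F -> uval U phi F = 0 ->
  ulim_to U (fun n => pr P (phi n) (raws F n)) 0.
Proof. by move=> bp bF <-; exact: (uval_lim UU pq bp bF). Qed.

Let P0_wnull F : ubounded p1 F -> (forall phi, cst_functionals q phi -> uval U phi F = 0) ->
  wnull P U q (raws F).
Proof.
move=> bF H; have : uhat p1 U F by rewrite (uhat_annih p1 UU pq).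
by move=> /(uhatP UU F pq)[].
Qed.

Let wnull_P0 F phi : ubounded p1 F -> wnull P U q (raws F) -> cst_functionals q phi ->
  uval U phi F = 0.
Proof.
move=> bF wF; have : uhat p1 U F by apply/(uhatP UU F pq).
by rewrite (uhat_annih p1 UU pq) => -[_]; exact.
Qed.

Lemma spaceDP F : spaceD F <-> ubounded p1 F /\ nullr P U 1 (raws F).
Proof.
split=> [[bF H]|[bF nF]]; split=> //.
  have wF := P0_wnull bF (fun phi Pp => H phi (or_introl Pp)).
  apply: (null1_killing UU UN pq _ wF); first exact/ubddP.
  move=> phi up wp; have Pp : PhiE phi by [].
  by apply: uval0 => //; [case: (bPhiE Pp)|apply: H; right].
have bF' : bdd P p (raws F) by apply/ubddP.
move=> phi [Pp|[up wp]]; first exact: wnull_P0 (null1_wnull UU pq bF' nF) Pp.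
by apply: (ulimE UU); exact: (null1_killed UU p_ge1' bF' nF up).
Qed.

Lemma spaceEP F : spaceE F <-> [/\ ubounded p1 F, EI P U p (raws F) & wnull P U q (raws F)].
Proof.
split=> [[bF H]|[bF EF wF]].
  split=> //; last exact: P0_wnull bF (fun phi Pp => H phi (or_introl Pp)).
  apply: (EI_killing UU UN pq); first exact/ubddP.
  by move=> phi bp np; apply: uval0 => //; apply: H; right.
split=> // phi [Pp|[bp np]]; first exact: wnull_P0 wF Pp.
by apply: (ulimE UU); exact: (EI_killed UU pq EF bp np).
Qed.

(** The component in L^p is the weak limit [w] of the truncated part; what truncation removes is in
    D, and the truncated part minus [w] is in E. *)
Lemma decDE F : ubounded p1 F -> exists f m n,
  [/\ spaceD m, spaceE n & unull (usub F (uadd (fun=> f) (uadd m n)))].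
Proof.
move=> bF; have bF' : bdd P p (raws F) by apply/ubddP.
have [l [EE nD]] := split_null1_EI UU UN p_gt1 bF'.
set E0 := (fun n x => trunc (l n)%:R (raws F n x)) in EE nD.
have [bE _] := EE; have [LE _] := bE.
have [w wE] := wlim_ex UU pq bE; have [Lw _] := wE.
have bD := bddB p_ge1' bF' bE; have [LD _] := bD.
have bEw := bddB p_ge1' bE (bdd_cst Lw); have [LEw _] := bEw.
pose m n : Lf := mkLf p1 (fun x => raws F n x - E0 n x).
pose e n : Lf := mkLf p1 (fun x => E0 n x - w x).
have mE : raws m = (fun n x => raws F n x - E0 n x).
  by apply/funext => n; exact: mkLfE.
have eE : raws e = (fun n x => E0 n x - w x).
  by apply/funext => n; exact: mkLfE.
have bm : ubounded p1 m by apply/ubddP; rewrite mE.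
have be : ubounded p1 e by apply/ubddP; rewrite eE.
exists (mkLf p1 w), m, e; split.
- by apply/spaceDP; split=> //; rewrite mE.
- split=> // phi [Pp|[bp np]].
    by apply: wnull_P0 => //; rewrite eE; exact: wnull_sub_wlim wE.
  apply: (ulimE UU); have [_ wp] := bPhiD (conj bp np).
  have := ulim_toB UU (EI_killed UU pq EE bp np) (wp w Lw); rewrite subr0.
  apply: (ulim_to_eq UU); apply: (ultraW UU) => n /=.
  by rewrite -/(raws e n) eE (prBr qp)//; case: bp.
apply: (unull_le UU) (unull_sub_refl UU F) => n.
have -> : usub F (uadd (fun=> mkLf p1 w) (uadd m e)) n = usub F F n; last by [].
rewrite /Defs.seq_sub; congr (_ - _); apply: rawf_inj; rewrite /seq_add !rawfD.
rewrite -/(raws m n) -/(raws e n) mE eE mkLfE//; apply/funext => x.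
by rewrite addrA addrAC subrKC subrKC.
Qed.

Lemma sepD F : spaceD F -> (forall phi, PhiD phi -> uval U phi F = 0) -> unull F.
Proof.
move=> /spaceDP[bF nF] H; apply/unullP.
have bF' : bdd P p (raws F) by apply/ubddP.
by apply: (null1_separated UU pq bF' nF) => phi bp np; apply: uval0 => //; exact: H.
Qed.

Lemma sepE F : spaceE F -> (forall phi, PhiE phi -> uval U phi F = 0) -> unull F.
Proof.
move=> /spaceEP[bF EF wF] H; apply/unullP.
apply: (EI_separated UU pq EF wF) => phi up wp; have Pp : PhiE phi by [].
by apply: uval0 => //; [case: (bPhiE Pp)|exact: H].
Qed.

(** A functional must be represented exactly by a sequence with an upper s-estimate, whereas a
    target in [tgt] is only approximated in norm: elements of E have uniformly bounded approximants
    only up to e, and [near_rank1_approx] tolerates this. *)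
Definition src s phi := exists psi, [/\ bdd P q psi, wnull P U p psi,
  eventual_est P U q s psi & forall F, ubounded p1 F -> uval U phi F = uval U psi F].

Definition tgt t y := forall e : R, 0 < e -> exists y', [/\ ubounded p1 y',
  wnull P U q (raws y'), eventual_est P U p t (raws y') & U [set n | lpn (y' n - y n) <= e]].

Lemma srcD phi : PhiD phi -> src q phi.
Proof.
move=> [bp np]; have [psi [bs ns Bs ds]] := null1_bounded_approx UU UN q_gt1 bp np.
have [A EA] := upper_est_null1 UU US q_gt1 bs ns Bs.
have ws := null1_wnull UU qp bs ns.
exists psi; split=> //; first by exists A.
move=> F bF; apply/eqP; rewrite -subr_eq0; apply/eqP.
have bd := bddB q_ge1 bp bs.
have bF' : bdd P p (raws F) by apply/ubddP.
apply: (ulim_to_unique UU (ulim_toB UU (uval_lim UU pq bp bF) (uval_lim UU pq bs bF))).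
have := pr_nullr_killed UU qp bd ds bF'.
apply: (ulim_to_eq UU); apply: (ultraW UU) => n /=.
by rewrite prC (prBl qp)//; [case: bp|case: bs|exact: Lf_mL].
Qed.

Lemma srcE phi : PhiE phi -> src 2 phi.
Proof.
move=> Pp; have [up wp] := Pp; have [bp _] := bPhiE Pp.
have wb (g : T -> R) (K : R) : measurable_fun setT g -> (forall x, `|g x| <= K) ->
    ulim_to U (fun n => pr P (phi n) g) 0.
  by move=> mg gK; apply: wp; exact: (mL_bounded P (ltW p_gt0') mg gK).
have [A [UA EA]] := upper_est_ubd UU US up wb.
by exists phi; split=> //; exists A; split=> //; exact: EA.
Qed.

Lemma tgtD y : spaceD y -> tgt p y.
Proof.
move=> /spaceDP[by' ny] e e0; have by'' : bdd P p (raws y) by apply/ubddP.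
have [G [bG nG BG dG]] := null1_bounded_approx UU UN p_gt1 by'' ny.
have [A EA] := upper_est_null1 UU US p_gt1 bG nG BG.
have [LG _] := bG; pose y' n : Lf := mkLf p1 (G n).
have yE : raws y' = G by apply/funext => n; exact: mkLfE.
exists y'; split; rewrite ?yE.
- by apply/ubddP; rewrite yE.
- exact: (null1_wnull UU pq bG nG).
- by exists A.
apply: (ultraS UU) (dG _ e0) => n /=; rewrite subr0 ger0_norm ?nrm_ge0// => h.
by apply: ltW; rewrite lpnBC lpnE rawfB -/(raws y' n) yE.
Qed.

Lemma tgtE y : spaceE y -> tgt 2 y.
Proof.
move=> /spaceEP[by' Ey wy] e e0.
have [G [uG wG dG]] := EI_ubd_approx UU pq Ey wy e0.
have bG := ubd_bdd P p_gt0' uG; have [LG _] := bG.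
have wb (g : T -> R) (K : R) : measurable_fun setT g -> (forall x, `|g x| <= K) ->
    ulim_to U (fun n => pr P (G n) g) 0.
  by move=> mg gK; apply: wG; exact: (mL_bounded P (ltW q_gt0) mg gK).
have [A [UA EA]] := upper_est_ubd UU US uG wb.
pose y' n : Lf := mkLf p1 (G n).
have yE : raws y' = G by apply/funext => n; exact: mkLfE.
exists y'; split; rewrite ?yE//.
- by apply/ubddP; rewrite yE.
- by exists A; split=> //; exact: EA.
by apply: (ultraS UU) dG => n /= h; rewrite lpnBC lpnE rawfB -/(raws y' n) yE.
Qed.

Lemma near_src_tgt s s' t phi y : conjg s s' -> s' <= t -> src s phi -> tgt t y ->
  near_op U (rank1 U phi y).
Proof.
move=> ss st [psi [bs ws Es Hs]] Hy.
apply: (near_op_ext (H := rank1 U psi y)).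
  by move=> F bF; apply/funext => n; rewrite /rank1 Hs.
apply: (near_rank1_approx UU) => e e0; have [y' [by' wy Ey dy]] := Hy e e0.
exists y'; split=> // k x e' e0' bx.
have e2 : 0 < e' / 2 by rewrite divr_gt0.
have by'' : bdd P p (raws y') by apply/ubddP.
have /choice[h Hh] : forall i, exists h : T -> R, (i < k)%N -> [/\ mL P p h,
    bdd P p (raws (x i)) & wnull P U q (fun n z => raws (x i) n z - h z)].
  move=> i; case: (ltnP i k) => [ik|_]; last by exists (fun=> 0).
  have bi : bdd P p (raws (x i)) by apply/ubddP; exact: bx.
  have [h hh] := wlim_ex UU pq bi; exists h => _; have [Lh _] := hh.
  by split=> //; exact: (wnull_sub_wlim UU pq bi hh).
have [S [lS HS]] := rank_one_approx UU UN US (x := fun i => raws (x i)) pq ss st bs ws Es by'' Ey Hh e2.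
exists (fun f => mkLf p1 (S (rawf f))); split; first exact: (lin_op_lp_op p1 pq lS).
move=> i ik; have [C HC] := by'.
have C1 : 0 < `|C| + 1 by rewrite ltr_wpDl.
have e3 : 0 < e' / 2 / (`|C| + 1) by rewrite divr_gt0.
have lim := uval_lim UU pq bs (bx i ik) e3.
apply: (ultraS UU) (ultraI UU HS lim) => n [/= hn ln].
have LSn : mL P p (S (rawf (x i n))) by case: lS => h1 _ _; apply: h1; exact: Lf_mL.
apply: le_trans (lpn_triangle _ (pr P (psi n) (rawf (x i n)) *: y' n) _) _.
rewrite [e']splitr; apply: lerD.
  rewrite lpnE rawfB rawfZ mkLfE//; exact: hn.
rewrite /rank1 -scalerBl lpnZ.
apply: (@le_trans _ _ (e' / 2 / (`|C| + 1) * (`|C| + 1))); last by rewrite divfK// gt_eqF.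
apply: ler_pM => //; [exact: lpn_ge0|exact: ltW|].
by apply: le_trans (HC n) _; apply: le_trans (ler_norm _) _; rewrite lerDl.
Qed.

Lemma op_src_tgt s t phi F S : 0 < s -> 0 < t -> s^-1 + t^-1 < 1 -> lp_op p1 S ->
  src s phi -> ubounded p1 F -> tgt t F -> uval U phi (Tult p1 S F) = 0.
Proof.
move=> s0 t0 st lS [psi [bs ws Es Hs]] bF HF.
have bSF := lp_op_ubd lS bF; rewrite Hs//.
have [C [C0 HC]] := uval_bound p1 UU pq bs.
have [D [D0 HD]] := lp_op_sub lS.
apply/eqP; rewrite -normr_le0; apply/ler_addgt0Pl => e e0; rewrite addr0.
have CD : 0 < C * D + 1 by rewrite ltr_wpDl// mulr_ge0.
have e1 : 0 < e / (C * D + 1) by rewrite divr_gt0.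
have [G [bG wG EG dG]] := HF _ e1.
have bG' : bdd P p (raws G) by apply/ubddP.
have bSG := lp_op_ubd lS bG.
have uG : uval U psi (Tult p1 S G) = 0.
  apply: (ulimE UU); have := obstruction UU UN US pq (lp_op_lin_op pq lS) bs ws Es bG' wG EG s0 t0 st.
  by apply: (ulim_to_eq UU); apply: (ultraW UU) => n /=; rewrite /raws mkLfK.
have bd := ubddB bSF bSG.
have -> : uval U psi (Tult p1 S F) = uval U psi (usub (Tult p1 S F) (Tult p1 S G)).
  by rewrite (uvalB UU pq bs bSF bSG) uG subr0.
apply: le_trans (HC _ bd) _.
apply: (@le_trans _ _ (C * (D * (e / (C * D + 1))))).
  apply: ler_wpM2l => //; apply: (unorm_le UU bd); apply: (ultraS UU) dG => n /= h.
  by apply: le_trans (HD _ _) _; rewrite lpnBC; apply: ler_wpM2l.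
by rewrite !mulrA ler_pdivrMr// mulrC ler_wpM2l ?(ltW e0)// lerDl.
Qed.

(** The target splits into a part in D with t = p and a part in E with t = 2, so s' has to lie below
    both. *)
Lemma near_hat s s' phi y : conjg s s' -> s' <= p -> s' <= 2 -> src s phi -> uhat p1 U y ->
  near_op U (rank1 U phi y).
Proof.
move=> ss sp s2 sphi; rewrite -(usum_MN UU pq decDE) => -[by' [m [n [Dm En ny]]]].
apply: (near_rank1_approx UU) => e e0; exists (uadd m n); split; last first.
  by apply: (ultraS UU) (unull_near UU ny e0) => k /=; rewrite /Defs.seq_sub lpnBC.
apply: (near_rank1D UU); first exact: (near_src_tgt ss sp sphi (tgtD Dm)).
exact: (near_src_tgt ss s2 sphi (tgtE En)).
Qed.

End Instances.

(** * Cosine waves and normalised spikes *)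

Section Witnesses.
Context (R : realType).
Local Notation T := (measurableTypeR R).
Local Notation P := (P01 R).
Local Notation mu := (@lebesgue_measure R).

Lemma mean_P01 (f : T -> R) : itg P f ->
  mean P f = fine (\int[mu]_(x in `[0%R, 1%R]) (f x)%:E)%E.
Proof.
move=> itf; rewrite meanE /Rintegral; congr fine.
have m01 := @measurable_01 R.
have N0 : P (~` `[0%R, 1%R]) = 0%E.
  by rewrite -(measure0 mu); congr (mu _); exact: setICl.
rewrite (negligible_integral (measurableC m01) measurableT itf N0).
rewrite setDE setCK setTI; apply: eq_measure_integral => A mA A01.
by congr (mu _); rewrite setIidl.
Qed.

Definition wave (k : nat) (x : T) : R := cos (pi *+ 2 *+ k * x).

Lemma wave_le1 k x : `|wave k x| <= 1.
Proof. by rewrite ler_norml cos_geN1 cos_le1. Qed.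

Lemma continuous_wave k : continuous (wave k : R -> R).
Proof.
move=> x; apply: (@continuous_comp _ _ _ (fun y : R => pi *+ 2 *+ k * y) (@cos R)).
  exact: mulrl_continuous.
exact: continuous_cos.
Qed.

Lemma measurable_wave k : measurable_fun setT (wave k).
Proof. exact: continuous_measurable_fun (@continuous_wave k). Qed.

Lemma itg_wave k : itg P (wave k).
Proof. exact: itg_bounded (measurable_wave k) (wave_le1 k). Qed.

Lemma mean_wave k : (0 < k)%N -> mean P (wave k) = 0.
Proof.
move=> k0; rewrite (mean_P01 (itg_wave k)).
set w : R := pi *+ 2 *+ k.
have w0 : w != 0.
  have p2 : 0 < pi *+ 2 :> R by rewrite mulr2n addr_gt0 ?pi_gt0.
  by rewrite gt_eqF// /w -mulr_natr mulr_gt0 ?ltr0n.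
pose S (x : R) := w^-1 * sin (w * x).
have dS (x : R) : is_derive x (1 : R) S (cos (w * x)).
  apply: is_derive_eq; rewrite /GRing.scale /= !mulr1.
  by rewrite mulrCA mulVf// mulr1.
have cS : continuous S.
  move=> x; apply/differentiable_continuous/derivable1_diffP.
  by case: (dS x).
rewrite (@continuous_FTC2 _ (wave k) S 0 1)//.
- rewrite /S mulr1 mulr0 sin0 mulr0 -EFinB subr0 /=.
  by rewrite -[X in sin X]add0r (periodicn (@sinD2pi R)) sin0 mulr0.
- exact/continuous_subspaceT/continuous_wave.
- split=> [x _||]; first by case: (dS x).
  + exact/cvg_at_right_filter/cS.
  + exact/cvg_at_left_filter/cS.
- by move=> x _; rewrite derive1E; case: (dS x).
Qed.

Lemma wave_sub_sqr m n x : (m <= n)%N -> (wave n x - wave m x) ^+ 2 =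
  1 + (2^-1 * wave (n + n) x + 2^-1 * wave (m + m) x) - (wave (n + m) x + wave (n - m) x).
Proof.
move=> mn; rewrite /wave mulrnBr// !mulrnDr mulrBl !mulrDl cosB !cosD.
set a := cos _; set b := cos _; set sa := sin _; set sb := sin _.
have ha : sa * sa = 1 - a * a.
  have := cos2Dsin2 (pi *+ 2 *+ n * x); rewrite !expr2 -/a -/sa => <-.
  by rewrite addrC addKr.
have hb : sb * sb = 1 - b * b.
  have := cos2Dsin2 (pi *+ 2 *+ m * x); rewrite !expr2 -/b -/sb => <-.
  by rewrite addrC addKr.
by rewrite ha hb; field.
Qed.

(** By orthogonality the mean square of the difference is 1, and the difference is at most 2 in
    modulus, so its L^1 norm is at least 1/2. *)
Lemma wave_separated m n : (0 < m < n)%N -> 2^-1 <= nrm P 1 (fun x => wave n x - wave m x).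
Proof.
move=> /andP[m0 mn]; have n0 := ltn_trans m0 mn; have mn' := ltnW mn.
have i k := itg_wave k; have iZ k := itgZ 2^-1 (i k).
have id := itgB (i n) (i m).
rewrite nrm1E -(ler_pM2l (ltr0n R 2)) divff ?pnatr_eq0// -meanZ; last exact: itg_norm.
have i1 := itgD (iZ (n + n)%N) (iZ (m + m)%N).
have i2 := itgD (itg_cst P 1) i1.
have i3 := itgD (i (n + m)%N) (i (n - m)%N).
have E : mean P (fun x => (wave n x - wave m x) ^+ 2) = 1.
  under eq_fun do rewrite (wave_sub_sqr _ mn').
  rewrite (meanB i2 i3) (meanD (itg_cst P 1) i1) (meanD (iZ _) (iZ _)) (meanD (i _) (i _)).
  rewrite !(meanZ _ (i _)) mean_cst !mean_wave ?addn_gt0 ?n0 ?m0 ?subn_gt0//.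
  by rewrite !mulr0 !addr0 subr0.
rewrite -[leLHS]E; apply: le_mean.
- by under eq_fun do rewrite (wave_sub_sqr _ mn'); exact: itgB.
- exact/itgZ/itg_norm.
move=> x; rewrite -real_normK ?num_real// expr2; apply: ler_wpM2r => //.
apply: le_trans (ler_normB _ _) _;
by apply: le_trans (lerD (wave_le1 _ _) (wave_le1 _ _)) _; lra.
Qed.

(** Normalised in L^p, with L^1 norm (n+1)^(1/p - 1): the standard nonzero element of D. *)
Definition spike (p : R) (n : nat) (x : T) : R :=
  n.+1%:R `^ p^-1 * \1_(`[0, n.+1%:R^-1] : set R) x.

Lemma measurable_spike p n : measurable_fun setT (spike p n).
Proof. by apply: measurable_scale; exact: measurable_indic. Qed.

Lemma spike_mom p (r : R) n : 0 < r -> mom P r (spike p n) = n.+1%:R `^ (r / p - 1).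
Proof.
move=> r0; pose I : set R := `[0, n.+1%:R^-1]%classic.
have mI : measurable (I : set T) by exact: measurable_itv.
have iI : itg P (\1_I : T -> R).
  by apply: (@itg_bounded _ _ _ P _ 1) => // x; rewrite indicE; case: (_ \in _); rewrite ?normr1 ?normr0.
have h : (0 : R) < n.+1%:R by [].
rewrite momE.
have -> : (fun x => `|spike p n x| `^ r) = (fun x => n.+1%:R `^ (r / p) * \1_I x).
  apply/funext => x; rewrite /spike ger0_norm ?mulr_ge0 ?powR_ge0// powRM ?powR_ge0//.
  rewrite -powRrM [p^-1 * r]mulrC; congr (_ * _); rewrite indicE.
  by case: (_ \in _); rewrite ?powR1// powR0// gt_eqF.
rewrite meanZ// meanE /Rintegral integral_indic// setIT.
have PI : P I = (n.+1%:R^-1)%:E.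
  have -> : P I = mu I.
    congr (mu _); rewrite setIidl// => x; rewrite /I /= !in_itv/= => /andP[-> /le_trans]; apply.
    by rewrite invf_le1// ler1n.
  by rewrite lebesgue_measure_itv/= lte_fin invr_gt0 h -EFinB subr0.
have n0 : (r / p + - 1 == 0) ==> (n.+1%:R != 0 :> R) by rewrite (gt_eqF h) implybT.
by rewrite [X in fine X]PI /= (powRD n0) powR_inv1// ltW.
Qed.

End Witnesses.

(** * From L^1 to L^2 for exponents above 2 *)

Section L2.
Context d (T : measurableType d) (R : realType) (P : probability T R).
Variable U : set (set nat).
Hypothesis UU : is_ultrafilter U.

Lemma mL2_split r f (K : R) : 2 <= r -> 0 < K -> mL P r f ->
  mL P 2 f /\ mom P 2 f <= K * nrm P 1 f + K `^ (2 - r) * mom P r f.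
Proof.
move=> r2 K0 Lf; have [mf itf] := Lf; have r1 : 1 <= r by lra.
have i1 := itgZ K (itg_norm (mL_itg r1 Lf)); have i2 := itgZ (K `^ (2 - r)) itf.
have le x : `|f x| `^ 2 <= K * `|f x| + K `^ (2 - r) * `|f x| `^ r by exact: powR_split2.
have [|i h] := mean_le_dom (measurable_abs_powR 2 mf) _ (itgD i1 i2).
  by move=> x; rewrite powR_ge0 le.
split=> //; rewrite nrm1E !momE; apply: le_trans h _.
by rewrite meanD// !meanZ//; exact: itg_norm (mL_itg r1 Lf).
Qed.

Lemma null1_null2 r F : 2 < r -> bdd P r F -> nullr P U 1 F -> nullr P U 2 F.
Proof.
move=> r2 bF nF; have [LF _] := bF; have r2' := ltW r2; have r0 : 0 < r by lra.
have [C [C0 HC]] := bdd_mom r0 bF.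
apply: (ulim_to0P UU) => e e0; have q0 : 0 < e `^ 2 / 2 by rewrite divr_gt0 ?powR_gt0.
have C1 : 0 < C + 1 by rewrite ltr_wpDl.
pose c := e `^ 2 / 2 / (C + 1); have c0 : 0 < c by rewrite divr_gt0.
(* K solves K^(2-r) = c, and c times the moment bound C is at most e^2/2. This is possible because 2
   - r is not 0. *)
pose K := c `^ (2 - r)^-1; have K0 : 0 < K by rewrite powR_gt0.
have KE : K `^ (2 - r) = c by rewrite -powRrM mulVf ?powRr1 ?(ltW c0)// lt_eqF// subr_lt0.
have := ulim_toZ UU K nF; rewrite mulr0 => /(_ _ q0).
apply: (ultraS UU) => n /=; rewrite subr0 ger0_norm ?mulr_ge0 ?nrm_ge0 ?(ltW K0)// => hn.
rewrite ger0_norm ?nrm_ge0//; apply: nrm_le_mom => //; first exact: ltW.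
apply: le_trans (mL2_split r2' K0 (LF n)).2 _; rewrite [leRHS]splitr; apply: lerD; first exact: ltW.
rewrite KE /c -mulrA ler_piMr ?(ltW q0)// mulrC ler_pdivrMr// mul1r.
by apply: le_trans (HC n) _; rewrite lerDl.
Qed.

End L2.

(** * Nonzero elements, the two cases and the theorem *)

Section Conclusion.
Context (R : realType) (p : R) (p1 : (1 <= p%:E)%E) (U : set (set nat)).
Hypothesis UU : is_ultrafilter U.
Hypothesis UN : nonprincipal U.
Hypothesis US : selective U.
Notation Lf := (LfunType (mu01 R) p1).
Local Notation T := (measurableTypeR R).
Local Notation P := (P01 R).
Local Notation unull := (unull p1 U).
Variable q : R.
Hypothesis pq : conjg p q.
Let p_gt1 : 1 < p. Proof. by case: pq. Qed.
Let p_gt0' : 0 < p. Proof. exact: lt_trans p_gt1. Qed.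
Local Notation spaceD := (@hat_annih R p p1 U q (PhiE p U)).
Local Notation spaceE := (@hat_annih R p p1 U q (PhiD U q)).

Lemma spaceD_nonzero : exists F, spaceD F /\ ~ unull F.
Proof.
have M1 n : mom P p (spike p n) = 1 by rewrite spike_mom// divff ?gt_eqF// subrr powRr0.
have LS n : mL P p (spike p n).
  apply: (@mL_bounded _ _ _ P p _ (n.+1%:R `^ p^-1) (ltW p_gt0') (measurable_spike p n)) => x.
  rewrite /spike normrM ger0_norm ?powR_ge0// ler_piMr ?powR_ge0// indicE.
  by case: (_ \in _); rewrite ?normr1 ?normr0.
have N1 n : nrm P p (spike p n) = 1 by rewrite nrmE M1 powR1.
pose F n : Lf := mkLf p1 (spike p n).
have FE : raws F = spike p by apply/funext => n; exact: mkLfE.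
exists F; split; last first.
  move=> /unullP; rewrite FE => nF.
  have := ulim_to_unique UU nF (ulim_to_eq UU (ultraW UU (fun n => esym (N1 n))) (ulim_to_cst UU 1)).
  by move=> /esym/eqP; rewrite oner_eq0.
apply/(spaceDP UU UN pq); split.
  by apply/ubddP; rewrite FE; split=> //; exists 1; split=> // n; rewrite N1.
rewrite FE; apply: (ulim_to_ge UU UN) => e e0; pose a := 1 - p^-1.
have a0 : 0 < a by rewrite subr_gt0 invf_lt1.
have e1 : 0 <= e^-1 `^ a^-1 by exact: powR_ge0.
exists (Num.Def.archi_bound (e^-1 `^ a^-1)) => n Nn.
have h : e^-1 <= n.+1%:R `^ a.
  have -> : e^-1 = (e^-1 `^ a^-1) `^ a.
    by rewrite -powRrM mulVf ?gt_eqF// powRr1// invr_ge0 ltW.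
  apply: ge0_ler_powR; rewrite ?nnegrE ?(ltW a0)//.
  by apply: le_trans (ltW (archi_boundP e1)) _; rewrite ler_nat leqW.
rewrite ger0_norm ?nrm_ge0// nrmE spike_mom// invr1 powRr1 ?powR_ge0// mul1r.
by rewrite -opprB powRN -/a -[leRHS]invrK lef_pV2 ?posrE ?invr_gt0 ?powR_gt0.
Qed.

(** The waves minus their weak limit along [U], so the value of that limit need not be known. A
    norm-null sequence would have two terms of norm below 1/5, against the separation 1/2 of the
    waves. *)
Lemma spaceE_nonzero : exists F, spaceE F /\ ~ unull F.
Proof.
have mw n := @measurable_wave R n.+1; have bw n := @wave_le1 R n.+1.
have [w [wl w1]] := wlim_ubd P UU pq ler01 mw bw; have [Lw _] := wl; have [mmw _] := Lw.
have uw : ubd (fun n => @wave R n.+1) by split=> //; exists 1.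
have bdw := ubd_bdd P p_gt0' uw; have [Lwv _] := bdw.
pose G n (x : T) := wave n.+1 x - w x.
have uG : ubd G.
  split=> [n|]; first exact: measurable_funB.
  exists (1 + 1); split=> // n x; apply: le_trans (ler_normB _ _) _; exact: lerD.
have bG := ubd_bdd P p_gt0' uG; have [LG _] := bG.
pose F n : Lf := mkLf p1 (G n).
have FE : raws F = G by apply/funext => n; exact: mkLfE.
exists F; split.
  apply/(spaceEP UU UN pq); rewrite FE; split.
  - by apply/ubddP; rewrite FE.
  - split=> // e e0; exists G; split=> //; apply: (ultraW UU) => n /=.
    by under eq_fun do rewrite subrr; rewrite nrm0// ltW.
  - exact: (wnull_sub_wlim UU pq bdw wl).
move=> /unullP; rewrite FE => nG.
have e5 : 0 < 5^-1 :> R by rewrite invr_gt0.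
have UA := nG _ e5; have [m Am] := ultra_ex UU UA.
have [n [mn An]] := ultra_inf UU UN m.+1 UA.
have p_ge1' := ltW p_gt1.
have h : nrm P 1 (fun x => wave n.+1 x - wave m.+1 x) <= nrm P p (G n) + nrm P p (G m).
  apply: le_trans (nrm1_le p_ge1' (mLB p_ge1' (Lwv n) (Lwv m))) _.
  have -> : (fun x => wave n.+1 x - wave m.+1 x) = (fun x => G n x - G m x).
    by apply/funext => x; rewrite /G opprB addrA subrK.
  exact: nrmB.
have s := @wave_separated R m.+1 n.+1 mn.
move: Am An; rewrite /= !subr0 !ger0_norm ?nrm_ge0// => Am An.
by move: (nrm P p _) (nrm P p _) (nrm P 1 _) s h Am An => x y z; lra.
Qed.

Lemma one_nonzero : lpn p1 (mkLf p1 (fun=> 1)) <> 0.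
Proof.
have L1 : mL P p (fun=> 1) by apply: (@mL_bounded _ _ _ P p _ 1 (ltW p_gt0')) => // x; rewrite normr1.
rewrite lpnE mkLfE// nrmE momE; under eq_fun do rewrite normr1 powR1.
by rewrite mean_cst powR1 => /eqP; rewrite oner_eq0.
Qed.

(** For sequences bounded in L^p with p > 2, tending to 0 in L^1 and in L^2 are equivalent: one
    direction is interpolation, the other the monotonicity of norms. *)
Lemma spaceD_uM2 : 2 < p -> spaceD = uM2 p1 U.
Proof.
move=> p2; have L2 (f : Lf) : mL P 2 (rawf f) := (mL2_split (ltW p2) ltr01 (Lf_mL f)).1.
have E (F : nat -> Lf) : ulim_to U (fun n => l2n p1 (F n)) 0 = nullr P U 2 (raws F).
  by rewrite /nullr; congr ulim_to; apply/funext => n; rewrite l2nE.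
apply/seteqP; split=> F.
  move=> /(spaceDP UU UN pq)[bF nF]; split=> //; rewrite E.
  by apply: (null1_null2 UU p2) nF; apply/ubddP.
move=> [bF]; rewrite E => nF; apply/(spaceDP UU UN pq); split=> //.
apply: (ulim_to_squeeze UU) nF; apply: (ultraW UU) => n /=.
by rewrite ger0_norm ?nrm_ge0//; apply: nrm1_le; [lra|exact: L2].
Qed.

Lemma conjg22 : conjg (2 : R) 2.
Proof. by split; lra. Qed.

(** Here M = D and N = E. The functionals on E have s = s' = 2, below both target exponents p and 2,
    and 1/2 + 1/p < 1 keeps every T^U from leading from D to E. *)
Lemma dichotomy_large : 2 < p -> four_invariant_subspaces U spaceD.
Proof.
move=> p2; have [m [Dm mz]] := spaceD_nonzero; have [n [En nz]] := spaceE_nonzero.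
have p2' := ltW p2; have qp := conjg_sym pq; have c22 := conjg22.
apply: (dichotomy UU pq _ _ _ _ _ _ _ _ _ _ one_nonzero Dm mz En nz).
- exact: (bPhiD UU pq).
- exact: (bPhiE pq).
- exact: (linPhiD UU pq).
- exact: (linPhiE UU pq).
- exact: (decDE UU UN pq).
- exact: (sepD UU UN pq).
- exact: (sepE UU UN pq).
- move=> phi y Pp Dy.
  exact: (near_src_tgt UU UN US pq qp (lexx p) (srcD p1 UU UN US pq Pp) (tgtD UU UN US pq Dy)).
- move=> phi y Pp; exact: (near_hat UU UN US pq c22 p2' (lexx 2) (srcE p1 UU US pq Pp)).
move=> S phi F lS Pp DF; have [bF _] := DF.
apply: (op_src_tgt UU UN US pq _ _ _ lS (srcE p1 UU US pq Pp) bF (tgtD UU UN US pq DF)) => //.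
have : p^-1 < 2^-1 by rewrite ltf_pV2 ?posrE.
by move: (p^-1) => z; lra.
Qed.

(** Here M = E and N = D. The functionals on D have s = q and s' = p, below both target exponents p
    and 2, and 1/q + 1/2 < 1 keeps every T^U from leading from E to D. *)
Lemma dichotomy_small : p < 2 -> four_invariant_subspaces U spaceE.
Proof.
move=> p2; have [m [Dm mz]] := spaceD_nonzero; have [n [En nz]] := spaceE_nonzero.
have p2' := ltW p2; have qp := conjg_sym pq; have c22 := conjg22.
have q0 : 0 < q by case: pq => _ q1 _; exact: lt_trans q1.
apply: (dichotomy UU pq _ _ _ _ _ _ _ _ _ _ one_nonzero En nz Dm mz).
- exact: (bPhiE pq).
- exact: (bPhiD UU pq).
- exact: (linPhiE UU pq).
- exact: (linPhiD UU pq).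
- move=> F /(decDE UU UN pq)[f [m' [n' [Dm' En' h]]]]; exists f, n', m'; split=> //.
  move: h; congr unull; apply/funext => k; rewrite /Defs.seq_sub /seq_add.
  by rewrite [n' k + _]addrC.
- exact: (sepE UU UN pq).
- exact: (sepD UU UN pq).
- move=> phi y Pp Ey.
  exact: (near_src_tgt UU UN US pq c22 (lexx 2) (srcE p1 UU US pq Pp) (tgtE UU UN US pq Ey)).
- move=> phi y Pp; exact: (near_hat UU UN US pq qp (lexx p) p2' (srcD p1 UU UN US pq Pp)).
move=> S phi F lS Pp EF; have [bF _] := EF.
apply: (op_src_tgt UU UN US pq _ _ _ lS (srcD p1 UU UN US pq Pp) bF (tgtE UU UN US pq EF)) => //.
have : 2^-1 < p^-1 by rewrite ltf_pV2 ?posrE.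
case: pq => _ _; move: (p^-1) (q^-1) => z w; lra.
Qed.

End Conclusion.

Theorem theorem6p1 (R : realType) (p : R) (p1 : (1 <= p%:E)%E)
    (U : set (set nat)) :
  1 < p -> p != 2 ->
  is_ultrafilter U -> nonprincipal U -> selective U ->
  exists M : set (nat -> LfunType (mu01 R) p1),
    (* M is the unique complemented closed subspace of \hat{L^p} with the
       WOT-closure property *)
    M_property p1 U M /\
    (forall M', M_property p1 U M' -> M' = M) /\
    (* the four subspaces are proper, nonzero closed subspaces ... *)
    (forall Y, Y = uLp p1 U \/ Y = uhat p1 U \/ Y = M \/ Y = usum p1 U (uLp p1 U) M ->
       [/\ usubspace p1 U Y, Y <> uzero p1 U & Y <> ubdd p1]) /\
    (* ... which are pairwise distinct ... *)
    [/\ uLp p1 U <> uhat p1 U, uLp p1 U <> M, uLp p1 U <> usum p1 U (uLp p1 U) M,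
        uhat p1 U <> M & uhat p1 U <> usum p1 U (uLp p1 U) M] /\
    M <> usum p1 U (uLp p1 U) M /\
    (* ... and are exactly the nontrivial closed subspaces uinvariant under
       all T^U, T in B(L^p) *)
    (forall Y, usubspace p1 U Y -> Y <> uzero p1 U -> Y <> ubdd p1 ->
       ((forall T, lp_op p1 T -> uinvariant p1 Y (Tult p1 T)) <->
        (Y = uLp p1 U \/ Y = uhat p1 U \/ Y = M \/ Y = usum p1 U (uLp p1 U) M))) /\
    (* explicit description for p > 2 *)
    (2 < p -> M = uM2 p1 U).
Proof.
move=> p_gt1 p_neq2 UU UN US; have pq := conjg_conj p_gt1.
case: (ltgtP p 2) p_neq2 => // p2 _.
  have [h1 [h2 [h3 [h4 [h5 h6]]]]] := dichotomy_small p1 UU UN US pq p2.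
  by eexists; split; [exact: h1|]; do 5 split=> //.
have [h1 [h2 [h3 [h4 [h5 h6]]]]] := dichotomy_large p1 UU UN US pq p2.
eexists; split; [exact: h1|]; do 5 (split=> //).
by move=> _; exact: (spaceD_uM2 p1 UU UN pq p2).
Qed.
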